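(* Let $n=1$, and let the Baker–Akhiezer function of $W_{T_1}$ be of the form $$\Psi_{W_{T_1}}[g](z)=e^{\xi(\mathbf t,z)}\Bigl(1+\frac{\omega}{z}\Bigr),\qquad \omega=\frac{\partial A}{1-A},$$ where $g=e^{\xi(\mathbf t,\cdot)}$ and $A=A(\mathbf t)$ is the function defined in the context. Then $$\partial\omega=\frac{\partial^2A}{1-A}+\Bigl(\frac{\partial A}{1-A}\Bigr)^2$$ is a solution to the KP equation with the Lax operator $L=\partial^2-2(\partial\omega)$; that is, $\lambda_1=-\partial\omega$ satisfies $$3\,\partial_{t_2}^2\lambda_1=\partial\bigl(4\,\partial_{t_3}\lambda_1-12\,\lambda_1\partial\lambda_1-\partial^3\lambda_1\bigr).$$
   Context: **Times.** $\mathbf t=(t_1,t_2,\dots)$ are the generalized times, $\partial=\partial_{t_1}$, $\xi(\mathbf t,z)=\sum_{k\ge1}t_kz^k$, and $e^{\xi(\mathbf t,z)}=1+\sum_{k\ge1}a_kz^k$, so $a_k=S_k(t_1,\dots,t_k)$ is the $k$-th elementary homogeneous Schur polynomial. It is assumed that $\xi(\mathbf t,\cdot)$ is holomorphic in the unit disk $\mathbb D$ and smooth on its closure $\hat{\mathbb D}$, and all identities are considered where $1-A\neq0$. **The function $A$.** Fix $f(z)=z\bigl(1+\sum_{n\ge1}c_nz^n\bigr)$, holomorphic and univalent in $\mathbb D$, $C^\infty$ on $\hat{\mathbb D}$, and a smooth embedding of $\hat{\mathbb D}$ into $\mathbb C$ (so $f'\ne0$ on $\hat{\mathbb D}$); put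 $c_0=1$. Let $H_+$ be the space of smooth functions $\sum_{k\ge0}x_{k+1}z^k$ on $S^1$, identified with their coefficient sequences $(x_1,x_2,\dots)$, and let $\bar C_{1,1}$ be the invertible operator on $H_+$ given by the upper triangular matrix $$(\bar C_{1,1}x)_k=\sum_{j\ge0}(j+1)\,\overline{c_j}\,x_{k+j},\qquad k\ge1.$$ Then $A(\mathbf t)=\sum_{k\ge1}k\,\overline{c_k}\,x_k$, where $x=\bar C_{1,1}^{-1}(a_1,a_2,a_3,\dots)$. (Likewise $\partial A=B:=\sum_{k\ge1}k\,\overline{c_k}\,y_k$ with $y=\bar C_{1,1}^{-1}(1,a_1,a_2,\dots)$.) **The space $W_{T_1}$ and the Baker–Akhiezer function.** $W_{T_1}$ is the closed linear span, in the space of smooth functions on $S^1$ with the $L^2$ inner product, of $$e_k=\sum_{j=0}^k(j+1)\overline{c_j}\,z^{k-j}+(k+1)\,\overline{c_{k+1}}\,z^{-1},\qquad k=0,1,2,\dots.$$ With $H_-$ the closed span of $\{z^k:k\le-1\}$, for $g$ such that $g^{-1}W$ is transverse to $H_-$ the Baker–Akhiezer function $\Psi_W[g]$ is the unique element of $W$ of the form $g(z)\bigl(1+\sum_{k\ge1}\omega_kz^{-k}\bigr)$. **KP equation.** For a Lax operator $L=\partial^2+2\lambda_1$ the KP equation is $3\partial_{t_2}^2\lambda_1=\partial(4\partial_{t_3}\lambda_1-12\lambda_1\partial\lambda_1-\partial^3\lambda_1)$. *)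

(* Defs.v *)
From Stdlib Require Import Reals ZArith ClassicalEpsilon.
From Coquelicot Require Import Coquelicot.
Open Scope R_scope.

Definition cis (theta : R) : C := (cos theta, sin theta).

Definition Cexp (z : C) : C := (RtoC (exp (Re z)) * cis (Im z))%C.

(* Sum of a complex series; as for [Series], only meaningful if it converges. *)
Definition CSeries (u : nat -> C) : C :=
  (Series (fun k => Re (u k)), Series (fun k => Im (u k))).

(* [F n] is holomorphic in the open disk with derivative [F (S n)], and
   continuous on the closed disk: the [F n] are the continuous extensions
   of the complex derivatives of [f] to the closed disk. *)
Definition closed_disk_derivatives (f : C -> C) (F : nat -> C -> C) : Prop :=
  (forall z, Cmod z <= 1 -> F 0%nat z = f z) /\
  (forall n z, Cmod z < 1 ->
     is_derive (K := C_AbsRing) (V := C_NormedModule) (F n) z (F (S n) z)) /\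
  (forall n z, Cmod z <= 1 ->
     filterlim (F n) (within (fun w : C => Cmod w <= 1) (locally z))
               (locally (F n z))).

(* Holomorphic in the open disk and C^infinity on the closed disk. *)
Definition holomorphic_smooth (f : C -> C) : Prop :=
  exists F, closed_disk_derivatives f F.

(* [f z = z (1 + sum_(n >= 1) c_n z^n)] is holomorphic in the open disk,
   C^infinity on the closed disk, and a smooth embedding of the closed disk.
   The real differential of a holomorphic function is multiplication by its
   derivative, so being an immersion means that the derivative does not
   vanish; a continuous injection of the (compact) closed disk is
   automatically a homeomorphism onto its image. *)
Definition univalent_embedding (f : C -> C) (c : nat -> C) : Prop :=
  c 0%nat = RtoC 1 /\
  (forall z, Cmod z < 1 -> exists s : C,
     is_pseries (K := C_AbsRing) (V := C_NormedModule) c z s /\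
     f z = (z * s)%C) /\
  (forall z w, Cmod z <= 1 -> Cmod w <= 1 -> f z = f w -> z = w) /\
  (exists F, closed_disk_derivatives f F /\
     forall z, Cmod z <= 1 -> F 1%nat z <> RtoC 0).

(* A function on the circle is represented by a function on [C], of which
   only the values at the points [cis theta] are relevant. *)
Definition eq_circle (g h : C -> C) : Prop :=
  forall theta, g (cis theta) = h (cis theta).

Definition smooth_circle (h : C -> C) : Prop :=
  forall (n : nat) (theta : R),
    ex_derive_n (fun u => Re (h (cis u))) n theta /\
    ex_derive_n (fun u => Im (h (cis u))) n theta.

Definition fourier (h : C -> C) (n : Z) : C :=
  (RtoC (/ (2 * PI)) *
   RInt (V := C_R_CompleteNormedModule)
     (fun theta => h (cis theta) * cis (- (IZR n * theta)))%C 0%R (2 * PI)%R)%C.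

Definition L2norm (h : C -> C) : R :=
  sqrt (/ (2 * PI) * RInt (fun theta => (Cmod (h (cis theta)))^2) 0 (2 * PI)).

(* Closed linear span of [b 0, b 1, ...] in the space of smooth functions on
   the circle with the L^2 inner product. *)
Definition closed_span (b : nat -> C -> C) (h : C -> C) : Prop :=
  smooth_circle h /\
  forall eps : R, 0 < eps -> exists (N : nat) (x : nat -> C),
    L2norm (fun z => h z - sum_n (G := C_AbelianGroup)
                             (fun k => x k * b k z) N)%C < eps.

Definition Hminus : (C -> C) -> Prop :=
  closed_span (fun k z => / z ^ (k + 1))%C.

(* The space H_+ identified with coefficient sequences (x_1, x_2, ...), where
   x_(k+1) is the coefficient of z^k; the entry [x 0] is not used. *)
Definition Hplus (x : nat -> C) : Prop :=
  exists h, smooth_circle h /\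
    (forall k : nat, fourier h (Z.of_nat k) = x (S k)) /\
    (forall k : nat, fourier h (- Z.of_nat (S k))%Z = RtoC 0).

(* A sequence of times is [t : nat -> C] with [t k] standing for t_k, k >= 1;
   the entry [t 0] is not used. *)
Definition xi_coeff (t : nat -> C) (k : nat) : C :=
  match k with O => RtoC 0 | S _ => t k end.

Definition xi (t : nat -> C) (z : C) : C :=
  CSeries (fun k => xi_coeff t k * z ^ k)%C.

(* The series xi(t, .) converges in the open disk to a function that is
   holomorphic there and smooth on the closed disk. *)
Definition admissible_times (t : nat -> C) : Prop :=
  exists G, holomorphic_smooth G /\
    forall z, Cmod z < 1 ->
      is_pseries (K := C_AbsRing) (V := C_NormedModule) (xi_coeff t) z (G z).

(* Coefficient of z^k in xi(t,z)^n. *)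
Fixpoint xi_pow_coeff (t : nat -> C) (n k : nat) : C :=
  match n with
  | O => match k with O => RtoC 1 | S _ => RtoC 0 end
  | S m => sum_n (G := C_AbelianGroup)
             (fun j => xi_coeff t j * xi_pow_coeff t m (k - j))%C k
  end.

(* The elementary Schur polynomial S_k(t_1, ..., t_k): the coefficient of z^k
   in exp(xi(t,z)) = sum_n xi(t,z)^n / n!. The terms with n > k do not
   contribute since xi(t,z) has no constant term. *)
Definition schur (t : nat -> C) (k : nat) : C :=
  sum_n (G := C_AbelianGroup)
    (fun n => xi_pow_coeff t n k / RtoC (INR (Factorial.fact n)))%C k.

(* Partial derivative with respect to the complex variable t_k. *)
Definition shift_time (t : nat -> C) (k : nat) (s : C) : nat -> C :=
  fun m => if Nat.eqb m k then (t m + s)%C else t m.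

Definition ex_pd (k : nat) (F : (nat -> C) -> C) (t : nat -> C) : Prop :=
  ex_derive (K := C_AbsRing) (V := C_NormedModule)
    (fun s => F (shift_time t k s)) (RtoC 0).

Definition pd (k : nat) (F : (nat -> C) -> C) (t : nat -> C) : C :=
  C_derive (fun s => F (shift_time t k s)) (RtoC 0).

Definition C11 (c x : nat -> C) (k : nat) : C :=
  CSeries (fun j => RtoC (INR (j + 1)) * Cconj (c j) * x (k + j)%nat)%C.

(* The inverse of [C11 c] on H_+. *)
Definition C11_inv (c y : nat -> C) : nat -> C :=
  epsilon (inhabits (fun _ => RtoC 0))
    (fun x => Hplus x /\ forall k, (1 <= k)%nat -> C11 c x k = y k).

(* The term of index 0 vanishes, so the sum is over k >= 1. *)
Definition A_fun (c : nat -> C) (t : nat -> C) : C :=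
  let x := C11_inv c (schur t) in
  CSeries (fun k => RtoC (INR k) * Cconj (c k) * x k)%C.

Definition omega (c : nat -> C) (t : nat -> C) : C :=
  (pd 1 (A_fun c) t / (1 - A_fun c t))%C.

(* The times at which identities are considered. *)
Definition regular_times (c : nat -> C) (t : nat -> C) : Prop :=
  admissible_times t /\ (1 - A_fun c t)%C <> RtoC 0.

Definition W_basis (c : nat -> C) (k : nat) (z : C) : C :=
  (sum_n (G := C_AbelianGroup)
     (fun j => RtoC (INR (j + 1)) * Cconj (c j) * z ^ (k - j)) k
   + RtoC (INR (k + 1)) * Cconj (c (k + 1)%nat) / z)%C.

Definition W_T1 (c : nat -> C) : (C -> C) -> Prop := closed_span (W_basis c).

(* The space of smooth functions on the circle is the direct sum of [U]
   and [V]. *)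
Definition transverse (U V : (C -> C) -> Prop) : Prop :=
  forall h, smooth_circle h ->
    exists u v, U u /\ V v /\ eq_circle h (fun z => u z + v z)%C /\
      forall u' v', U u' -> V v' -> eq_circle h (fun z => u' z + v' z)%C ->
        eq_circle u' u /\ eq_circle v' v.

(* Membership in [g^-1 W], for [g] without zeros on the circle. *)
Definition inv_mult (g : C -> C) (W : (C -> C) -> Prop) : (C -> C) -> Prop :=
  fun u => W (fun z => g z * u z)%C.

(* [psi] is in [W] and of the form [g(z) (1 + sum_(k >= 1) omega_k z^-k)]. *)
Definition BA_form (W : (C -> C) -> Prop) (g psi : C -> C) : Prop :=
  W psi /\ exists v, Hminus v /\ eq_circle psi (fun z => g z * (1 + v z))%C.

Definition is_Baker_Akhiezer (W : (C -> C) -> Prop) (g psi : C -> C) : Prop :=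
  transverse (inv_mult g W) Hminus /\
  BA_form W g psi /\
  forall psi', BA_form W g psi' -> eq_circle psi' psi.

Definition KP_flux (lam : (nat -> C) -> C) (t : nat -> C) : C :=
  (4 * pd 3 lam t - 12 * lam t * pd 1 lam t - pd 1 (pd 1 (pd 1 lam)) t)%C.

(* [lam] is a solution on [D] of the KP equation for the Lax operator
   d^2 + 2 lam; all the derivatives that occur are required to exist. *)
Definition KP_solution (D : (nat -> C) -> Prop) (lam : (nat -> C) -> C) : Prop :=
  forall t, D t ->
    ex_pd 2 lam t /\ ex_pd 2 (pd 2 lam) t /\
    ex_pd 3 lam t /\
    ex_pd 1 lam t /\ ex_pd 1 (pd 1 lam) t /\ ex_pd 1 (pd 1 (pd 1 lam)) t /\
    ex_pd 1 (KP_flux lam) t /\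
    (3 * pd 2 (pd 2 lam) t = pd 1 (KP_flux lam) t)%C.

(* Main.v *)
Require Import Defs.
From Stdlib Require Import Reals Lra Lia ZArith ClassicalEpsilon FunctionalExtensionality.
From Coquelicot Require Import Coquelicot.
Open Scope R_scope.

(** Write [A = sum_m L_m a_m] with [L] bounded: the operator [C11] is the
   Toeplitz operator with symbol [conj f'], its inverse has symbol
   [conj (1/f')], and the Taylor coefficients of [1/f'] are absolutely summable
   since [f'] has no zero on the closed disk.  As [d/dt_k exp(xi) = z^k exp(xi)],
   the functions [A_n = sum_m L_m [z^m] (z^n exp(xi))] satisfy
   [d_k A_n = A_(n+k)]; in particular [tau = 1 - A] solves [d_k tau = d_1^k tau].
   The ratios [w_n = A_n / (1 - A)] then satisfy [d_k w_n = w_(n+k) + w_n w_k],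
   so that [omega = w_1], and the KP equation for [- (w_2 + w_1^2)] is a
   polynomial identity in the [w_n]. *)

(** * Sums, convolution and complex series *)

(** The formal inverse of the series of [f'] represents [1/f'] on a circle only once it is known to
    converge absolutely there, so its summability up to the boundary cannot be read off directly
    from the smoothness of [1/f']. The circularity is broken by moving the radius: absolute
    convergence on one circle spreads to slightly larger ones, and an a priori bound from two
    derivatives of [1/f'] keeps the step size fixed. [C11_inv] is a choice of preimage in H_+, so it
    carries information only once a preimage exists and its entries of positive index are unique.
    Existence uses the rapid decrease of the coefficients of [exp(xi)], which comes from the
    smoothness of [xi] on the closed disk; uniqueness uses only bounded entries, because both
    Toeplitz symbols are absolutely summable. Differentiability in a time is a norm estimate: in l1,
    [exp(xi + s z^k)] differs from its linear part in [s] by at most a constant times [|s|^2], and a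
    bounded functional preserves such an estimate. *)

Notation csum := (sum_n (G := C_AbelianGroup)).
Notation rsum := (sum_n (G := R_AbelianGroup)).

Definition conv (u v : nat -> C) (m : nat) : C :=
  csum (fun j => u j * v (m - j)%nat)%C m.

(** Summability and a bound on the norm are carried together, so estimates combine without separate
    convergence proofs. *)
Definition l1_bound (u : nat -> C) (M : R) : Prop :=
  forall N, rsum (fun k => Cmod (u k)) N <= M.

Definition delta (n : nat) : C := match n with O => RtoC 1 | S _ => RtoC 0 end.

Lemma csum_S (u : nat -> C) N : csum u (S N) = (csum u N + u (S N))%C.
Proof. exact (sum_Sn u N). Qed.

Lemma rsum_S (u : nat -> R) N : rsum u (S N) = rsum u N + u (S N).
Proof. exact (sum_Sn u N). Qed.

Lemma csum_O (u : nat -> C) : csum u 0 = u O.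
Proof. exact (sum_O u). Qed.

Lemma rsum_O (u : nat -> R) : rsum u 0 = u O.
Proof. exact (sum_O u). Qed.

Lemma csum_ext (u v : nat -> C) N :
  (forall n, (n <= N)%nat -> u n = v n) -> csum u N = csum v N.
Proof. exact (sum_n_ext_loc u v N). Qed.

Lemma rsum_ext (u v : nat -> R) N :
  (forall n, (n <= N)%nat -> u n = v n) -> rsum u N = rsum v N.
Proof. exact (sum_n_ext_loc u v N). Qed.

Lemma csum_plus (u v : nat -> C) N :
  csum (fun n => u n + v n)%C N = (csum u N + csum v N)%C.
Proof. exact (sum_n_plus u v N). Qed.

Lemma csum_mult_l (a : C) (u : nat -> C) N :
  csum (fun n => a * u n)%C N = (a * csum u N)%C.
Proof. exact (sum_n_mult_l (K := C_Ring) a u N). Qed.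

Lemma csum_mult_r (a : C) (u : nat -> C) N :
  csum (fun n => u n * a)%C N = (csum u N * a)%C.
Proof. exact (sum_n_mult_r (K := C_Ring) a u N). Qed.

Lemma rsum_mult_l (a : R) (u : nat -> R) N :
  rsum (fun n => a * u n) N = a * rsum u N.
Proof. exact (sum_n_mult_l (K := R_Ring) a u N). Qed.

Lemma rsum_mult_r (a : R) (u : nat -> R) N :
  rsum (fun n => u n * a) N = rsum u N * a.
Proof. exact (sum_n_mult_r (K := R_Ring) a u N). Qed.

Lemma csum_minus (u v : nat -> C) N :
  csum (fun n => u n - v n)%C N = (csum u N - csum v N)%C.
Proof.
  replace (csum u N - csum v N)%C with (csum u N + (-1) * csum v N)%C by ring.
  rewrite <- csum_mult_l, <- csum_plus. apply csum_ext. intros. ring.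
Qed.

Lemma rsum_le (u v : nat -> R) N :
  (forall n, (n <= N)%nat -> u n <= v n) -> rsum u N <= rsum v N.
Proof.
  induction N as [|N IH]; intros H.
  - rewrite !rsum_O. auto.
  - rewrite !rsum_S. apply Rplus_le_compat; [apply IH; intros|]; auto.
Qed.

Lemma rsum_nonneg (u : nat -> R) N :
  (forall n, (n <= N)%nat -> 0 <= u n) -> 0 <= rsum u N.
Proof.
  induction N as [|N IH]; intros H.
  - rewrite rsum_O. auto.
  - rewrite rsum_S. apply Rplus_le_le_0_compat; [apply IH; intros|]; auto.
Qed.

Lemma rsum_incr (u : nat -> R) N N' :
  (forall n, 0 <= u n) -> (N <= N')%nat -> rsum u N <= rsum u N'.
Proof.
  intros H. induction 1 as [|N' _ IH]; [lra|].
  rewrite rsum_S. specialize (H (S N')). lra.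
Qed.

Lemma rsum_term (u : nat -> R) N n :
  (forall n, 0 <= u n) -> (n <= N)%nat -> u n <= rsum u N.
Proof.
  intros H Hn. apply Rle_trans with (rsum u n); [|now apply rsum_incr].
  destruct n; [rewrite rsum_O; lra|rewrite rsum_S].
  assert (0 <= rsum u n) by (apply rsum_nonneg; auto). lra.
Qed.

Lemma Cmod_csum (u : nat -> C) N :
  Cmod (csum u N) <= rsum (fun n => Cmod (u n)) N.
Proof. exact (norm_sum_n_m (K := C_AbsRing) (V := C_NormedModule) u 0 N). Qed.

(** Antidiagonals against rows of a triangle; general in the group so that it serves complex terms
    and their moduli alike. *)
Lemma sum_n_triangle {G : AbelianGroup} (F : nat -> nat -> G) N :
  sum_n (fun m => sum_n (fun j => F j (m - j)%nat) m) N
  = sum_n (fun j => sum_n (F j) (N - j)) N.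
Proof.
  induction N as [|N IH].
  - now rewrite !sum_O.
  - rewrite (sum_Sn (fun j => sum_n (F j) _)), sum_Sn, IH.
    replace (S N - S N)%nat with O by lia. rewrite sum_O.
    rewrite (sum_n_ext_loc (fun j => sum_n (F j) (S N - j))
               (fun j => plus (sum_n (F j) (N - j)) (F j (S N - j)%nat))).
    + rewrite sum_n_plus, <- plus_assoc. f_equal.
      rewrite sum_Sn. replace (S N - S N)%nat with O by lia. reflexivity.
    + intros n Hn. replace (S N - n)%nat with (S (N - n)) by lia. apply sum_Sn.
Qed.

Lemma csum_triangle (F : nat -> nat -> C) N :
  csum (fun m => csum (fun j => F j (m - j)%nat) m) N
  = csum (fun j => csum (F j) (N - j)) N.
Proof. apply sum_n_triangle. Qed.

Lemma rsum_triangle (F : nat -> nat -> R) N :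
  rsum (fun m => rsum (fun j => F j (m - j)%nat) m) N
  = rsum (fun j => rsum (F j) (N - j)) N.
Proof. exact (sum_n_triangle (G := R_AbelianGroup) F N). Qed.

Lemma csum_rev (u : nat -> C) N : csum u N = csum (fun k => u (N - k)%nat) N.
Proof.
  revert u. induction N as [|N IH]; intros u.
  - rewrite !csum_O. reflexivity.
  - rewrite csum_S, IH. unfold sum_n at 2.
    rewrite (sum_Sn_m (G := C_AbelianGroup)) by lia.
    rewrite <- (sum_n_m_S (G := C_AbelianGroup)).
    replace (S N - 0)%nat with (S N) by lia.
    change (csum (fun k => u (N - k)%nat) N + u (S N) = u (S N) + csum (fun k => u (S N - S k)%nat) N)%C.
    rewrite Cplus_comm. f_equal.
Qed.

Lemma conv_comm (u v : nat -> C) m : conv u v m = conv v u m.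
Proof.
  unfold conv. rewrite csum_rev. apply csum_ext. intros n Hn.
  replace (m - (m - n))%nat with n by lia. ring.
Qed.

Lemma conv_assoc (u v w : nat -> C) m :
  conv (conv u v) w m = conv u (conv v w) m.
Proof.
  unfold conv.
  rewrite (csum_ext _ (fun k => csum (fun j => u j * v (k - j)%nat
              * w (m - (j + (k - j)))%nat)%C k)).
  - rewrite (csum_triangle (fun j i => u j * v i * w (m - (j + i))%nat)%C).
    apply csum_ext. intros j Hj. rewrite <- csum_mult_l. apply csum_ext.
    intros i Hi. replace (m - (j + i))%nat with (m - j - i)%nat by lia. ring.
  - intros k Hk. rewrite <- csum_mult_r. apply csum_ext. intros j Hj.
    now replace (j + (k - j))%nat with k by lia.
Qed.

Lemma conv_ext (u u' v v' : nat -> C) m :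
  (forall n, (n <= m)%nat -> u n = u' n) ->
  (forall n, (n <= m)%nat -> v n = v' n) -> conv u v m = conv u' v' m.
Proof.
  intros H H'. apply csum_ext. intros n Hn. rewrite H, H' by lia. reflexivity.
Qed.

Lemma conv_delta_l (u : nat -> C) m : conv delta u m = u m.
Proof.
  unfold conv.
  assert (H : forall n, csum (fun j => delta j * u (m - j)%nat)%C n = u m).
  { induction n as [|n IH].
    - rewrite csum_O. simpl. replace (m - 0)%nat with m by lia. ring.
    - rewrite csum_S, IH. simpl. ring. }
  apply H.
Qed.

Lemma conv_delta_r (u : nat -> C) m : conv u delta m = u m.
Proof. rewrite conv_comm. apply conv_delta_l. Qed.

Lemma conv_plus_l (u u' v : nat -> C) m :
  conv (fun n => u n + u' n)%C v m = (conv u v m + conv u' v m)%C.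
Proof. unfold conv. rewrite <- csum_plus. apply csum_ext. intros. ring. Qed.

Lemma conv_minus_l (u u' v : nat -> C) m :
  conv (fun n => u n - u' n)%C v m = (conv u v m - conv u' v m)%C.
Proof. unfold conv. rewrite <- csum_minus. apply csum_ext. intros. ring. Qed.

Lemma conv_scal_l (a : C) (u v : nat -> C) m :
  conv (fun n => a * u n)%C v m = (a * conv u v m)%C.
Proof. unfold conv. rewrite <- csum_mult_l. apply csum_ext. intros. ring. Qed.

Lemma rsum_triangle_le (F : nat -> nat -> R) N :
  (forall j i, 0 <= F j i) ->
  rsum (fun m => rsum (fun j => F j (m - j)%nat) m) N
  <= rsum (fun j => rsum (F j) N) N.
Proof.
  intros H. rewrite rsum_triangle. apply rsum_le. intros n Hn.
  apply rsum_incr; [auto|lia].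
Qed.

Lemma l1_bound_nonneg (u : nat -> C) M : l1_bound u M -> 0 <= M.
Proof.
  intros H. specialize (H O). rewrite rsum_O in H.
  pose proof (Cmod_ge_0 (u O)). lra.
Qed.

Lemma l1_bound_term (u : nat -> C) M n : l1_bound u M -> Cmod (u n) <= M.
Proof.
  intros H. eapply Rle_trans; [|apply (H n)].
  apply (rsum_term (fun k => Cmod (u k))); [intros; apply Cmod_ge_0|lia].
Qed.

Lemma l1_bound_ext (u v : nat -> C) M :
  (forall n, Cmod (u n) = Cmod (v n)) -> l1_bound u M -> l1_bound v M.
Proof.
  intros E H N. rewrite (rsum_ext _ (fun k => Cmod (u k))); auto.
Qed.

Lemma l1_bound_mono (u v : nat -> C) M :
  (forall n, Cmod (v n) <= Cmod (u n)) -> l1_bound u M -> l1_bound v M.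
Proof.
  intros E H N. eapply Rle_trans; [|apply (H N)]. apply rsum_le. auto.
Qed.

(** The first [N + 1] coefficients of a product involve only those of the factors, so the norm
    inequality already holds for partial sums. This allows it to be applied to a factor not yet
    known to be summable. *)
Lemma conv_bound_upto (u v : nat -> C) N :
  rsum (fun m => Cmod (conv u v m)) N
  <= rsum (fun k => Cmod (u k)) N * rsum (fun k => Cmod (v k)) N.
Proof.
  apply Rle_trans with
    (rsum (fun m => rsum (fun j => Cmod (u j) * Cmod (v (m - j)%nat)) m) N).
  - apply rsum_le. intros m Hm. eapply Rle_trans; [apply Cmod_csum|].
    apply rsum_le. intros. rewrite Cmod_mult. lra.
  - eapply Rle_trans.
    { apply (rsum_triangle_le (fun j i => Cmod (u j) * Cmod (v i))).
      intros; apply Rmult_le_pos; apply Cmod_ge_0. }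
    rewrite <- rsum_mult_r. apply rsum_le. intros j Hj.
    rewrite rsum_mult_l. lra.
Qed.

Lemma rsum_Cmod_nonneg (u : nat -> C) N : 0 <= rsum (fun k => Cmod (u k)) N.
Proof. apply rsum_nonneg. intros; apply Cmod_ge_0. Qed.

Lemma l1_bound_conv (u v : nat -> C) M M' :
  l1_bound u M -> l1_bound v M' -> l1_bound (conv u v) (M * M').
Proof.
  intros H H' N. eapply Rle_trans; [apply conv_bound_upto|].
  apply Rmult_le_compat; auto using rsum_Cmod_nonneg.
Qed.

Lemma ex_series_nonneg (a : nat -> R) M :
  (forall n, 0 <= a n) -> (forall N, rsum a N <= M) -> ex_series a.
Proof.
  intros H HM. destruct (ex_finite_lim_seq_incr (rsum a) M) as [l Hl].
  - intros n. rewrite rsum_S. specialize (H (S n)). lra.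
  - exact HM.
  - exists l. exact Hl.
Qed.

Definition is_Cseries (u : nat -> C) (l : C) : Prop :=
  is_series (fun k => Re (u k)) (Re l) /\ is_series (fun k => Im (u k)) (Im l).

Lemma is_Cseries_unique u l : is_Cseries u l -> CSeries u = l.
Proof.
  intros [H H']. unfold CSeries. apply is_series_unique in H, H'.
  rewrite H, H'. now destruct l.
Qed.

Lemma Re_csum (u : nat -> C) N : Re (csum u N) = rsum (fun k => Re (u k)) N.
Proof.
  induction N as [|N IH]; [now rewrite csum_O, rsum_O|].
  rewrite csum_S, rsum_S, <- IH. reflexivity.
Qed.

Lemma Im_csum (u : nat -> C) N : Im (csum u N) = rsum (fun k => Im (u k)) N.
Proof.
  induction N as [|N IH]; [now rewrite csum_O, rsum_O|].
  rewrite csum_S, rsum_S, <- IH. reflexivity.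
Qed.

Lemma Rabs_Re_le (z : C) : Rabs (Re z) <= Cmod z.
Proof. apply re_le_Cmod. Qed.

Lemma Rabs_Im_le (z : C) : Rabs (Im z) <= Cmod z.
Proof. eapply Rle_trans; [apply Rmax_r|apply (Rmax_Cmod z)]. Qed.

Lemma Cmod_le_Re_Im (z : C) : Cmod z <= Rabs (Re z) + Rabs (Im z).
Proof.
  replace z with (RtoC (Re z) + Ci * RtoC (Im z))%C at 1.
  - eapply Rle_trans; [apply Cmod_triangle|].
    rewrite Cmod_mult, Cmod_Ci, !Cmod_R. lra.
  - destruct z as [x y]. unfold Ci, Cplus, Cmult, RtoC; simpl. f_equal; ring.
Qed.

Lemma is_Cseries_iff (u : nat -> C) (l : C) :
  is_Cseries u l <-> is_lim_seq (fun N => Cmod (csum u N - l)) 0.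
Proof.
  assert (E1 : forall N, Re (csum u N - l)%C = rsum (fun k => Re (u k)) N - Re l).
  { intros. rewrite <- Re_csum. unfold Re, Cminus, Cplus, Copp; simpl. lra. }
  assert (E2 : forall N, Im (csum u N - l)%C = rsum (fun k => Im (u k)) N - Im l).
  { intros. rewrite <- Im_csum. unfold Im, Cminus, Cplus, Copp; simpl. lra. }
  split.
  - intros [H H'].
    change (is_lim_seq (rsum (fun k => Re (u k))) (Re l)) in H.
    change (is_lim_seq (rsum (fun k => Im (u k))) (Im l)) in H'.
    apply is_lim_seq_le_le with (fun _ => 0)
      (fun N => Rabs (Re (csum u N - l)%C) + Rabs (Im (csum u N - l)%C)).
    + intros n. split; [apply Cmod_ge_0|apply Cmod_le_Re_Im].
    + apply is_lim_seq_const.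
    + replace (Finite 0) with (Finite (0 + 0)) by (f_equal; lra).
      apply is_lim_seq_plus'.
      * apply is_lim_seq_ext with (fun N => Rabs (rsum (fun k => Re (u k)) N - Re l)).
        { intros. now rewrite E1. }
        replace (Finite 0) with (Rbar_abs (Finite (Re l - Re l))) by (simpl; f_equal; rewrite Rminus_diag; apply Rabs_R0).
        apply is_lim_seq_abs. apply is_lim_seq_minus'; auto using is_lim_seq_const.
      * apply is_lim_seq_ext with (fun N => Rabs (rsum (fun k => Im (u k)) N - Im l)).
        { intros. now rewrite E2. }
        replace (Finite 0) with (Rbar_abs (Finite (Im l - Im l))) by (simpl; f_equal; rewrite Rminus_diag; apply Rabs_R0).
        apply is_lim_seq_abs. apply is_lim_seq_minus'; auto using is_lim_seq_const.
  - intros H. split.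
    + change (is_lim_seq (rsum (fun k => Re (u k))) (Re l)).
      apply is_lim_seq_ext with (fun N => (rsum (fun k => Re (u k)) N - Re l) + Re l); [intros; lra|].
      replace (Finite (Re l)) with (Finite (0 + Re l)) by (f_equal; lra).
      apply is_lim_seq_plus'; [|apply is_lim_seq_const].
      apply is_lim_seq_abs_0.
      apply is_lim_seq_le_le with (fun _ => 0) (fun N => Cmod (csum u N - l)); auto using is_lim_seq_const.
      intros n. rewrite <- E1. split; [apply Rabs_pos|apply Rabs_Re_le].
    + change (is_lim_seq (rsum (fun k => Im (u k))) (Im l)).
      apply is_lim_seq_ext with (fun N => (rsum (fun k => Im (u k)) N - Im l) + Im l); [intros; lra|].
      replace (Finite (Im l)) with (Finite (0 + Im l)) by (f_equal; lra).
      apply is_lim_seq_plus'; [|apply is_lim_seq_const].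
      apply is_lim_seq_abs_0.
      apply is_lim_seq_le_le with (fun _ => 0) (fun N => Cmod (csum u N - l)); auto using is_lim_seq_const.
      intros n. rewrite <- E2. split; [apply Rabs_pos|apply Rabs_Im_le].
Qed.

Lemma is_Cseries_l1 (u : nat -> C) M : l1_bound u M -> is_Cseries u (CSeries u).
Proof.
  intros H.
  assert (E : ex_series (fun k => Cmod (u k))).
  { apply ex_series_nonneg with M; [intros; apply Cmod_ge_0|exact H]. }
  split; apply Series_correct;
    apply (ex_series_le (K := R_AbsRing) (V := R_CompleteNormedModule)) with (fun k => Cmod (u k)); auto;
    intros n; [apply Rabs_Re_le|apply Rabs_Im_le].
Qed.

Lemma Cmod_lim_le (u : nat -> C) (l : C) M :
  is_lim_seq (fun N => Cmod (u N - l)) 0 -> (forall N, Cmod (u N) <= M) -> Cmod l <= M.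
Proof.
  intros H HM.
  assert (E : Rbar_le (Cmod l) (Finite (0 + M))).
  { apply (is_lim_seq_le (fun _ => Cmod l) (fun N => Cmod (u N - l) + M)).
    - intros n. replace l with (- (u n - l) + u n)%C at 1 by ring.
      eapply Rle_trans; [apply Cmod_triangle|]. rewrite Cmod_opp. specialize (HM n). lra.
    - apply is_lim_seq_const.
    - apply is_lim_seq_plus'; auto using is_lim_seq_const. }
  simpl in E. lra.
Qed.

Lemma Cmod_CSeries_le (u : nat -> C) M : l1_bound u M -> Cmod (CSeries u) <= M.
Proof.
  intros H. apply (Cmod_lim_le (csum u)).
  - apply is_Cseries_iff, is_Cseries_l1 with M, H.
  - intros N. eapply Rle_trans; [apply Cmod_csum|apply H].
Qed.

Lemma Cmod_CSeries_tail (u : nat -> C) M N :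
  l1_bound u M ->
  Cmod (CSeries u - csum u N) <= Series (fun k => Cmod (u k)) - rsum (fun k => Cmod (u k)) N.
Proof.
  intros H.
  assert (E : ex_series (fun k => Cmod (u k))).
  { apply ex_series_nonneg with M; [intros; apply Cmod_ge_0|exact H]. }
  apply (Cmod_lim_le (fun n => (csum u (n + S N) - csum u N)%C)).
  - pose proof (proj1 (is_Cseries_iff _ _) (is_Cseries_l1 u M H)) as L.
    apply (is_lim_seq_incr_n _ (S N)) in L.
    apply is_lim_seq_ext with (2 := L). intros n. simpl. f_equal. ring.
  - intros n.
    assert (A : forall m, (csum u (m + S N) - csum u N)%C = csum (fun k => u (k + S N)%nat) m).
    { induction m as [|m IH].
      - simpl. rewrite csum_S, csum_O. simpl. ring.
      - simpl. rewrite csum_S, csum_S, <- IH. simpl. ring. }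
    assert (B : forall m, rsum (fun k => Cmod (u (k + S N)%nat)) m
                 = rsum (fun k => Cmod (u k)) (m + S N) - rsum (fun k => Cmod (u k)) N).
    { induction m as [|m IH].
      - simpl. rewrite rsum_S, rsum_O. simpl. lra.
      - simpl. rewrite rsum_S, rsum_S, IH. simpl. lra. }
    rewrite A. eapply Rle_trans; [apply Cmod_csum|]. rewrite B.
    enough (rsum (fun k => Cmod (u k)) (n + S N) <= Series (fun k => Cmod (u k))) by lra.
    apply (is_lim_seq_incr_compare (rsum (fun k => Cmod (u k)))).
    + apply Series_correct, E.
    + intros m. rewrite rsum_S. pose proof (Cmod_ge_0 (u (S m))). lra.
Qed.

Lemma l1_bound_mult (u w : nat -> C) M W :
  l1_bound u M -> (forall n, Cmod (w n) <= W) -> l1_bound (fun n => u n * w n)%C (M * W).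
Proof.
  intros H HW N. apply Rle_trans with (rsum (fun k => Cmod (u k) * W) N).
  - apply rsum_le. intros. rewrite Cmod_mult.
    apply Rmult_le_compat_l; auto using Cmod_ge_0.
  - rewrite rsum_mult_r. apply Rmult_le_compat_r; auto.
    eapply Rle_trans; [apply (Cmod_ge_0 (w O))|auto].
Qed.

Lemma CSeries_ext (u v : nat -> C) : (forall n, u n = v n) -> CSeries u = CSeries v.
Proof.
  intros H. unfold CSeries. f_equal; apply Series_ext; intros; now rewrite H.
Qed.

(* Mertens: the real Cauchy product of the moduli controls the error made by
   truncating the double sum to [i + j <= N]. *)
Lemma CSeries_conv (u v w : nat -> C) U V W :
  l1_bound u U -> l1_bound v V -> (forall n, Cmod (w n) <= W) ->
  CSeries (fun j => u j * CSeries (fun i => v i * w (i + j)%nat))%C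
  = CSeries (fun m => conv u v m * w m)%C.
Proof.
  intros Hu Hv Hw.
  set (Vj := fun j => CSeries (fun i => v i * w (i + j)%nat)%C).
  assert (HVw : forall j, l1_bound (fun i => v i * w (i + j)%nat)%C (V * W)).
  { intros j. apply (l1_bound_mult v (fun i => w (i + j)%nat)); auto. }
  assert (HVj : forall j, Cmod (Vj j) <= V * W).
  { intros j. apply Cmod_CSeries_le; auto. }
  pose proof (l1_bound_mult u Vj U _ Hu HVj) as L1.
  pose proof (l1_bound_mult _ w _ _ (l1_bound_conv u v U V Hu Hv) Hw) as L2.
  apply is_Cseries_l1 in L1, L2. apply is_Cseries_iff in L1.
  set (T := CSeries (fun m => conv u v m * w m)%C) in *.
  change (CSeries (fun j => u j * Vj j)%C = T).
  apply is_Cseries_unique, is_Cseries_iff.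
  apply is_Cseries_iff in L2.
  assert (W0 : 0 <= W) by (eapply Rle_trans; [apply (Cmod_ge_0 (w O))|auto]).
  assert (Eu : ex_series (fun k => Cmod (u k))).
  { apply ex_series_nonneg with U; [intros; apply Cmod_ge_0|exact Hu]. }
  assert (Ev : ex_series (fun k => Cmod (v k))).
  { apply ex_series_nonneg with V; [intros; apply Cmod_ge_0|exact Hv]. }
  set (SU := Series (fun k => Cmod (u k))). set (SV := Series (fun k => Cmod (v k))).
  (* [err N] is [W] times the sum over [j <= N] of [|u_j|] times the tail of [|v|] beyond [N - j]:
     the mass of the rows up to [N] outside the triangle. Both of its terms tend to
     [W * SU * SV]. *)
  pose (err := fun N => W * (rsum (fun k => Cmod (u k)) N * SV
     - rsum (fun m => rsum (fun j => Cmod (u j) * Cmod (v (m - j)%nat)) m) N)).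
  assert (Herr : is_lim_seq err 0).
  { unfold err. replace (Finite 0) with (Finite (W * (SU * SV - SU * SV))) by (f_equal; ring).
    apply (is_lim_seq_scal_l _ W (Finite (SU * SV - SU * SV))).
    apply is_lim_seq_minus'.
    - apply (is_lim_seq_scal_r _ SV (Finite SU)). apply (Series_correct _ Eu).
    - pose proof (is_series_mult _ _ _ _ (Series_correct _ Eu) (Series_correct _ Ev)) as P.
      change (is_lim_seq (rsum (fun m => rsum (fun j => Cmod (u j) * Cmod (v (m - j)%nat)) m)) (SU * SV)).
      apply is_lim_seq_ext with (rsum (fun n => sum_f_R0 (fun k => Cmod (u k) * Cmod (v (n - k)%nat)) n)).
      + intros n. apply rsum_ext. intros m Hm. symmetry. exact (sum_n_Reals _ m).
      + apply P; [apply ex_series_ext with (2 := Eu)|apply ex_series_ext with (2 := Ev)];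
          intros; simpl; rewrite Rabs_pos_eq; auto using Cmod_ge_0. }
  apply is_lim_seq_le_le with (fun _ => 0)
     (fun N => Cmod (csum (fun m => conv u v m * w m)%C N - T) + err N).
  - intros N. split; [apply Cmod_ge_0|].
    replace (csum (fun j => u j * Vj j)%C N - T)%C
      with ((csum (fun m => conv u v m * w m)%C N - T)
            + (csum (fun j => u j * Vj j)%C N - csum (fun m => conv u v m * w m)%C N))%C by ring.
    eapply Rle_trans; [apply Cmod_triangle|]. apply Rplus_le_compat_l.
    rewrite (csum_ext (fun m => conv u v m * w m)%C
       (fun m => csum (fun j => u j * v (m - j)%nat * w ((m - j) + j)%nat)%C m)).
    2:{ intros m Hm. unfold conv. rewrite <- csum_mult_r. apply csum_ext. intros j Hj.
        now replace (m - j + j)%nat with m by lia. }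
    rewrite (csum_triangle (fun j i => u j * v i * w (i + j)%nat)%C).
    rewrite <- csum_minus. eapply Rle_trans; [apply Cmod_csum|].
    unfold err. rewrite (rsum_triangle (fun j i => Cmod (u j) * Cmod (v i))).
    rewrite <- rsum_mult_r.
    replace (rsum (fun n => Cmod (u n) * SV) N - rsum (fun j => rsum (fun i => Cmod (u j) * Cmod (v i)) (N - j)) N)
      with (rsum (fun j => Cmod (u j) * (SV - rsum (fun i => Cmod (v i)) (N - j))) N).
    2:{ replace (rsum (fun n => Cmod (u n) * SV) N - rsum (fun j => rsum (fun i => Cmod (u j) * Cmod (v i)) (N - j)) N)
          with (rsum (fun n => Cmod (u n) * SV) N + (-1) * rsum (fun j => rsum (fun i => Cmod (u j) * Cmod (v i)) (N - j)) N) by lra.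
        rewrite <- rsum_mult_l. rewrite <- (sum_n_plus (G := R_AbelianGroup)).
        apply rsum_ext. intros j Hj. rewrite rsum_mult_l. change plus with Rplus. simpl. ring. }
    rewrite <- rsum_mult_l. apply rsum_le. intros j Hj.
    replace (u j * Vj j - csum (fun i => u j * v i * w (i + j)%nat) (N - j))%C
      with (u j * (Vj j - csum (fun i => v i * w (i + j)%nat) (N - j)))%C.
    2:{ rewrite (csum_ext (fun i => u j * v i * w (i + j)%nat)%C (fun i => u j * (v i * w (i + j)%nat))%C)
         by (intros; ring). rewrite csum_mult_l. ring. }
    rewrite Cmod_mult, (Rmult_comm W), Rmult_assoc. apply Rmult_le_compat_l; [apply Cmod_ge_0|].
    rewrite Rmult_comm.
    eapply Rle_trans; [apply Cmod_CSeries_tail with (1 := HVw j)|].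
    (* The tail of [|v_i w_(i+j)|] is at most [W] times the tail of [|v_i|]; this is the statement
       that the partial sums of the nonnegative [q] stay below its total. *)
    set (q := fun i => W * Cmod (v i) - Cmod (v i * w (i + j)%nat)).
    assert (Q0 : forall i, 0 <= q i).
    { intros i. unfold q. rewrite Cmod_mult, Rmult_comm, <- Rmult_minus_distr_l.
      apply Rmult_le_pos; [apply Cmod_ge_0|]. specialize (Hw (i + j)%nat). lra. }
    assert (Evw : ex_series (fun i => Cmod (v i * w (i + j)%nat))).
    { apply ex_series_nonneg with (V * W); [intros; apply Cmod_ge_0|apply HVw]. }
    assert (Eq : is_series q (W * SV - Series (fun i => Cmod (v i * w (i + j)%nat)%C))).
    { apply (is_series_minus (K := R_AbsRing) (V := R_NormedModule)).
      - apply (is_series_scal (K := R_AbsRing) (V := R_NormedModule)). now apply Series_correct.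
      - now apply Series_correct. }
    assert (L : rsum q (N - j) <= W * SV - Series (fun i => Cmod (v i * w (i + j)%nat)%C)).
    { apply (is_lim_seq_incr_compare (rsum q)); [exact Eq|].
      intros n. rewrite rsum_S. specialize (Q0 (S n)). lra. }
    assert (L' : rsum q (N - j) = W * rsum (fun i => Cmod (v i)) (N - j)
                   - rsum (fun i => Cmod (v i * w (i + j)%nat)) (N - j)).
    { unfold q. generalize (N - j)%nat. induction n as [|n IH].
      - now rewrite !rsum_O.
      - rewrite !rsum_S, IH. lra. }
    lra.
  - apply is_lim_seq_const.
  - replace (Finite 0) with (Finite (0 + 0)) by (f_equal; lra).
    apply is_lim_seq_plus'; assumption.
Qed.

(** * Complex derivatives and the circle *)

Notation is_deriveC := (is_derive (K := C_AbsRing) (V := C_NormedModule)).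
Notation is_deriveR := (is_derive (K := R_AbsRing) (V := C_R_NormedModule)).

Lemma is_deriveC_eps (f : C -> C) (z l : C) :
  is_deriveC f z l <->
  forall eps, 0 < eps -> exists d, 0 < d /\ forall w, Cmod (w - z) < d ->
    Cmod (f w - f z - (w - z) * l) <= eps * Cmod (w - z).
Proof.
  split.
  - intros [_ H] eps He.
    specialize (H z (fun P HP => HP) (mkposreal eps He)). destruct H as [d Hd].
    exists d. split; [apply cond_pos|]. intros w Hw. exact (Hd w Hw).
  - intros H. split; [apply (is_linear_scal_l (K := C_AbsRing) (V := C_NormedModule))|].
    intros x Hx.
    replace x with z by exact (is_filter_lim_locally_unique (K := C_AbsRing) (V := AbsRing_NormedModule C_AbsRing) z x Hx).
    intros [eps He]. destruct (H eps He) as [d [Hd0 Hd]].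
    exists (mkposreal d Hd0). intros w Hw. exact (Hd w Hw).
Qed.

Lemma C_R_norm (z : C) : @norm R_AbsRing C_R_NormedModule z = Cmod z.
Proof. symmetry. apply Cmod_norm. Qed.

Lemma is_deriveR_eps (f : R -> C) (x : R) (l : C) :
  is_deriveR f x l <->
  forall eps, 0 < eps -> exists d, 0 < d /\ forall y, Rabs (y - x) < d ->
    Cmod (f y - f x - RtoC (y - x) * l) <= eps * Rabs (y - x).
Proof.
  assert (E : forall (y : R) (l : C), scal (V := C_R_NormedModule) y l = (RtoC y * l)%C).
  { intros y [a b]. unfold scal, Cmult, RtoC; simpl. unfold prod_scal, scal; simpl.
    unfold mult; simpl. f_equal; ring. }
  split.
  - intros [_ H] eps He.
    specialize (H x (fun P HP => HP) (mkposreal eps He)). destruct H as [d Hd].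
    exists d. split; [apply cond_pos|]. intros w Hw. rewrite <- C_R_norm, <- E. exact (Hd w Hw).
  - intros H. split; [apply (is_linear_scal_l (K := R_AbsRing) (V := C_R_NormedModule))|].
    intros x' Hx.
    replace x' with x by exact (is_filter_lim_locally_unique (K := R_AbsRing) (V := R_NormedModule) x x' Hx).
    intros [eps He]. destruct (H eps He) as [d [Hd0 Hd]].
    exists (mkposreal d Hd0). intros w Hw. simpl pos.
    rewrite C_R_norm, E. exact (Hd w Hw).
Qed.

Lemma filterlim_within_eps (f : C -> C) (D : C -> Prop) (z l : C) :
  filterlim f (within D (locally z)) (locally l) ->
  forall eps, 0 < eps -> exists d, 0 < d /\ forall w, D w -> Cmod (w - z) < d -> Cmod (f w - l) < eps.
Proof.
  intros H eps He.
  (* Balls of the product uniform structure control the modulus only up to a factor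
     [sqrt 2 <= 2]. *)
  assert (He' : 0 < eps / 2) by lra.
  destruct (H (ball l (mkposreal _ He'))) as [d Hd]; [now exists (mkposreal _ He')|].
  exists d. split; [apply cond_pos|]. intros w Dw Hw.
  assert (B : ball z d w) by (apply C_NormedModule_mixin_compat1; exact Hw).
  specialize (Hd w B Dw). apply C_NormedModule_mixin_compat2 in Hd.
  eapply Rlt_le_trans; [exact Hd|]. simpl.
  assert (sqrt 2 <= 2). { rewrite <- (sqrt_Rsqr 2) at 2 by lra. apply sqrt_le_1_alt. unfold Rsqr; lra. }
  nra.
Qed.

Lemma is_deriveC_quadratic (f : C -> C) (z l : C) M d :
  0 < d ->
  (forall h, Cmod h < d -> Cmod (f (z + h) - f z - h * l) <= M * (Cmod h)^2)%C ->
  is_deriveC f z l.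
Proof.
  intros Hd H. apply is_deriveC_eps. intros eps He.
  assert (HM : 0 < Rabs M + 1) by (pose proof (Rabs_pos M); lra).
  exists (Rmin d (eps / (Rabs M + 1))). split.
  { apply Rmin_pos; auto. apply Rdiv_lt_0_compat; auto. }
  intros w Hw. pose proof (Rmin_l d (eps / (Rabs M + 1))). pose proof (Rmin_r d (eps / (Rabs M + 1))).
  specialize (H (w - z)%C ltac:(lra)). replace (z + (w - z))%C with w in H by ring.
  eapply Rle_trans; [exact H|]. pose proof (Cmod_ge_0 (w - z)).
  assert (Cmod (w - z) * (Rabs M + 1) <= eps).
  { apply Rle_trans with (eps / (Rabs M + 1) * (Rabs M + 1)).
    - apply Rmult_le_compat_r; lra.
    - right. field. lra. }
  pose proof (Rle_abs M). simpl. rewrite Rmult_1_r, <- Rmult_assoc.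
  apply Rmult_le_compat_r; [auto|]. nra.
Qed.

Lemma is_deriveR_quadratic (f : R -> C) (x : R) (l : C) M :
  (forall h : R, Cmod (f (x + h)%R - f x - RtoC h * l)%C <= M * h^2) ->
  is_deriveR f x l.
Proof.
  intros H. apply is_deriveR_eps. intros eps He.
  assert (HM : 0 < Rabs M + 1) by (pose proof (Rabs_pos M); lra).
  exists (eps / (Rabs M + 1)). split.
  { apply Rdiv_lt_0_compat; auto. }
  intros w Hw.
  specialize (H (w - x)). replace (x + (w - x)) with w in H by ring.
  eapply Rle_trans; [exact H|]. pose proof (Rabs_pos (w - x)).
  assert (Rabs (w - x) * (Rabs M + 1) <= eps).
  { apply Rle_trans with (eps / (Rabs M + 1) * (Rabs M + 1)).
    - apply Rmult_le_compat_r; lra.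
    - right. field. lra. }
  pose proof (Rle_abs M). rewrite <- (pow2_abs (w - x)). simpl. rewrite Rmult_1_r, <- Rmult_assoc.
  apply Rmult_le_compat_r; [auto|]. nra.
Qed.

Lemma is_deriveC_cont (f : C -> C) (z l : C) :
  is_deriveC f z l ->
  forall eps, 0 < eps -> exists d, 0 < d /\ forall w, Cmod (w - z) < d -> Cmod (f w - f z) < eps.
Proof.
  intros H eps He. rewrite is_deriveC_eps in H. destruct (H 1 ltac:(lra)) as [d [Hd K]].
  assert (HM : 0 < 1 + Cmod l) by (pose proof (Cmod_ge_0 l); lra).
  exists (Rmin d (eps / (1 + Cmod l))). split.
  { apply Rmin_pos; auto. apply Rdiv_lt_0_compat; auto. }
  intros w Hw. pose proof (Rmin_l d (eps / (1 + Cmod l))). pose proof (Rmin_r d (eps / (1 + Cmod l))).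
  specialize (K w ltac:(lra)).
  replace (f w - f z)%C with ((f w - f z - (w - z) * l) + (w - z) * l)%C by ring.
  eapply Rle_lt_trans; [apply Cmod_triangle|]. rewrite Cmod_mult.
  assert (Cmod (w - z) * (1 + Cmod l) < eps).
  { apply Rlt_le_trans with (eps / (1 + Cmod l) * (1 + Cmod l)).
    - apply Rmult_lt_compat_r; lra.
    - right. field. lra. }
  nra.
Qed.

Lemma is_deriveC_ext_loc (f g : C -> C) (z l : C) d :
  0 < d -> (forall w, Cmod (w - z) < d -> f w = g w) -> is_deriveC f z l -> is_deriveC g z l.
Proof.
  intros Hd E H. apply is_deriveC_eps. rewrite is_deriveC_eps in H.
  intros eps He. destruct (H eps He) as [d' [Hd' K]].
  exists (Rmin d d'). split; [now apply Rmin_pos|]. intros w Hw.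
  pose proof (Rmin_l d d'). pose proof (Rmin_r d d').
  rewrite <- !E; [apply K; lra| |lra].
  replace (z - z)%C with (RtoC 0) by ring. now rewrite Cmod_0.
Qed.

(* [C_NormedModule] uses the product uniform structure, so the two notions of
   derivative agree only propositionally. *)
Lemma is_deriveC_AbsRing (f : C -> C) (z l : C) :
  is_deriveC f z l <-> is_derive (K := C_AbsRing) (V := AbsRing_NormedModule C_AbsRing) f z l.
Proof.
  split; intros [_ H]; split; try exact H.
  - apply (is_linear_scal_l (K := C_AbsRing) (V := AbsRing_NormedModule C_AbsRing)).
  - apply (is_linear_scal_l (K := C_AbsRing) (V := C_NormedModule)).
Qed.

Lemma is_deriveC_plus (f g : C -> C) (z df dg : C) :
  is_deriveC f z df -> is_deriveC g z dg -> is_deriveC (fun w => f w + g w)%C z (df + dg)%C.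
Proof. exact (is_derive_plus (K := C_AbsRing) (V := C_NormedModule) f g z df dg). Qed.

Lemma is_deriveC_mult (f g : C -> C) (z df dg : C) :
  is_deriveC f z df -> is_deriveC g z dg ->
  is_deriveC (fun w => f w * g w)%C z (df * g z + f z * dg)%C.
Proof.
  rewrite !is_deriveC_AbsRing. intros Hf Hg.
  apply (is_derive_mult (K := C_AbsRing) f g z df dg Hf Hg).
  exact Cmult_comm.
Qed.

Lemma is_deriveC_const (a z : C) : is_deriveC (fun _ => a) z (RtoC 0).
Proof. exact (is_derive_const (K := C_AbsRing) (V := C_NormedModule) a z). Qed.

Lemma is_deriveC_opp (f : C -> C) (z df : C) :
  is_deriveC f z df -> is_deriveC (fun w => - f w)%C z (- df)%C.
Proof. exact (is_derive_opp (K := C_AbsRing) (V := C_NormedModule) f z df). Qed.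

Lemma is_deriveC_inv_id (z : C) :
  z <> RtoC 0 -> is_deriveC Cinv z (- / (z * z))%C.
Proof.
  intros Hz. pose proof (proj1 (Cmod_gt_0 z) Hz) as P.
  (* The remainder is [h^2 / ((z + h) z^2)], and [|z + h| >= |z| / 2] on this disk. *)
  apply is_deriveC_quadratic with (2 / (Cmod z)^3) (Cmod z / 2); [lra|].
  intros h Hh.
  assert (Q : Cmod z / 2 <= Cmod (z + h)).
  { assert (Cmod z <= Cmod (z + h) + Cmod h).
    { replace z with ((z + h) + - h)%C at 1 by ring. rewrite <- (Cmod_opp h). apply Cmod_triangle. }
    lra. }
  assert (Hzh : (z + h)%C <> RtoC 0) by (apply Cmod_gt_0; lra).
  replace (/ (z + h) - / z - h * - / (z * z))%C with (h * h / ((z + h) * (z * z)))%C by (field; auto).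
  assert (Hm : (z * z)%C <> RtoC 0) by (apply Cmult_neq_0; auto).
  assert (Hm' : ((z + h) * (z * z))%C <> RtoC 0) by (apply Cmult_neq_0; auto).
  rewrite Cmod_div, !Cmod_mult by auto.
  pose proof (Cmod_ge_0 h).
  apply Rle_trans with (Cmod h * Cmod h / (Cmod z / 2 * (Cmod z * Cmod z))).
  - apply Rmult_le_compat_l; [nra|]. apply Rinv_le_contravar.
    + apply Rmult_lt_0_compat; nra.
    + apply Rmult_le_compat_r; nra.
  - right. field. lra.
Qed.

Lemma is_deriveC_inv (f : C -> C) (z df : C) :
  f z <> RtoC 0 -> is_deriveC f z df -> is_deriveC (fun w => / f w)%C z (- df / (f z * f z))%C.
Proof.
  intros Hz H.
  replace (- df / (f z * f z))%C with (df * (- / (f z * f z)))%C.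
  - apply is_deriveC_AbsRing in H.
    exact (is_derive_comp (K := C_AbsRing) (V := C_NormedModule) Cinv f z _ df (is_deriveC_inv_id _ Hz) H).
  - field. auto.
Qed.

Lemma cis_plus a b : cis (a + b) = (cis a * cis b)%C.
Proof.
  unfold cis, Cmult; simpl. rewrite cos_plus, sin_plus. f_equal; ring.
Qed.

Lemma cis_0 : cis 0 = RtoC 1.
Proof. unfold cis. now rewrite cos_0, sin_0. Qed.

Lemma Cmod_cis a : Cmod (cis a) = 1.
Proof.
  unfold Cmod, cis; simpl fst; simpl snd. rewrite <- sqrt_1 at 1. f_equal.
  rewrite <- (sin2_cos2 a). unfold Rsqr. ring.
Qed.

Lemma cis_pow a n : (cis a ^ n)%C = cis (INR n * a).
Proof.
  induction n as [|n IH].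
  - simpl. now rewrite Rmult_0_l, cis_0.
  - rewrite S_INR. replace ((INR n + 1) * a) with (a + INR n * a) by ring.
    rewrite cis_plus, <- IH. reflexivity.
Qed.

Lemma Rabs_sin_le y : Rabs (sin y) <= Rabs y.
Proof.
  destruct (MVT_gen sin 0 y cos) as [x [_ Hx]].
  - intros. apply is_derive_sin.
  - intros. apply continuity_sin.
  - rewrite sin_0, !Rminus_0_r in Hx. rewrite Hx, Rabs_mult.
    pose proof (COS_bound x). assert (Rabs (cos x) <= 1) by (apply Rabs_le; lra).
    pose proof (Rabs_pos y). nra.
Qed.

Lemma cis_quadratic y : Cmod (cis y - 1 - Ci * RtoC y)%C <= 2 * y ^ 2.
Proof.
  assert (Hc : Rabs (cos y - 1) <= y ^ 2).
  { destruct (MVT_gen cos 0 y (fun x => - sin x)) as [x [Hx Ex]].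
    - intros. apply is_derive_cos.
    - intros. apply continuity_cos.
    - rewrite cos_0 in Ex. rewrite Ex, Rabs_mult, Rabs_Ropp, Rminus_0_r.
      assert (Rabs x <= Rabs y).
      { revert Hx. unfold Rmin, Rmax, Rabs. repeat destruct Rle_dec; repeat destruct Rcase_abs; lra. }
      pose proof (Rabs_sin_le x). rewrite <- pow2_abs. pose proof (Rabs_pos y). pose proof (Rabs_pos (sin x)). nra. }
  assert (Hs : Rabs (sin y - y) <= y ^ 2).
  { destruct (MVT_gen (fun x => sin x - x) 0 y (fun x => cos x - 1)) as [x [Hx Ex]].
    - intros. auto_derive; auto. ring.
    - intros. apply continuity_pt_minus; [apply continuity_sin|apply continuity_pt_id].
    - rewrite sin_0 in Ex. replace (sin y - y) with (sin y - y - (0 - 0)) by ring.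
      rewrite Ex, Rabs_mult, Rminus_0_r.
      assert (Rabs x <= Rabs y).
      { revert Hx. unfold Rmin, Rmax, Rabs. repeat destruct Rle_dec; repeat destruct Rcase_abs; lra. }
      destruct (MVT_gen cos 0 x (fun x => - sin x)) as [x' [_ Ex']].
      { intros. apply is_derive_cos. } { intros. apply continuity_cos. }
      rewrite cos_0 in Ex'. rewrite Ex', Rabs_mult, Rabs_Ropp, Rminus_0_r.
      assert (Rabs (sin x') <= 1) by (pose proof (SIN_bound x'); apply Rabs_le; lra).
      rewrite <- pow2_abs. pose proof (Rabs_pos y). pose proof (Rabs_pos x). pose proof (Rabs_pos (sin x')).
      assert (Rabs (sin x') * Rabs x <= 1 * Rabs x) by (apply Rmult_le_compat_r; lra).
      simpl. rewrite Rmult_1_r. apply Rmult_le_compat_r; lra. }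
  eapply Rle_trans; [apply Cmod_le_Re_Im|].
  unfold cis, Ci, Cminus, Cplus, Copp, Cmult, RtoC, Re, Im; simpl.
  replace (cos y + - (1) + - (0 * y - 1 * 0)) with (cos y - 1) by ring.
  replace (sin y + - 0 + - (0 * 0 + 1 * y)) with (sin y - y) by ring. simpl in *. lra.
Qed.

(** * Fourier coefficients *)

(* [sum_n] produces equations in the carrier of [C_AbelianGroup], which [ring]
   does not recognize. *)
Ltac cring := match goal with |- @eq _ ?a ?b => change (@eq C a b) end; ring.

Lemma is_deriveR_components (f : R -> C) (x : R) (l : C) :
  is_deriveR f x l <->
  is_derive (fun u => Re (f u)) x (Re l) /\ is_derive (fun u => Im (f u)) x (Im l).
Proof.
  assert (K : forall (g : R -> R) (m : R), is_derive g x m <->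
     forall eps, 0 < eps -> exists d, 0 < d /\ forall y, Rabs (y - x) < d ->
       Rabs (g y - g x - (y - x) * m) <= eps * Rabs (y - x)).
  { intros g m. split.
    - intros [_ H] eps He.
      specialize (H x (fun P HP => HP) (mkposreal eps He)). destruct H as [d Hd].
      exists d. split; [apply cond_pos|]. intros w Hw. exact (Hd w Hw).
    - intros H. split; [apply (is_linear_scal_l (K := R_AbsRing) (V := R_NormedModule))|].
      intros x' Hx.
      replace x' with x by exact (is_filter_lim_locally_unique (K := R_AbsRing) (V := R_NormedModule) x x' Hx).
      intros [eps He]. destruct (H eps He) as [d [Hd0 Hd]].
      exists (mkposreal d Hd0). intros w Hw. exact (Hd w Hw). }
  assert (E1 : forall y, Re (f y - f x - RtoC (y - x) * l)%C = Re (f y) - Re (f x) - (y - x) * Re l).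
  { intros y. unfold Re, Cminus, Cplus, Copp, Cmult, RtoC; simpl. ring. }
  assert (E2 : forall y, Im (f y - f x - RtoC (y - x) * l)%C = Im (f y) - Im (f x) - (y - x) * Im l).
  { intros y. unfold Im, Cminus, Cplus, Copp, Cmult, RtoC; simpl. ring. }
  rewrite is_deriveR_eps, !K. split.
  - intros H. split; intros eps He; destruct (H eps He) as [d [Hd Hd']]; exists d; (split; [auto|]);
      intros y Hy; specialize (Hd' y Hy).
    + rewrite <- E1. eapply Rle_trans; [apply Rabs_Re_le|auto].
    + rewrite <- E2. eapply Rle_trans; [apply Rabs_Im_le|auto].
  - intros [H H'] eps He.
    destruct (H (eps / 2) ltac:(lra)) as [d [Hd K1]]. destruct (H' (eps / 2) ltac:(lra)) as [d' [Hd' K2]].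
    exists (Rmin d d'). split; [now apply Rmin_pos|]. intros y Hy.
    pose proof (Rmin_l d d'). pose proof (Rmin_r d d').
    specialize (K1 y ltac:(lra)). specialize (K2 y ltac:(lra)).
    eapply Rle_trans; [apply Cmod_le_Re_Im|]. rewrite E1, E2. lra.
Qed.

Lemma is_deriveR_mult (f g : R -> C) (x : R) (df dg : C) :
  is_deriveR f x df -> is_deriveR g x dg ->
  is_deriveR (fun u => f u * g u)%C x (df * g x + f x * dg)%C.
Proof.
  rewrite !is_deriveR_components. intros [H1 H2] [H3 H4]. split.
  - apply (is_derive_ext (fun u => Re (f u) * Re (g u) - Im (f u) * Im (g u))); [reflexivity|].
    replace (Re (df * g x + f x * dg)%C)
      with ((Re df * Re (g x) + Re (f x) * Re dg) - (Im df * Im (g x) + Im (f x) * Im dg))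
      by (unfold Re, Im, Cplus, Cmult; simpl; ring).
    apply (is_derive_minus (K := R_AbsRing) (V := R_NormedModule));
      apply (is_derive_mult (K := R_AbsRing)); auto; exact Rmult_comm.
  - apply (is_derive_ext (fun u => Re (f u) * Im (g u) + Im (f u) * Re (g u))); [reflexivity|].
    replace (Im (df * g x + f x * dg)%C)
      with ((Re df * Im (g x) + Re (f x) * Im dg) + (Im df * Re (g x) + Im (f x) * Re dg))
      by (unfold Re, Im, Cplus, Cmult; simpl; ring).
    apply (is_derive_plus (K := R_AbsRing) (V := R_NormedModule));
      apply (is_derive_mult (K := R_AbsRing)); auto; exact Rmult_comm.
Qed.

Lemma is_deriveR_comp (F : C -> C) (g : R -> C) (x : R) (l m : C) :
  is_deriveC F (g x) l -> is_deriveR g x m -> is_deriveR (fun u => F (g u)) x (m * l)%C.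
Proof.
  rewrite is_deriveC_eps, !is_deriveR_eps. intros HF Hg eps He.
  assert (Pl : 0 <= Cmod l) by apply Cmod_ge_0.
  assert (Pm : 0 <= Cmod m) by apply Cmod_ge_0.
  set (e1 := eps / 2 / (1 + Cmod m)). set (e2 := eps / 2 / (1 + Cmod l)).
  assert (He1 : 0 < e1) by (apply Rdiv_lt_0_compat; lra).
  assert (He2 : 0 < e2) by (apply Rdiv_lt_0_compat; lra).
  assert (Q1 : e1 * (1 + Cmod m) = eps / 2) by (unfold e1; field; lra).
  assert (Q2 : e2 * (1 + Cmod l) = eps / 2) by (unfold e2; field; lra).
  destruct (HF e1 He1) as [d1 [Hd1 K1]].
  (* The bound by 1 gives [g] the local Lipschitz constant [1 + |m|]; the bound by [e2] controls the
     error of [g] after multiplication by [l]. *)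
  destruct (Hg (Rmin 1 e2)) as [d2 [Hd2 K2]]; [apply Rmin_pos; lra|].
  set (d3 := d1 / (1 + Cmod m)).
  assert (Hd3 : 0 < d3) by (apply Rdiv_lt_0_compat; lra).
  assert (Q3 : d3 * (1 + Cmod m) = d1) by (unfold d3; field; lra).
  exists (Rmin d2 d3). split; [now apply Rmin_pos|]. intros y Hy.
  pose proof (Rmin_l d2 d3). pose proof (Rmin_r d2 d3).
  pose proof (Rmin_l 1 e2). pose proof (Rmin_r 1 e2).
  specialize (K2 y ltac:(lra)). pose proof (Rabs_pos (y - x)).
  assert (B : Cmod (g y - g x) <= (1 + Cmod m) * Rabs (y - x)).
  { replace (g y - g x)%C with ((g y - g x - RtoC (y - x) * m) + RtoC (y - x) * m)%C by ring.
    eapply Rle_trans; [apply Cmod_triangle|]. rewrite Cmod_mult, Cmod_R. nra. }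
  specialize (K1 (g y) ltac:(nra)).
  replace (F (g y) - F (g x) - RtoC (y - x) * (m * l))%C
    with ((F (g y) - F (g x) - (g y - g x) * l) + (g y - g x - RtoC (y - x) * m) * l)%C by ring.
  eapply Rle_trans; [apply Cmod_triangle|]. rewrite Cmod_mult.
  assert (A1 : e1 * Cmod (g y - g x) <= eps / 2 * Rabs (y - x)).
  { rewrite <- Q1, Rmult_assoc. apply Rmult_le_compat_l; lra. }
  assert (A2 : Cmod (g y - g x - RtoC (y - x) * m) * Cmod l <= eps / 2 * Rabs (y - x)).
  { apply Rle_trans with (e2 * Rabs (y - x) * Cmod l).
    - apply Rmult_le_compat_r; [auto|]. eapply Rle_trans; [exact K2|].
      apply Rmult_le_compat_r; auto.
    - rewrite <- Q2. nra. }
  lra.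
Qed.

Lemma is_deriveR_cis (a x : R) :
  is_deriveR (fun u => cis (a * u)) x (Ci * RtoC a * cis (a * x))%C.
Proof.
  apply is_deriveR_quadratic with (2 * a^2). intros h.
  replace (a * (x + h)) with (a * x + a * h) by ring. rewrite cis_plus.
  replace (cis (a * x) * cis (a * h) - cis (a * x) - RtoC h * (Ci * RtoC a * cis (a * x)))%C
    with (cis (a * x) * (cis (a * h) - 1 - Ci * RtoC (a * h)))%C by (rewrite RtoC_mult; ring).
  rewrite Cmod_mult, Cmod_cis, Rmult_1_l.
  eapply Rle_trans; [apply cis_quadratic|]. right. ring.
Qed.

Lemma is_deriveR_scal_l (a : C) (f : R -> C) (x : R) (l : C) :
  is_deriveR f x l -> is_deriveR (fun u => a * f u)%C x (a * l)%C.
Proof.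
  intros H. replace (a * l)%C with (0 * f x + a * l)%C by ring.
  apply (is_deriveR_mult (fun _ => a)); auto.
  exact (is_derive_const (K := R_AbsRing) (V := C_R_NormedModule) a x).
Qed.

Lemma is_deriveR_ext (f g : R -> C) (x : R) (l : C) :
  (forall u, f u = g u) -> is_deriveR f x l -> is_deriveR g x l.
Proof. intros E. exact (is_derive_ext (K := R_AbsRing) (V := C_R_NormedModule) f g x l E). Qed.

Lemma is_deriveR_unique (f : R -> C) (x : R) (l m : C) :
  is_deriveR f x l -> is_deriveR f x m -> l = m.
Proof.
  rewrite !is_deriveR_components. intros [H1 H2] [H3 H4].
  apply is_derive_unique in H1, H2, H3, H4. destruct l, m; unfold Re, Im in *; simpl in *. congruence.
Qed.

(* Integral over [0, 2 pi], componentwise. *)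
Definition is_CInt (g : R -> C) (l : C) : Prop :=
  is_RInt (fun x => Re (g x)) 0 (2 * PI) (Re l) /\ is_RInt (fun x => Im (g x)) 0 (2 * PI) (Im l).

Lemma is_CInt_ext (f g : R -> C) (l : C) :
  (forall x, f x = g x) -> is_CInt f l -> is_CInt g l.
Proof.
  intros E [H H']. split; eapply is_RInt_ext; eauto; intros; simpl; now rewrite E.
Qed.

Lemma is_CInt_plus (f g : R -> C) (l m : C) :
  is_CInt f l -> is_CInt g m -> is_CInt (fun x => f x + g x)%C (l + m)%C.
Proof.
  intros [H H'] [G G']. split.
  - exact (is_RInt_plus (V := R_NormedModule) _ _ _ _ _ _ H G).
  - exact (is_RInt_plus (V := R_NormedModule) _ _ _ _ _ _ H' G').
Qed.

Lemma is_CInt_scal (a : C) (g : R -> C) (l : C) :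
  is_CInt g l -> is_CInt (fun x => a * g x)%C (a * l)%C.
Proof.
  intros [H H']. split.
  - apply (is_RInt_minus (V := R_NormedModule) (fun x => Re a * Re (g x)) (fun x => Im a * Im (g x)));
      now apply (is_RInt_scal (V := R_NormedModule)).
  - apply (is_RInt_plus (V := R_NormedModule) (fun x => Re a * Im (g x)) (fun x => Im a * Re (g x)));
      now apply (is_RInt_scal (V := R_NormedModule)).
Qed.

Lemma two_PI_pos : 0 < 2 * PI.
Proof. pose proof PI_RGT_0. lra. Qed.

(** Real and imaginary parts are bounded separately, at the cost of a factor 2 over the sharp
    estimate; later only the existence of a uniform bound matters. *)
Lemma is_CInt_bound (g : R -> C) (l : C) M :
  is_CInt g l -> (forall x, 0 <= x <= 2 * PI -> Cmod (g x) <= M) -> Cmod l <= 2 * PI * (2 * M).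
Proof.
  intros [H H'] HM. pose proof two_PI_pos as P.
  assert (E : is_RInt (fun _ => M) 0 (2 * PI) (2 * PI * M)).
  { replace (2 * PI * M) with (scal (V := R_NormedModule) (2 * PI - 0) M) by (unfold scal; simpl; unfold mult; simpl; ring).
    apply (is_RInt_const (V := R_NormedModule)). }
  assert (A : Rabs (Re l) <= 2 * PI * M).
  { apply (norm_RInt_le (V := R_NormedModule) (fun x => Re (g x)) (fun _ => M) 0 (2 * PI)); auto; [lra|].
    intros x Hx. eapply Rle_trans; [apply Rabs_Re_le|auto]. }
  assert (B : Rabs (Im l) <= 2 * PI * M).
  { apply (norm_RInt_le (V := R_NormedModule) (fun x => Im (g x)) (fun _ => M) 0 (2 * PI)); auto; [lra|].
    intros x Hx. eapply Rle_trans; [apply Rabs_Im_le|auto]. }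
  eapply Rle_trans; [apply Cmod_le_Re_Im|]. lra.
Qed.

(** Fundamental theorem of calculus; the differentiability of [dG] supplies the continuity of the
    integrand. *)
Lemma is_CInt_derive (G dG : R -> C) :
  (forall x, is_deriveR G x (dG x)) -> (forall x, exists l, is_deriveR dG x l) ->
  is_CInt dG (G (2 * PI)%R - G 0%R)%C.
Proof.
  intros H H'. split.
  - apply (is_RInt_derive (V := R_CompleteNormedModule) (fun x => Re (G x)) (fun x => Re (dG x))).
    + intros x _. apply (is_deriveR_components G x (dG x)), H.
    + intros x _. destruct (H' x) as [l Hl]. apply is_deriveR_components in Hl.
      apply (ex_derive_continuous (V := R_NormedModule)). exists (Re l). apply Hl.
  - apply (is_RInt_derive (V := R_CompleteNormedModule) (fun x => Im (G x)) (fun x => Im (dG x))).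
    + intros x _. apply (is_deriveR_components G x (dG x)), H.
    + intros x _. destruct (H' x) as [l Hl]. apply is_deriveR_components in Hl.
      apply (ex_derive_continuous (V := R_NormedModule)). exists (Im l). apply Hl.
Qed.

Lemma is_CInt_uniform (f : nat -> R -> C) (g : R -> C) (l : C) :
  (forall N, is_CInt (f N) l) ->
  (forall eps, 0 < eps -> exists N0, forall N x, (N0 <= N)%nat -> Cmod (f N x - g x) < eps) ->
  is_CInt g l.
Proof.
  intros H U. split.
  - destruct (filterlim_RInt (V := R_CompleteNormedModule) (fun N x => Re (f N x)) 0 (2 * PI) eventually
      eventually_filter (fun x => Re (g x)) (fun _ => Re l)) as [I [HI HI']].
    + intros N. exact (proj1 (H N)).
    + apply filterlim_locally. intros eps. destruct (U eps (cond_pos eps)) as [N0 HN].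
      exists N0. intros N HN' x. eapply Rle_lt_trans; [|apply (HN N x HN')].
      change (Rabs (Re (f N x) - Re (g x)) <= Cmod (f N x - g x)%C).
      replace (Re (f N x) - Re (g x)) with (Re (f N x - g x)%C) by (unfold Re, Cminus, Cplus, Copp; simpl; ring).
      apply Rabs_Re_le.
    + replace (Re l) with I; [exact HI'|].
      apply (filterlim_locally_unique (F := eventually) (fun _ : nat => Re l) I (Re l) HI).
      apply filterlim_const.
  - destruct (filterlim_RInt (V := R_CompleteNormedModule) (fun N x => Im (f N x)) 0 (2 * PI) eventually
      eventually_filter (fun x => Im (g x)) (fun _ => Im l)) as [I [HI HI']].
    + intros N. exact (proj2 (H N)).
    + apply filterlim_locally. intros eps. destruct (U eps (cond_pos eps)) as [N0 HN].
      exists N0. intros N HN' x. eapply Rle_lt_trans; [|apply (HN N x HN')].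
      change (Rabs (Im (f N x) - Im (g x)) <= Cmod (f N x - g x)%C).
      replace (Im (f N x) - Im (g x)) with (Im (f N x - g x)%C) by (unfold Im, Cminus, Cplus, Copp; simpl; ring).
      apply Rabs_Im_le.
    + replace (Im l) with I; [exact HI'|].
      apply (filterlim_locally_unique (F := eventually) (fun _ : nat => Im l) I (Im l) HI).
      apply filterlim_const.
Qed.

Lemma cis_2PI (n : Z) : cis (IZR n * (2 * PI)) = RtoC 1.
Proof.
  assert (N : forall k, cis (INR k * (2 * PI)) = RtoC 1).
  { intros k. rewrite <- cis_pow.
    replace (cis (2 * PI)) with (RtoC 1) by (unfold cis; now rewrite cos_2PI, sin_2PI).
    induction k as [|k IH]; simpl; [auto|]. rewrite IH. ring. }
  destruct (Z_le_gt_dec 0 n) as [H|H].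
  - rewrite <- (Z2Nat.id n H), <- INR_IZR_INZ. apply N.
  - specialize (N (Z.to_nat (- n))). rewrite INR_IZR_INZ, Z2Nat.id in N by lia.
    assert (E : (cis (IZR n * (2 * PI)) * cis (IZR (- n) * (2 * PI)))%C = RtoC 1).
    { rewrite <- cis_plus, opp_IZR. replace (_ + _) with 0 by ring. apply cis_0. }
    rewrite N in E. rewrite <- E. ring.
Qed.

Lemma is_CInt_cis (a : C) (n : Z) :
  is_CInt (fun x => a * cis (IZR n * x))%C (if Z.eq_dec n 0 then RtoC (2 * PI) * a else RtoC 0)%C.
Proof.
  destruct (Z.eq_dec n 0) as [->|Hn].
  - apply is_CInt_ext with (fun _ => a).
    { intros x. rewrite Rmult_0_l, cis_0. ring. }
    split.
    + replace (Re (RtoC (2 * PI) * a)%C) with (scal (V := R_NormedModule) (2 * PI - 0) (Re a))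
        by (unfold scal, Re, RtoC; simpl; unfold mult; simpl; ring).
      apply (is_RInt_const (V := R_NormedModule)).
    + replace (Im (RtoC (2 * PI) * a)%C) with (scal (V := R_NormedModule) (2 * PI - 0) (Im a))
        by (unfold scal, Im, RtoC; simpl; unfold mult; simpl; ring).
      apply (is_RInt_const (V := R_NormedModule)).
  - assert (Hn' : (Ci * RtoC (IZR n))%C <> RtoC 0).
    { apply Cmod_gt_0. rewrite Cmod_mult, Cmod_Ci, Cmod_R, Rmult_1_l.
      apply Rabs_pos_lt. now apply not_0_IZR. }
    set (b := (a / (Ci * RtoC (IZR n)))%C).
    replace (RtoC 0) with (b * cis (IZR n * (2 * PI)) - b * cis (IZR n * 0))%C.
    2:{ rewrite cis_2PI, Rmult_0_r, cis_0. ring. }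
    apply (is_CInt_derive (fun x => b * cis (IZR n * x))%C).
    + intros x. replace (a * cis (IZR n * x))%C with (b * (Ci * RtoC (IZR n) * cis (IZR n * x)))%C.
      * apply is_deriveR_scal_l, is_deriveR_cis.
      * unfold b. field. split; intros E; apply Hn'; rewrite E; ring.
    + intros x. eexists. apply is_deriveR_scal_l, is_deriveR_cis.
Qed.

Definition tser (g : nat -> C) (x : R) : C := CSeries (fun k => g k * cis (INR k * x))%C.

Lemma l1_tser (g : nat -> C) M x : l1_bound g M -> l1_bound (fun k => g k * cis (INR k * x))%C M.
Proof.
  apply l1_bound_ext. intros n. rewrite Cmod_mult, Cmod_cis. lra.
Qed.

Lemma is_CInt_csum (F : nat -> R -> C) (l : nat -> C) N :
  (forall k, is_CInt (F k) (l k)) -> is_CInt (fun x => csum (fun k => F k x) N) (csum l N).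
Proof.
  intros H. induction N as [|N IH].
  - rewrite csum_O. apply is_CInt_ext with (F O); auto. intros; now rewrite csum_O.
  - rewrite csum_S. apply is_CInt_ext with (fun x => csum (fun k => F k x) N + F (S N) x)%C.
    + intros. now rewrite csum_S.
    + apply is_CInt_plus; auto.
Qed.

Lemma is_CInt_tser (g : nat -> C) M (n : Z) :
  l1_bound g M ->
  is_CInt (fun x => tser g x * cis (- (IZR n * x)))%C
    (if Z_le_dec 0 n then RtoC (2 * PI) * g (Z.to_nat n) else RtoC 0)%C.
Proof.
  intros H.
  set (l := (if Z_le_dec 0 n then RtoC (2 * PI) * g (Z.to_nat n) else RtoC 0)%C).
  (* The shift by [Z.to_nat n] makes every partial sum contain the frequency [n] when [n >= 0], so
     all the integrals have the same value [l] by orthogonality. *)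
  apply is_CInt_uniform with
    (fun N x => csum (fun k => g k * cis (IZR (Z.of_nat k - n) * x))%C (N + Z.to_nat n)).
  - intros N.
    replace l with (csum (fun k => if Z.eq_dec (Z.of_nat k - n) 0 then RtoC (2 * PI) * g k else RtoC 0)%C (N + Z.to_nat n)).
    { apply (is_CInt_csum (fun k x => g k * cis (IZR (Z.of_nat k - n) * x))%C). intros k. apply is_CInt_cis. }
    assert (A : forall m, (Z.of_nat m < n)%Z ->
      csum (fun k => if Z.eq_dec (Z.of_nat k - n) 0 then RtoC (2 * PI) * g k else RtoC 0)%C m = RtoC 0).
    { induction m as [|m IH]; intros Hm.
      - rewrite csum_O. destruct Z.eq_dec; [lia|auto].
      - rewrite csum_S, IH by lia. destruct Z.eq_dec; [lia|cring]. }
    assert (B : (n < 0)%Z -> forall m,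
      csum (fun k => if Z.eq_dec (Z.of_nat k - n) 0 then RtoC (2 * PI) * g k else RtoC 0)%C m = RtoC 0).
    { intros Hn. induction m as [|m IH].
      - rewrite csum_O. destruct Z.eq_dec; [lia|auto].
      - rewrite csum_S, IH. destruct Z.eq_dec; [lia|cring]. }
    unfold l. destruct (Z_le_dec 0 n) as [Hn|Hn]; [|apply B; lia].
    induction N as [|N IH].
    + change (0 + Z.to_nat n)%nat with (Z.to_nat n). destruct (Z.to_nat n) as [|m] eqn:E.
      * rewrite csum_O. destruct Z.eq_dec; [auto|lia].
      * rewrite csum_S, A by lia. destruct Z.eq_dec; [cring|lia].
    + change (S N + Z.to_nat n)%nat with (S (N + Z.to_nat n)). rewrite csum_S, IH. destruct Z.eq_dec; [lia|cring].
  - intros eps He.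
    assert (Eu : ex_series (fun k => Cmod (g k))).
    { apply ex_series_nonneg with M; [intros; apply Cmod_ge_0|exact H]. }
    pose proof (Series_correct _ Eu) as L.
    change (is_lim_seq (rsum (fun k => Cmod (g k))) (Series (fun k => Cmod (g k)))) in L.
    apply is_lim_seq_spec in L. destruct (L (mkposreal eps He)) as [N0 HN].
    exists N0. intros N x HN'.
    rewrite (csum_ext _ (fun k => (g k * cis (INR k * x)) * cis (- (IZR n * x)))%C).
    2:{ intros k _. rewrite <- Cmult_assoc, <- cis_plus. do 2 f_equal.
        rewrite minus_IZR, INR_IZR_INZ. ring. }
    rewrite csum_mult_r. unfold tser.
    set (N1 := (N + Z.to_nat n)%nat).
    replace (csum (fun k => g k * cis (INR k * x))%C N1 * cis (- (IZR n * x))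
             - CSeries (fun k => g k * cis (INR k * x)) * cis (- (IZR n * x)))%C
      with (- ((CSeries (fun k => g k * cis (INR k * x)) - csum (fun k => g k * cis (INR k * x)) N1) * cis (- (IZR n * x))))%C by ring.
    rewrite Cmod_opp, Cmod_mult, Cmod_cis, Rmult_1_r.
    eapply Rle_lt_trans; [apply Cmod_CSeries_tail with (1 := l1_tser g M x H)|].
    rewrite (Series_ext _ (fun k => Cmod (g k))) by (intros; rewrite Cmod_mult, Cmod_cis; lra).
    rewrite (rsum_ext _ (fun k => Cmod (g k))) by (intros; rewrite Cmod_mult, Cmod_cis; lra).
    specialize (HN N1 ltac:(unfold N1; lia)). simpl in HN.
    rewrite Rabs_minus_sym in HN. eapply Rle_lt_trans; [apply Rle_abs|exact HN].
Qed.

(** * Coefficients of holomorphic functions on circles *)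

Lemma cis_lipschitz a b : Cmod (cis a - cis b) <= 2 * Rabs (a - b).
Proof.
  assert (H : forall y, Cmod (cis y - 1) <= 2 * Rabs y).
  { intros y. eapply Rle_trans; [apply Cmod_le_Re_Im|].
    unfold cis, Cminus, Cplus, Copp, RtoC, Re, Im; simpl.
    replace (sin y + - 0) with (sin y) by ring.
    pose proof (Rabs_sin_le y).
    enough (Rabs (cos y + - (1)) <= Rabs y) by lra.
    destruct (MVT_gen cos 0 y (fun x => - sin x)) as [x [_ Ex]].
    - intros. apply is_derive_cos.
    - intros. apply continuity_cos.
    - rewrite cos_0 in Ex. unfold Rminus in Ex at 1. rewrite Ex, Rabs_mult, Rabs_Ropp, Rminus_0_r.
      assert (Rabs (sin x) <= 1) by (pose proof (SIN_bound x); apply Rabs_le; lra).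
      pose proof (Rabs_pos y). nra. }
  replace (cis a - cis b)%C with (cis b * (cis (a - b) - 1))%C.
  - rewrite Cmod_mult, Cmod_cis, Rmult_1_l. apply H.
  - replace a with (b + (a - b)) at 2 by ring. rewrite cis_plus. ring.
Qed.

Lemma polar (z : C) : exists r x, 0 <= r /\ - PI <= x <= PI /\ r = Cmod z /\ z = (RtoC r * cis x)%C.
Proof.
  destruct (Req_dec (Cmod z) 0) as [E|E].
  - exists 0, 0. pose proof PI_RGT_0. apply Cmod_eq_0 in E. subst z.
    repeat split; try lra. { now rewrite Cmod_0. } ring.
  - pose proof (Cmod_ge_0 z) as P.
    set (a := Re z / Cmod z). set (b := Im z / Cmod z).
    assert (Hab : a * a + b * b = 1).
    { pose proof (Cmod2_alt z) as Q. unfold a, b. field_simplify; [|auto].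
      replace (Re z ^ 2 + Im z ^ 2) with (Cmod z ^ 2) by auto. field. auto. }
    assert (Ha : -1 <= a <= 1) by (split; nra).
    pose proof (acos_bound a) as [B1 B2].
    assert (Ez : forall y, cos y = a -> sin y = b -> z = (RtoC (Cmod z) * cis y)%C).
    { intros y H1 H2. unfold cis. rewrite H1, H2. destruct z as [u v].
      unfold Cmult, RtoC, a, b; simpl. f_equal; unfold Re, Im; simpl; field; auto. }
    assert (Hs : sin (acos a) = Rabs b).
    { rewrite sin_acos by lra. rewrite <- sqrt_Rsqr_abs. f_equal. unfold Rsqr. lra. }
    destruct (Rle_dec 0 b) as [Hb|Hb].
    + exists (Cmod z), (acos a). repeat split; auto; try lra.
      apply Ez; [apply cos_acos; lra|]. rewrite Hs. apply Rabs_pos_eq; auto.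
    + exists (Cmod z), (- acos a). repeat split; auto; try lra.
      apply Ez; [rewrite cos_neg; apply cos_acos; lra|]. rewrite sin_neg, Hs, Rabs_left; lra.
Qed.

(** Compactness of the closed disk, transported from the rectangle of polar coordinates [[0,1] x
    [-PI,PI]]. *)
Lemma disk_locally_bounded (N : C -> R) :
  (forall z, Cmod z <= 1 -> exists d B, 0 < d /\
     forall w, Cmod w <= 1 -> Cmod (w - z) < d -> N w <= B) ->
  exists B, forall z, Cmod z <= 1 -> N z <= B.
Proof.
  intros H.
  (* The gauge [d] has two roles: it is the size of the neighbourhood, and [/ d] bounds [N] there,
     so a uniform lower bound on the gauge is a uniform bound on [N]. The factor 3 allows for an
     error [d] in the radius and [d] in the angle, the latter moving the point by at most [2 d]. *)
  assert (E : forall u v, exists d : posreal, 0 <= u <= 1 ->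
     forall w, Cmod w <= 1 -> Cmod (w - RtoC u * cis v) < 3 * d -> N w <= / d).
  { intros u v. destruct (Rle_dec 0 u) as [H0|H0]; [|exists (mkposreal 1 Rlt_0_1); intros; lra].
    destruct (Rle_dec u 1) as [H1|H1]; [|exists (mkposreal 1 Rlt_0_1); intros; lra].
    destruct (H (RtoC u * cis v)%C) as [d [B [Hd K]]].
    { rewrite Cmod_mult, Cmod_R, Cmod_cis, Rabs_pos_eq by auto. lra. }
    assert (HB : 0 < / (Rabs B + 1)) by (apply Rinv_0_lt_compat; pose proof (Rabs_pos B); lra).
    assert (Hd3 : 0 < d / 3) by lra.
    exists (mkposreal _ (Rmin_pos _ _ Hd3 HB)). intros _ w Hw Hw'. simpl in *.
    pose proof (Rmin_l (d / 3) (/ (Rabs B + 1))). pose proof (Rmin_r (d / 3) (/ (Rabs B + 1))).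
    apply Rle_trans with (Rabs B + 1).
    - specialize (K w Hw ltac:(lra)). pose proof (Rle_abs B). lra.
    - rewrite <- (Rinv_inv (Rabs B + 1)) at 1. apply Rinv_le_contravar; auto. now apply Rmin_pos. }
  pose (delta := fun u v => proj1_sig (constructive_indefinite_description _ (E u v))).
  assert (Hdelta : forall u v, 0 <= u <= 1 ->
     forall w, Cmod w <= 1 -> Cmod (w - RtoC u * cis v) < 3 * delta u v -> N w <= / delta u v).
  { intros u v. unfold delta. destruct constructive_indefinite_description; auto. }
  destruct (compactness_value_2d 0 1 (- PI) PI delta) as [d Hd].
  (* The covering property is only available under a double negation, so the comparison is decided
     first and the covering is used to reach a contradiction. *)
  exists (/ d). intros z Hz. destruct (Rle_dec (N z) (/ d)) as [|F]; [auto|exfalso].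
  destruct (polar z) as [r [x [Hr [Hx [Er Ez]]]]].
  apply (Hd r x); [lra|lra|]. intros [u [v [Hu [Hv [Hru [Hxv Hdd]]]]]]. apply F.
  pose proof (cond_pos d). apply Rle_trans with (/ delta u v); [|now apply Rinv_le_contravar].
  apply (Hdelta u v Hu z Hz). rewrite Ez.
  replace (RtoC r * cis x - RtoC u * cis v)%C
    with (RtoC (r - u) * cis x + RtoC u * (cis x - cis v))%C by (rewrite RtoC_minus; ring).
  eapply Rle_lt_trans; [apply Cmod_triangle|].
  rewrite !Cmod_mult, Cmod_cis, !Cmod_R, (Rabs_pos_eq u) by lra.
  pose proof (cis_lipschitz x v). pose proof (Rabs_pos (x - v)). pose proof (Cmod_ge_0 (cis x - cis v)). nra.
Qed.

(* The nonnegative Fourier coefficients of [F] on the circle of radius [r]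
   are [g n * r ^ n]. *)
Definition has_coefs (F : C -> C) (r : R) (g : nat -> C) : Prop :=
  forall n : nat, is_CInt (fun x => F (RtoC r * cis x) * cis (- (INR n * x)))%C
                    (RtoC (2 * PI) * (g n * RtoC (r ^ n)))%C.

Definition der (g : nat -> C) (n : nat) : C := (RtoC (INR (S n)) * g (S n))%C.

Lemma Ci_neq_0 : Ci <> RtoC 0.
Proof. apply Cmod_gt_0. rewrite Cmod_Ci. lra. Qed.

Lemma is_deriveR_circle r x :
  is_deriveR (fun u => RtoC r * cis u)%C x (Ci * (RtoC r * cis x))%C.
Proof.
  replace (Ci * (RtoC r * cis x))%C with (RtoC r * (Ci * RtoC 1 * cis (1 * x)))%C
    by (rewrite Rmult_1_l; ring).
  apply is_deriveR_ext with (fun u => RtoC r * cis (1 * u))%C.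
  - intros. now rewrite Rmult_1_l.
  - apply is_deriveR_scal_l, is_deriveR_cis.
Qed.

Lemma Cmod_circle r x : 0 <= r -> Cmod (RtoC r * cis x) = r.
Proof. intros. rewrite Cmod_mult, Cmod_R, Cmod_cis, Rabs_pos_eq; lra. Qed.

(** Integration by parts: the derivative of the periodic function [F(r e^(ix)) e^(-i(n+1)x)] has
    zero integral, which relates coefficient [n + 1] of [F] to coefficient [n] of [F']. The
    differentiability of [F'] makes the integrand continuous. *)
Lemma has_coefs_der (F F' : C -> C) r (g : nat -> C) :
  0 < r < 1 ->
  (forall z, Cmod z < 1 -> is_deriveC F z (F' z)) ->
  (forall z, Cmod z < 1 -> exists l, is_deriveC F' z l) ->
  has_coefs F r g -> has_coefs F' r (der g).
Proof.
  intros Hr HF HF' H n.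
  assert (HC : forall x, Cmod (RtoC r * cis x) < 1) by (intros; rewrite Cmod_circle; lra).
  set (a := - INR (S n)).
  set (h := fun x => (F (RtoC r * cis x) * cis (a * x))%C).
  set (dh := fun x => (Ci * (RtoC r * (F' (RtoC r * cis x) * cis (- (INR n * x))))
                       + Ci * RtoC a * h x)%C).
  assert (Eh : forall x, (cis x * cis (a * x))%C = cis (- (INR n * x))).
  { intros x. rewrite <- cis_plus. f_equal. unfold a. rewrite S_INR. ring. }
  assert (Dh : forall x, is_deriveR h x (dh x)).
  { intros x. unfold dh, h.
    replace (Ci * (RtoC r * (F' (RtoC r * cis x) * cis (- (INR n * x)))) + Ci * RtoC a * (F (RtoC r * cis x) * cis (a * x)))%C
      with ((Ci * (RtoC r * cis x) * F' (RtoC r * cis x)) * cis (a * x)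
            + F (RtoC r * cis x) * (Ci * RtoC a * cis (a * x)))%C by (rewrite <- Eh; ring).
    apply (is_deriveR_mult (fun u => F (RtoC r * cis u)%C) (fun u => cis (a * u))).
    - apply is_deriveR_comp; [now apply HF|apply is_deriveR_circle].
    - apply is_deriveR_cis. }
  assert (I : is_CInt dh (RtoC 0)).
  { replace (RtoC 0) with (h (2 * PI)%R - h 0%R)%C.
    - apply is_CInt_derive; auto. intros x. destruct (HF' _ (HC x)) as [l Hl].
      eexists. unfold dh.
      apply (is_derive_plus (K := R_AbsRing) (V := C_R_NormedModule)
        (fun x => (Ci * (RtoC r * (F' (RtoC r * cis x) * cis (- (INR n * x)))))%C)
        (fun x => (Ci * RtoC a * h x)%C)).
      + apply is_deriveR_scal_l, is_deriveR_scal_l.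
        apply (is_deriveR_mult (fun u => F' (RtoC r * cis u)%C) (fun u => cis (- (INR n * u)))).
        * apply is_deriveR_comp; [exact Hl|apply is_deriveR_circle].
        * apply is_deriveR_ext with (fun u => cis ((- INR n) * u)); [intros; f_equal; ring|].
          apply is_deriveR_cis.
      + apply is_deriveR_scal_l, Dh.
    - unfold h, a.
      replace (- INR (S n) * (2 * PI)) with (IZR (- Z.of_nat (S n)) * (2 * PI))
        by (rewrite opp_IZR, <- INR_IZR_INZ; ring).
      rewrite cis_2PI, Rmult_0_r, cis_0.
      replace (2 * PI) with (IZR 1 * (2 * PI)) by ring. rewrite cis_2PI. ring. }
  specialize (H (S n)).
  assert (I2 := is_CInt_scal (/ (Ci * RtoC r))%C _ _
           (is_CInt_plus _ _ _ _ I (is_CInt_scal (- (Ci * RtoC a))%C _ _ H))).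
  assert (Hr' : RtoC r <> RtoC 0) by (intros E; apply RtoC_inj in E; lra).
  pose proof Ci_neq_0 as HCi.
  replace (RtoC (2 * PI) * (der g n * RtoC (r ^ n)))%C
    with (/ (Ci * RtoC r) * (RtoC 0 + - (Ci * RtoC a) * (RtoC (2 * PI) * (g (S n) * RtoC (r ^ (S n))))))%C.
  - eapply is_CInt_ext; [|exact I2]. intros x. cbv beta.
    replace (- (INR (S n) * x)) with (a * x) by (unfold a; ring).
    unfold dh. unfold h. field. auto.
  - unfold der, a. rewrite RtoC_opp. simpl (r ^ S n). rewrite (RtoC_mult r). field. auto.
Qed.

(** Cauchy's estimate, with the factor 2 inherited from [is_CInt_bound]. *)
Lemma has_coefs_bound (F : C -> C) r (g : nat -> C) M n :
  0 <= r -> (forall z, Cmod z = r -> Cmod (F z) <= M) -> has_coefs F r g ->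
  Cmod (g n) * r ^ n <= 2 * M.
Proof.
  intros Hr HM H. specialize (H n).
  apply is_CInt_bound with (M := M) in H.
  - rewrite !Cmod_mult, !Cmod_R, !Rabs_pos_eq in H.
    + pose proof two_PI_pos. apply Rmult_le_reg_l with (2 * PI); auto.
    + now apply pow_le.
    + pose proof two_PI_pos. lra.
  - intros x _. rewrite Cmod_mult, Cmod_cis, Rmult_1_r. apply HM. now apply Cmod_circle.
Qed.

(** * The convolution algebra of absolutely convergent trigonometric series *)

Lemma CSeries_mult_r (u : nat -> C) (a : C) M :
  l1_bound u M -> CSeries (fun k => u k * a)%C = (CSeries u * a)%C.
Proof.
  intros H. apply is_Cseries_unique, is_Cseries_iff.
  pose proof (proj1 (is_Cseries_iff _ _) (is_Cseries_l1 u M H)) as L.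
  apply is_lim_seq_ext with (fun N => Cmod (csum u N - CSeries u) * Cmod a).
  - intros N. rewrite <- Cmod_mult, csum_mult_r. f_equal. ring.
  - replace (Finite 0) with (Rbar_mult (Finite 0) (Cmod a)) by (simpl; f_equal; ring).
    now apply is_lim_seq_scal_r.
Qed.

Lemma CSeries_mult_l (u : nat -> C) (a : C) M :
  l1_bound u M -> CSeries (fun k => a * u k)%C = (a * CSeries u)%C.
Proof.
  intros H. rewrite Cmult_comm, <- (CSeries_mult_r u a M H). apply CSeries_ext. intros. ring.
Qed.

Lemma tser_conv (u v : nat -> C) U V x :
  l1_bound u U -> l1_bound v V -> tser (conv u v) x = (tser u x * tser v x)%C.
Proof.
  intros Hu Hv. unfold tser at 1.
  rewrite <- (CSeries_conv u v (fun k => cis (INR k * x)) U V 1 Hu Hv)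
    by (intros; rewrite Cmod_cis; lra).
  unfold tser. rewrite <- (CSeries_mult_r _ _ U) by now apply l1_tser.
  apply CSeries_ext. intros j.
  rewrite <- (Cmult_assoc (u j)). f_equal.
  rewrite <- (CSeries_mult_l _ _ V) by now apply l1_tser.
  apply CSeries_ext. intros i. rewrite plus_INR, Rmult_plus_distr_r, cis_plus. ring.
Qed.

Lemma csum_delta (w : nat -> C) N : csum (fun m => delta m * w m)%C N = w O.
Proof.
  induction N as [|N IH]; [rewrite csum_O|rewrite csum_S, IH]; simpl; ring.
Qed.

Lemma CSeries_delta (w : nat -> C) : CSeries (fun m => delta m * w m)%C = w O.
Proof.
  apply is_Cseries_unique, is_Cseries_iff.
  apply is_lim_seq_ext with (fun _ => 0); [|apply is_lim_seq_const].
  intros N. rewrite csum_delta. replace (w O - w O)%C with (RtoC 0) by ring. now rewrite Cmod_0.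
Qed.

Lemma tser_delta x : tser delta x = RtoC 1.
Proof.
  unfold tser. rewrite CSeries_delta. simpl. now rewrite Rmult_0_l, cis_0.
Qed.

Lemma tser_ext (u v : nat -> C) x : (forall n, u n = v n) -> tser u x = tser v x.
Proof. intros H. apply CSeries_ext. intros. now rewrite H. Qed.

Lemma has_coefs_tser (F : C -> C) r (g : nat -> C) M :
  l1_bound (fun n => g n * RtoC (r ^ n))%C M ->
  (forall x, F (RtoC r * cis x)%C = tser (fun n => g n * RtoC (r ^ n))%C x) ->
  has_coefs F r g.
Proof.
  intros H E n.
  pose proof (is_CInt_tser _ M (Z.of_nat n) H) as I.
  destruct Z_le_dec as [_|]; [|lia]. rewrite Nat2Z.id in I.
  eapply is_CInt_ext; [|exact I]. intros x. cbv beta. now rewrite E, INR_IZR_INZ.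
Qed.

Definition dil (r : R) (g : nat -> C) (n : nat) : C := (g n * RtoC (r ^ n))%C.

Lemma conv_dil r (u v : nat -> C) m : conv (dil r u) (dil r v) m = dil r (conv u v) m.
Proof.
  unfold conv, dil. rewrite <- csum_mult_r. apply csum_ext. intros j Hj.
  replace (r ^ m) with (r ^ j * r ^ (m - j)) by (rewrite <- pow_add; f_equal; lia).
  rewrite RtoC_mult. ring.
Qed.

Lemma dil_delta r m : dil r delta m = delta m.
Proof. unfold dil. destruct m; simpl; ring. Qed.

Lemma pow_diff_le a b n : 0 <= a <= b -> b <= 1 -> 0 <= b ^ n - a ^ n <= INR n * (b - a).
Proof.
  intros H Hb. induction n as [|n IH]; [simpl; lra|].
  rewrite S_INR. simpl.
  assert (0 <= a ^ n) by (apply pow_le; lra).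
  assert (a ^ n <= 1) by (rewrite <- (pow1 n); apply pow_incr; lra).
  replace (b * b ^ n - a * a ^ n) with (b * (b ^ n - a ^ n) + (b - a) * a ^ n) by ring.
  split; [nra|]. pose proof (pos_INR n). nra.
Qed.

(** The sum of [1 / ((n+1)(n+2))] telescopes to at most 1. This converts a bound on the coefficients
    of a second derivative into absolute summability. *)
Lemma telescoping_bound (a : nat -> R) M N :
  (forall n, 0 <= a n) -> (forall n, INR (S n) * INR (S (S n)) * a n <= M) -> rsum a N <= M.
Proof.
  intros H0 H.
  assert (M0 : 0 <= M). { specialize (H O). specialize (H0 O). simpl in H. nra. }
  assert (K : forall n, a n <= M * (/ INR (S n) - / INR (S (S n)))).
  { intros n. specialize (H n). rewrite !S_INR in *. pose proof (pos_INR n).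
    replace (/ (INR n + 1) - / (INR n + 1 + 1)) with (/ ((INR n + 1) * (INR n + 1 + 1))) by (field; lra).
    apply Rmult_le_reg_l with ((INR n + 1) * (INR n + 1 + 1)); [nra|].
    eapply Rle_trans; [exact H|]. right. field. lra. }
  assert (T : forall n, rsum a n <= M * (1 - / INR (S (S n)))).
  { induction n as [|n IH].
    - rewrite rsum_O. specialize (K O). simpl in K. simpl. lra.
    - rewrite rsum_S. specialize (K (S n)). lra. }
  eapply Rle_trans; [apply T|].
  assert (0 < / INR (S (S N))) by (apply Rinv_0_lt_compat, lt_0_INR; lia). nra.
Qed.

Lemma rsum_shift2 (a : nat -> R) N : (forall n, 0 <= a n) ->
  rsum a N <= a O + a 1%nat + rsum (fun n => a (S (S n))) N.
Proof.
  intros H.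
  assert (E : forall n, rsum a (S (S n)) = a O + a 1%nat + rsum (fun n => a (S (S n))) n).
  { induction n as [|n IH]; [rewrite !rsum_S, !rsum_O; lra|].
    rewrite rsum_S, IH, rsum_S. lra. }
  rewrite <- E. apply rsum_incr; [auto|lia].
Qed.

(** * Absolute summability of the inverse series *)

(** Each coefficient of the inverse depends on all earlier ones; carrying the whole table up to [N]
    turns this into a structural recursion. *)
Fixpoint conv_inv_upto (p : nat -> C) (N : nat) : nat -> C :=
  match N with
  | O => delta
  | S N' => fun m => if Nat.eqb m N then (- csum (fun j => p (S j) * conv_inv_upto p N' (N' - j)%nat) N')%C
                     else conv_inv_upto p N' m
  end.

Definition conv_inv (p : nat -> C) (n : nat) : C := conv_inv_upto p n n.

Lemma conv_inv_upto_stable p N m : (m <= N)%nat -> conv_inv_upto p N m = conv_inv p m.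
Proof.
  induction N as [|N IH]; intros H.
  - now replace m with O by lia.
  - simpl. destruct (Nat.eqb_spec m (S N)) as [->|E].
    + unfold conv_inv. simpl. now rewrite Nat.eqb_refl.
    + apply IH. lia.
Qed.

Lemma csum_S_head (u : nat -> C) N : csum u (S N) = (u O + csum (fun n => u (S n)) N)%C.
Proof.
  induction N as [|N IH].
  - rewrite csum_S, !csum_O. reflexivity.
  - rewrite csum_S, IH, csum_S. cring.
Qed.

Lemma conv_inv_correct p n : p O = RtoC 1 -> conv p (conv_inv p) n = delta n.
Proof.
  intros Hp. destruct n as [|n].
  - unfold conv. rewrite csum_O, Hp. unfold conv_inv. simpl. ring.
  - unfold conv. rewrite csum_S_head, Hp.
    unfold conv_inv at 1. simpl. rewrite Nat.eqb_refl.
    rewrite (csum_ext (fun j => p (S j) * conv_inv_upto p n (n - j)%nat)%C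
                      (fun j => p (S j) * conv_inv p (n - j)%nat)%C).
    + ring.
    + intros k Hk. rewrite conv_inv_upto_stable by lia. reflexivity.
Qed.

Lemma l1_bound_delta : l1_bound delta 1.
Proof.
  intros N. induction N as [|N IH]; [rewrite rsum_O|rewrite rsum_S]; simpl;
    rewrite ?Cmod_1, ?Cmod_0; lra.
Qed.

Lemma l1_bound_dil (g : nat -> C) r M : 0 <= r <= 1 -> l1_bound g M -> l1_bound (dil r g) M.
Proof.
  intros Hr. apply l1_bound_mono. intros n. unfold dil.
  rewrite Cmod_mult, Cmod_R, Rabs_pos_eq by (apply pow_le; lra).
  assert (r ^ n <= 1) by (rewrite <- (pow1 n); apply pow_incr; lra).
  pose proof (Cmod_ge_0 (g n)). nra.
Qed.

(** With [q = dil r' p - dil r p], of norm at most [B (r' - r)], the inverses satisfy the resolvent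
    identity [d_r' = d_r - d_r q d_r']. Since [d_r q] has norm at most 1/2, the last term is
    absorbed on the left. *)
Lemma inverse_step (p d : nat -> C) B K r r' :
  (forall n, conv p d n = delta n) ->
  l1_bound (fun n => RtoC (INR n) * p n)%C B ->
  0 <= r <= r' -> r' <= 1 -> K * (B * (r' - r)) <= / 2 ->
  l1_bound (dil r d) K -> l1_bound (dil r' d) (2 * K).
Proof.
  intros Hpd HB Hr Hr' Hs HK.
  set (q := fun n => (dil r' p n - dil r p n)%C).
  assert (Hq : l1_bound q (B * (r' - r))).
  { intros N. apply Rle_trans with (rsum (fun n => Cmod (RtoC (INR n) * p n) * (r' - r)) N).
    - apply rsum_le. intros n _. unfold q, dil.
      replace (p n * RtoC (r' ^ n) - p n * RtoC (r ^ n))%C with (p n * RtoC (r' ^ n - r ^ n))%C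
        by (rewrite RtoC_minus; ring).
      rewrite !Cmod_mult, !Cmod_R, (Rabs_pos_eq (INR n)) by apply pos_INR.
      pose proof (pow_diff_le r r' n Hr Hr') as D. rewrite Rabs_pos_eq by lra.
      rewrite (Rmult_comm (INR n)), Rmult_assoc. apply Rmult_le_compat_l; [apply Cmod_ge_0|lra].
    - rewrite rsum_mult_r. apply Rmult_le_compat_r; [lra|apply HB]. }
  assert (Hu := l1_bound_conv _ _ _ _ HK Hq).
  assert (E : forall n, dil r' d n = (dil r d n - conv (conv (dil r d) q) (dil r' d) n)%C).
  { intros n.
    assert (E1 : conv (dil r d) (conv (dil r' p) (dil r' d)) n = dil r d n).
    { rewrite (conv_ext _ (dil r d) _ delta); [apply conv_delta_r|auto|].
      intros m _. rewrite conv_dil. unfold dil. rewrite Hpd. exact (dil_delta r' m). }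
    assert (E2 : forall m, conv (dil r d) (dil r' p) m = (delta m + conv (dil r d) q m)%C).
    { intros m. rewrite conv_comm.
      rewrite (conv_ext _ (fun n => dil r p n + q n)%C _ (dil r d)) by (intros; unfold q; auto; ring).
      rewrite conv_plus_l, (conv_comm q), conv_dil. f_equal. unfold dil. rewrite Hpd. apply dil_delta. }
    rewrite <- conv_assoc in E1.
    rewrite (conv_ext _ (fun m => delta m + conv (dil r d) q m)%C _ (dil r' d)) in E1 by auto.
    rewrite conv_plus_l, conv_delta_l in E1. rewrite <- E1. ring. }
  intros N. set (SN := rsum (fun k => Cmod (dil r' d k)) N).
  assert (S0 : 0 <= SN) by apply rsum_Cmod_nonneg.
  (* The absorption takes place on partial sums, which are finite; the summability of [dil r' d] is
     thus a conclusion and is not presupposed. *)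
  assert (Hle : SN <= K + / 2 * SN).
  { unfold SN at 1.
    apply Rle_trans with (rsum (fun k => Cmod (dil r d k) + Cmod (conv (conv (dil r d) q) (dil r' d) k)) N).
    - apply rsum_le. intros n _. rewrite E at 1. unfold Cminus.
      eapply Rle_trans; [apply Cmod_triangle|]. rewrite Cmod_opp. lra.
    - rewrite (sum_n_plus (G := R_AbelianGroup)). apply Rplus_le_compat; [apply HK|].
      eapply Rle_trans; [apply conv_bound_upto|]. fold SN.
      apply Rmult_le_compat_r; [auto|]. eapply Rle_trans; [apply Hu|exact Hs]. }
  lra.
Qed.

(* Wiener's lemma for a power series that is nonvanishing on the closed disk,
   by continuity in the radius [r]: the l1 norm of the inverse series on the
   circle of radius [r] is bounded independently of [r] as soon as it is
   finite, because its terms are then the Fourier coefficients of [1/P]. *)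
Lemma inverse_l1 (P P' P'' : C -> C) (p d : nat -> C) Mp B :
  (forall z, Cmod z < 1 -> is_deriveC P z (P' z)) ->
  (forall z, Cmod z < 1 -> is_deriveC P' z (P'' z)) ->
  (forall z, Cmod z < 1 -> exists l, is_deriveC P'' z l) ->
  (exists M, forall z, Cmod z <= 1 -> P z <> RtoC 0 /\ Cmod (/ P z) <= M
      /\ Cmod (P' z) <= M /\ Cmod (P'' z) <= M) ->
  l1_bound p Mp -> l1_bound (fun n => RtoC (INR n) * p n)%C B ->
  (forall r x, 0 < r < 1 -> P (RtoC r * cis x)%C = tser (dil r p) x) ->
  d O = RtoC 1 -> (forall n, conv p d n = delta n) ->
  exists K, l1_bound d K.
Proof.
  intros HP HP' HP'' [M HM] Hp HB HPp Hd0 Hpd.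
  set (Q := fun z => (/ P z)%C).
  set (Q' := fun z => (- (P' z * (Q z * Q z)))%C).
  set (Q'' := fun z => (- (P'' z * (Q z * Q z) + P' z * (Q' z * Q z + Q z * Q' z)))%C).
  assert (HQ : forall z, Cmod z < 1 -> is_deriveC Q z (Q' z)).
  { intros z Hz. destruct (HM z ltac:(lra)) as [H0 _].
    replace (Q' z) with (- P' z / (P z * P z))%C by (unfold Q', Q; field; auto).
    apply is_deriveC_inv; auto. }
  assert (HQ' : forall z, Cmod z < 1 -> is_deriveC Q' z (Q'' z)).
  { intros z Hz. apply is_deriveC_opp.
    apply (is_deriveC_mult P' (fun z => Q z * Q z)%C); auto. apply (is_deriveC_mult Q Q); auto. }
  (* This is the continuity requirement of the second integration by parts, and the reason why [P'']
     is assumed differentiable. *)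
  assert (HQ'' : forall z, Cmod z < 1 -> exists l, is_deriveC Q'' z l).
  { intros z Hz. destruct (HP'' z Hz) as [l Hl]. eexists. apply is_deriveC_opp.
    apply (is_deriveC_plus (fun z => P'' z * (Q z * Q z))%C (fun z => P' z * (Q' z * Q z + Q z * Q' z))%C).
    - apply (is_deriveC_mult P'' (fun z => Q z * Q z)%C); [exact Hl|]. apply (is_deriveC_mult Q Q); auto.
    - apply (is_deriveC_mult P' (fun z => Q' z * Q z + Q z * Q' z)%C); [auto|].
      apply (is_deriveC_plus (fun z => Q' z * Q z)%C (fun z => Q z * Q' z)%C);
        [apply (is_deriveC_mult Q' Q)|apply (is_deriveC_mult Q Q')]; auto. }
  assert (M0 : 0 <= M).
  { destruct (HM (RtoC 0)) as [_ [H _]]; [rewrite Cmod_0; lra|].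
    pose proof (Cmod_ge_0 (/ P (RtoC 0))). lra. }
  set (N1 := M * (M * M)). set (N2 := M * (M * M) + M * (N1 * M + M * N1)).
  assert (BQ' : forall z, Cmod z <= 1 -> Cmod (Q' z) <= N1).
  { intros z Hz. destruct (HM z Hz) as [_ [H1 [H2 H3]]]. unfold Q', N1.
    rewrite Cmod_opp, !Cmod_mult. fold (Q z) in H1.
    repeat apply Rmult_le_compat; auto using Cmod_ge_0, Rmult_le_pos. }
  assert (BQ'' : forall z, Cmod z <= 1 -> Cmod (Q'' z) <= N2).
  { intros z Hz. destruct (HM z Hz) as [_ [H1 [H2 H3]]]. unfold Q'', N2.
    specialize (BQ' z Hz). fold (Q z) in H1.
    rewrite Cmod_opp. eapply Rle_trans; [apply Cmod_triangle|]. rewrite !Cmod_mult.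
    apply Rplus_le_compat.
    - repeat apply Rmult_le_compat; auto using Cmod_ge_0, Rmult_le_pos.
    - apply Rmult_le_compat; auto using Cmod_ge_0.
      eapply Rle_trans; [apply Cmod_triangle|]. rewrite !Cmod_mult.
      apply Rplus_le_compat; apply Rmult_le_compat; auto using Cmod_ge_0. }
  assert (N20 : 0 <= N2) by (eapply Rle_trans; [apply (Cmod_ge_0 (Q'' (RtoC 0)))|apply BQ''; rewrite Cmod_0; lra]).
  (* Differentiating twice loses the first two coefficients, which are kept explicitly; the others
     are controlled by Cauchy's estimate for [Q''] and telescoping. *)
  set (K := Cmod (d O) + Cmod (d 1%nat) + 2 * N2).
  assert (HK : 1 <= K).
  { unfold K. rewrite Hd0, Cmod_1. pose proof (Cmod_ge_0 (d 1%nat)). lra. }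
  (* The bound [M'] only licenses the identification of [d] with the coefficients of [Q] on the
     circle; the resulting bound [K] does not depend on it. *)
  assert (Apriori : forall r M', 0 <= r < 1 -> l1_bound (dil r d) M' -> l1_bound (dil r d) K).
  { intros r M' Hr HM'. destruct (Req_dec r 0) as [->|Hr0].
    - intros N. apply Rle_trans with 1; [|exact HK].
      apply (l1_bound_ext delta); [|apply l1_bound_delta].
      intros [|n]; unfold dil; simpl; f_equal; [rewrite Hd0|rewrite Rmult_0_l]; ring.
    - assert (Hr' : 0 < r < 1) by lra.
      assert (HC : has_coefs Q r d).
      { apply has_coefs_tser with M'; [exact HM'|]. intros x.
        unfold Q. rewrite HPp by auto.
        assert (E : (tser (dil r p) x * tser (dil r d) x)%C = RtoC 1).
        { rewrite <- (tser_conv _ _ Mp M'); [|apply l1_bound_dil; auto; lra|exact HM'].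
          rewrite <- (tser_delta x). apply tser_ext. intros n. rewrite conv_dil.
          unfold dil. rewrite Hpd. apply dil_delta. }
        change (fun n => d n * RtoC (r ^ n))%C with (dil r d).
        assert (E0 : tser (dil r p) x <> RtoC 0).
        { intros E0. rewrite E0, Cmult_0_l in E. apply RtoC_inj in E. lra. }
        rewrite <- (Cmult_1_l (/ tser (dil r p) x)), <- E. field. exact E0. }
      apply (has_coefs_der Q Q') in HC; auto; [|intros z Hz; eexists; now apply HQ'].
      apply (has_coefs_der Q' Q'') in HC; auto.
      intros N. eapply Rle_trans; [apply rsum_shift2; intros; apply Cmod_ge_0|].
      assert (Hle1 : forall n, Cmod (dil r d n) <= Cmod (d n)).
      { intros n. unfold dil. rewrite Cmod_mult, Cmod_R, Rabs_pos_eq by (apply pow_le; lra).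
        assert (r ^ n <= 1) by (rewrite <- (pow1 n); apply pow_incr; lra).
        pose proof (Cmod_ge_0 (d n)). nra. }
      pose proof (Hle1 O). pose proof (Hle1 1%nat).
      assert (rsum (fun n => Cmod (dil r d (S (S n)))) N <= 2 * N2); [|unfold K; lra].
      apply telescoping_bound; [intros; apply Cmod_ge_0|]. intros n.
      assert (Hb := has_coefs_bound Q'' r (der (der d)) N2 n (proj1 Hr) ltac:(intros z Hz; apply BQ''; lra) HC).
      eapply Rle_trans; [|exact Hb]. unfold der, dil.
      rewrite !Cmod_mult, !Cmod_R, !(Rabs_pos_eq (INR _)) by apply pos_INR.
      rewrite Rabs_pos_eq by (apply pow_le; lra).
      assert (r ^ S (S n) <= r ^ n).
      { assert (0 <= r ^ n) by (apply pow_le; lra). simpl. assert (r * r <= 1) by nra.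
        replace (r * (r * r ^ n)) with (r * r * r ^ n) by ring. nra. }
      pose proof (Cmod_ge_0 (d (S (S n)))). pose proof (pos_INR (S n)). pose proof (pos_INR (S (S n))).
      rewrite !Rmult_assoc. repeat (apply Rmult_le_compat_l; [auto|]). auto. }
  assert (B0 : 0 <= B) by (eapply l1_bound_nonneg, HB).
  (* A step length that works at every radius, since [K * B * eps <= 1/2]; [B + 1] replaces [B] to
     avoid dividing by zero. *)
  set (eps := / (2 * K * (B + 1))).
  assert (He : 0 < eps) by (apply Rinv_0_lt_compat; nra).
  assert (HKe : K * (B * eps) <= / 2).
  { unfold eps. apply Rmult_le_reg_r with (2 * K * (B + 1)); [nra|].
    replace (K * (B * / (2 * K * (B + 1))) * (2 * K * (B + 1))) with (K * B) by (field; lra).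
    replace (/ 2 * (2 * K * (B + 1))) with (K * (B + 1)) by field. nra. }
  assert (Step : forall r r', 0 <= r < 1 -> r <= r' <= 1 -> r' - r <= eps ->
    (exists M', l1_bound (dil r d) M') -> exists M', l1_bound (dil r' d) M').
  { intros r r' Hr Hr' Hd [M' HM']. exists (2 * K).
    apply (inverse_step p d B K r r'); auto; try lra.
    - apply Rle_trans with (K * (B * eps)); [|exact HKe].
      apply Rmult_le_compat_l; [lra|]. apply Rmult_le_compat_l; lra.
    - now apply Apriori with M'. }
  assert (All : forall n r, 0 <= r < 1 -> r <= INR n * eps -> exists M', l1_bound (dil r d) M').
  { induction n as [|n IH]; intros r Hr Hn.
    - exists 1. simpl in Hn. replace r with 0 by lra.
      apply (l1_bound_ext delta); [|apply l1_bound_delta].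
      intros [|m]; unfold dil; simpl; f_equal; [rewrite Hd0|rewrite Rmult_0_l]; ring.
    - rewrite S_INR in Hn.
      assert (0 <= INR n * eps) by (apply Rmult_le_pos; [apply pos_INR|lra]).
      apply (Step (Rmax 0 (r - eps)) r); unfold Rmax; destruct Rle_dec; try lra;
        apply IH; lra. }
  (* The last step goes from a radius below 1 to the boundary itself: [Step] uses the a priori bound
     only at its starting radius. *)
  destruct (Step (Rmax 0 (1 - eps)) 1) as [M' HM'].
  - unfold Rmax; destruct Rle_dec; lra.
  - unfold Rmax; destruct Rle_dec; lra.
  - unfold Rmax; destruct Rle_dec; lra.
  - destruct (nfloor_ex (/ eps)) as [n [_ Hn]]; [left; now apply Rinv_0_lt_compat|].
    apply (All (S n)); [unfold Rmax; destruct Rle_dec; lra|].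
    assert (1 <= INR (S n) * eps).
    { rewrite S_INR. apply Rmult_le_reg_r with (/ eps); [now apply Rinv_0_lt_compat|].
      rewrite Rmult_assoc, Rinv_r; lra. }
    unfold Rmax; destruct Rle_dec; lra.
  - exists M'. apply (l1_bound_ext (dil 1 d)); [|exact HM'].
    intros n. unfold dil. rewrite pow1, Cmult_1_r. reflexivity.
Qed.

(** * Series smooth up to the boundary *)

Lemma is_pseries_Cseries (a : nat -> C) (z l : C) :
  is_pseries (K := C_AbsRing) (V := C_NormedModule) a z l ->
  is_Cseries (fun k => a k * z ^ k)%C l.
Proof.
  intros H. apply is_Cseries_iff.
  assert (E : forall N, sum_n (G := C_NormedModule) (fun k => scal (pow_n (K := C_AbsRing) z k) (a k)) N
                        = csum (fun k => a k * z ^ k)%C N).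
  { intros N. apply csum_ext. intros n _.
    assert (P : forall k, pow_n (K := C_AbsRing) z k = (z ^ k)%C).
    { induction k as [|k IH]; [reflexivity|]. simpl. now rewrite IH. }
    change (pow_n (K := C_AbsRing) z n * a n = a n * z ^ n)%C. rewrite P. ring. }
  apply is_lim_seq_spec. intros eps.
  assert (He : 0 < eps / 2) by (pose proof (cond_pos eps); lra).
  destruct (H (ball l (mkposreal _ He))) as [N0 HN]; [now exists (mkposreal _ He)|].
  exists N0. intros N HN'. specialize (HN N HN'). cbv beta in HN. rewrite E in HN.
  apply C_NormedModule_mixin_compat2 in HN. simpl in HN.
  rewrite Rminus_0_r, Rabs_pos_eq by apply Cmod_ge_0.
  eapply Rlt_le_trans; [exact HN|].
  assert (sqrt 2 <= 2). { rewrite <- (sqrt_Rsqr 2) at 2 by lra. apply sqrt_le_1_alt. unfold Rsqr; lra. }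
  pose proof (cond_pos eps). nra.
Qed.

Lemma is_Cseries_terms_bounded (u : nat -> C) (l : C) :
  is_Cseries u l -> exists M, forall n, Cmod (u n) <= M.
Proof.
  intros H. apply is_Cseries_iff in H.
  destruct (filterlim_bounded (K := R_AbsRing) (V := R_NormedModule) (fun N => Cmod (csum u N - l)))
    as [M HM]; [exists 0; exact H|].
  assert (HM' : forall N, Cmod (csum u N - l) <= M).
  { intros N. eapply Rle_trans; [apply Rle_abs|apply HM]. }
  exists (2 * M + Cmod l). intros [|n].
  - specialize (HM' O). rewrite csum_O in HM'. replace (u O) with ((u O - l) + l)%C by ring.
    eapply Rle_trans; [apply Cmod_triangle|]. pose proof (Cmod_ge_0 (u O - l)). lra.
  - replace (u (S n)) with ((csum u (S n) - l) + - (csum u n - l))%C by (rewrite csum_S; ring).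
    eapply Rle_trans; [apply Cmod_triangle|]. rewrite Cmod_opp.
    pose proof (HM' n). pose proof (HM' (S n)). pose proof (Cmod_ge_0 l). lra.
Qed.

Lemma Cpow_mult (a b : C) n : ((a * b) ^ n)%C = (a ^ n * b ^ n)%C.
Proof. induction n as [|n IH]; simpl; [ring|rewrite IH; ring]. Qed.

Lemma RtoC_pow_nat (r : R) n : (RtoC r ^ n)%C = RtoC (r ^ n).
Proof. induction n as [|n IH]; simpl; [ring|rewrite IH, RtoC_mult; ring]. Qed.

Lemma geometric_bound q N : 0 <= q < 1 -> rsum (fun n => q ^ n) N <= / (1 - q).
Proof.
  intros Hq.
  assert (E : forall n, rsum (fun n => q ^ n) n = (1 - q ^ S n) / (1 - q)).
  { induction n as [|n IH].
    - rewrite rsum_O. simpl. field. lra.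
    - rewrite rsum_S, IH. simpl. field. lra. }
  rewrite E. assert (0 <= q ^ S N) by (apply pow_le; lra).
  unfold Rdiv. rewrite <- (Rmult_1_l (/ (1 - q))) at 2.
  apply Rmult_le_compat_r; [left; apply Rinv_0_lt_compat|]; lra.
Qed.

Definition disk_series (G : C -> C) (g : nat -> C) : Prop :=
  forall z, Cmod z < 1 -> is_Cseries (fun k => g k * z ^ k)%C (G z).

Lemma disk_series_l1 (G : C -> C) (g : nat -> C) r :
  disk_series G g -> 0 <= r < 1 -> exists M, l1_bound (dil r g) M.
Proof.
  (* Abel's argument: the terms are bounded at the radius [s] strictly between [r] and 1, hence
     decay like [(r/s)^n] at [r]. *)
  intros H Hr. set (s := (1 + r) / 2).
  assert (Hs : r < s < 1) by (unfold s; lra).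
  destruct (is_Cseries_terms_bounded _ _ (H (RtoC s) ltac:(rewrite Cmod_R, Rabs_pos_eq; lra))) as [M HM].
  assert (M0 : 0 <= M) by (eapply Rle_trans; [apply Cmod_ge_0|apply (HM O)]).
  assert (Hq : 0 <= r / s < 1).
  { split; [apply Rdiv_le_0_compat; lra|]. apply Rmult_lt_reg_r with s; [lra|].
    unfold Rdiv. rewrite Rmult_assoc, Rinv_l; lra. }
  exists (M * / (1 - r / s)). intros N.
  apply Rle_trans with (rsum (fun n => M * (r / s) ^ n) N).
  - apply rsum_le. intros n _. specialize (HM n). unfold dil.
    rewrite RtoC_pow_nat in HM. rewrite Cmod_mult, Cmod_R, Rabs_pos_eq in * by (apply pow_le; lra).
    replace (r ^ n) with (s ^ n * (r / s) ^ n).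
    + rewrite <- Rmult_assoc. apply Rmult_le_compat_r; [apply pow_le; lra|exact HM].
    + rewrite <- Rpow_mult_distr. f_equal. field. lra.
  - rewrite rsum_mult_l. apply Rmult_le_compat_l; auto. now apply geometric_bound.
Qed.

Lemma disk_series_circle (G : C -> C) (g : nat -> C) r x :
  disk_series G g -> 0 <= r < 1 -> G (RtoC r * cis x)%C = tser (dil r g) x.
Proof.
  intros H Hr. symmetry. apply is_Cseries_unique.
  specialize (H (RtoC r * cis x)%C ltac:(rewrite Cmod_circle; lra)).
  destruct H as [H H']. split;
    [apply is_series_ext with (2 := H)|apply is_series_ext with (2 := H')];
    intros n; unfold dil; [apply (f_equal Re)|apply (f_equal Im)]; rewrite Cpow_mult, cis_pow, RtoC_pow_nat; ring.
Qed.

Lemma disk_series_has_coefs (G : C -> C) (g : nat -> C) r :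
  disk_series G g -> 0 <= r < 1 -> has_coefs G r g.
Proof.
  intros H Hr. destruct (disk_series_l1 G g r H Hr) as [M HM].
  apply has_coefs_tser with M; [exact HM|]. intros x. now apply disk_series_circle.
Qed.

Lemma closed_disk_derivatives_bounded (f : C -> C) F n :
  closed_disk_derivatives f F -> exists M, forall z, Cmod z <= 1 -> Cmod (F n z) <= M.
Proof.
  intros [_ [_ H]]. apply (disk_locally_bounded (fun z => Cmod (F n z))).
  intros z Hz. destruct (filterlim_within_eps _ _ _ _ (H n z Hz) 1 Rlt_0_1) as [d [Hd K]].
  exists d, (Cmod (F n z) + 1). split; auto. intros w Hw Hwz. specialize (K w Hw Hwz).
  replace (F n w) with (F n z + (F n w - F n z))%C by ring.
  eapply Rle_trans; [apply Cmod_triangle|]. lra.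
Qed.

Lemma closed_disk_derivatives_inv_bounded (f : C -> C) F n :
  closed_disk_derivatives f F -> (forall z, Cmod z <= 1 -> F n z <> RtoC 0) ->
  exists M, forall z, Cmod z <= 1 -> Cmod (/ F n z) <= M.
Proof.
  intros [_ [_ H]] H0. apply (disk_locally_bounded (fun z => Cmod (/ F n z))).
  intros z Hz. pose proof (proj1 (Cmod_gt_0 _) (H0 z Hz)) as P.
  destruct (filterlim_within_eps _ _ _ _ (H n z Hz) (Cmod (F n z) / 2) ltac:(lra)) as [d [Hd K]].
  exists d, (/ (Cmod (F n z) / 2)). split; auto. intros w Hw Hwz. specialize (K w Hw Hwz).
  rewrite Cmod_inv by auto. apply Rinv_le_contravar; [lra|].
  assert (Cmod (F n z) <= Cmod (F n w) + Cmod (F n w - F n z)); [|lra].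
  replace (F n z) with (F n w + - (F n w - F n z))%C at 1 by ring.
  rewrite <- (Cmod_opp (F n w - F n z)). apply Cmod_triangle.
Qed.

Definition iter_der (n : nat) (g : nat -> C) : nat -> C := Nat.iter n der g.

Lemma has_coefs_iter_der (f : C -> C) F g n r :
  closed_disk_derivatives f F -> disk_series f g -> 0 < r < 1 -> has_coefs (F n) r (iter_der n g).
Proof.
  intros HF Hg Hr. pose proof HF as [HF0 [HFd _]]. induction n as [|n IH].
  - assert (E := disk_series_has_coefs f g r Hg ltac:(lra)). intros m.
    eapply is_CInt_ext; [|apply E]. intros x. simpl. rewrite HF0; [reflexivity|].
    rewrite Cmod_circle; lra.
  - simpl. apply (has_coefs_der (F n)); auto. intros z Hz. eexists. now apply HFd.
Qed.

Lemma radial_limit_le a b n : (forall r, 0 < r < 1 -> a * r ^ n <= b) -> 0 <= a -> a <= b.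
Proof.
  intros H Ha. apply Rnot_lt_le. intros Hab.
  (* Chosen so that [a * n * e <= (a - b) / 2]; by Bernoulli's inequality
     [a (1 - e)^n >= (a + b) / 2 > b]. The summand [a - b] in the denominator keeps it positive for
     [n = 0] and forces [e < 1]. *)
  set (e := (a - b) / (2 * (a * INR n + (a - b)))).
  pose proof (pos_INR n).
  assert (Hp : 0 < a * INR n + (a - b)) by nra.
  assert (Q : e * (a * INR n + (a - b)) = (a - b) / 2) by (unfold e; field; lra).
  assert (He : 0 < e) by (apply Rdiv_lt_0_compat; lra).
  assert (He1 : e < 1). { assert (0 <= a * INR n) by nra. nra. }
  specialize (H (1 - e) ltac:(lra)).
  pose proof (pow_diff_le (1 - e) 1 n ltac:(lra) ltac:(lra)) as D. rewrite pow1 in D.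
  assert (a * (1 - INR n * e) <= a * (1 - e) ^ n) by (apply Rmult_le_compat_l; lra).
  nra.
Qed.

(** Here smoothness up to the boundary enters: the [n]-th derivative is bounded on the whole closed
    disk, so Cauchy's estimate is uniform in the radius and survives the limit [r -> 1]. *)
Lemma iter_der_bounded (f : C -> C) F g n :
  closed_disk_derivatives f F -> disk_series f g -> exists M, forall k, Cmod (iter_der n g k) <= M.
Proof.
  intros HF Hg. destruct (closed_disk_derivatives_bounded f F n HF) as [M HM].
  exists (2 * M). intros k. apply radial_limit_le with k; [|apply Cmod_ge_0].
  intros r Hr. apply (has_coefs_bound (F n) r); [lra| |now apply has_coefs_iter_der with f].
  intros z Hz. apply HM. lra.
Qed.

(** The coefficient side of smoothness on the circle. The weight uses [S k], so that it is at least
    1 also at index 0. *)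
Definition rapid (g : nat -> C) : Prop :=
  forall N, exists M, l1_bound (fun k => RtoC (INR (S k) ^ N) * g k)%C M.

Lemma iter_der_S n g : iter_der n (der g) = iter_der (S n) g.
Proof. unfold iter_der. symmetry. apply Nat.iter_succ_r. Qed.

Lemma rapid_of_bounded (g : nat -> C) :
  (forall N, exists M, forall k, INR (S k) ^ N * Cmod (g k) <= M) -> rapid g.
Proof.
  intros H N. destruct (H (S (S N))) as [M HM].
  exists (2 * M). intros n. apply telescoping_bound; [intros; apply Cmod_ge_0|].
  intros k. specialize (HM k). rewrite Cmod_mult, Cmod_R, Rabs_pos_eq by (apply pow_le, pos_INR).
  assert (INR (S (S k)) <= 2 * INR (S k)) by (rewrite !S_INR; pose proof (pos_INR k); lra).
  apply Rle_trans with (2 * (INR (S k) ^ S (S N) * Cmod (g k))); [|lra].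
  change (INR (S k) ^ S (S N)) with (INR (S k) * (INR (S k) * INR (S k) ^ N)). pose proof (pos_INR (S k)).
  assert (0 <= INR (S k) ^ N * Cmod (g k)) by (apply Rmult_le_pos; [apply pow_le; auto|apply Cmod_ge_0]).
  replace (2 * (INR (S k) * (INR (S k) * INR (S k) ^ N) * Cmod (g k)))
    with (INR (S k) * (2 * INR (S k)) * (INR (S k) ^ N * Cmod (g k))) by ring.
  apply Rmult_le_compat_r; auto. apply Rmult_le_compat_l; auto.
Qed.

Lemma bounded_iter_der_rapid (g : nat -> C) :
  (forall n, exists M, forall k, Cmod (iter_der n g k) <= M) -> rapid g.
Proof.
  intros H.
  (* One power of the weight is gained by passing to [der h], hence the generalization over the
     sequence. The coefficient [h 0], invisible to [der h], is bounded separately by the [Rmax]; the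
     power of 2 compares [k + 2] with [k + 1]. *)
  assert (P : forall N g, (forall n, exists M, forall k, Cmod (iter_der n g k) <= M) ->
     exists M, forall k, INR (S k) ^ N * Cmod (g k) <= M).
  { induction N as [|N IH]; intros h Hh.
    - destruct (Hh O) as [M HM]. exists M. intros k. simpl. rewrite Rmult_1_l. apply HM.
    - destruct (IH (der h)) as [M HM].
      { intros n. rewrite iter_der_S. apply Hh. }
      exists (Rmax (Cmod (h O)) (2 ^ S N * M)). intros [|k].
      + eapply Rle_trans; [|apply Rmax_l]. change (INR 1) with 1. rewrite pow1. lra.
      + eapply Rle_trans; [|apply Rmax_r]. specialize (HM k).
        unfold der in HM. rewrite Cmod_mult, Cmod_R, Rabs_pos_eq in HM by apply pos_INR.
        assert (INR (S (S k)) ^ S N <= 2 ^ S N * INR (S k) ^ S N).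
        { rewrite <- Rpow_mult_distr. apply pow_incr. rewrite !S_INR. pose proof (pos_INR k). lra. }
        assert (0 < 2 ^ S N) by (apply pow_lt; lra).
        apply Rle_trans with (2 ^ S N * INR (S k) ^ S N * Cmod (h (S k))).
        * apply Rmult_le_compat_r; auto using Cmod_ge_0.
        * change (INR (S k) ^ S N) with (INR (S k) * INR (S k) ^ N). rewrite Rmult_assoc. apply Rmult_le_compat_l; [lra|].
          eapply Rle_trans; [|exact HM]. right. ring. }
  apply rapid_of_bounded. intros N. now apply P.
Qed.

Lemma smooth_disk_series_rapid (f : C -> C) F g :
  closed_disk_derivatives f F -> disk_series f g -> rapid g.
Proof.
  intros HF Hg. apply bounded_iter_der_rapid. intros n. now apply iter_der_bounded with f F.
Qed.

Lemma rapid_weight (g : nat -> C) (w : nat -> R) N :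
  (forall k, Rabs (w k) <= INR (S k) ^ N) -> rapid g ->
  exists M, l1_bound (fun k => RtoC (w k) * g k)%C M.
Proof.
  intros Hw H. destruct (H N) as [M HM]. exists M.
  eapply l1_bound_mono; [|exact HM]. intros n. cbv beta.
  rewrite !Cmod_mult, !Cmod_R. apply Rmult_le_compat_r; [apply Cmod_ge_0|].
  rewrite (Rabs_pos_eq (INR (S n) ^ N)); [apply Hw|apply pow_le, pos_INR].
Qed.

Lemma rapid_l1 (g : nat -> C) : rapid g -> exists M, l1_bound g M.
Proof.
  intros H. destruct (H O) as [M HM]. exists M. eapply l1_bound_ext; [|exact HM].
  intros n. simpl. now rewrite Cmult_1_l.
Qed.

Lemma rapid_mono (g h : nat -> C) : (forall n, Cmod (h n) <= Cmod (g n)) -> rapid g -> rapid h.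
Proof.
  intros E H N. destruct (H N) as [M HM]. exists M. eapply l1_bound_mono; [|exact HM].
  intros n. cbv beta. rewrite !Cmod_mult. apply Rmult_le_compat_l; auto using Cmod_ge_0.
Qed.

Lemma rapid_mult_INR (g : nat -> C) (a : C) : rapid g -> rapid (fun k => a * RtoC (INR k) * g k)%C.
Proof.
  intros H N. destruct (H (S N)) as [M HM]. exists (Cmod a * M). intros n.
  eapply Rle_trans; [|apply Rmult_le_compat_l; [apply Cmod_ge_0|apply (HM n)]].
  rewrite <- rsum_mult_l. apply rsum_le. intros k _.
  rewrite !Cmod_mult, !Cmod_R, !Rabs_pos_eq by (try apply pow_le; apply pos_INR).
  rewrite S_INR. simpl. pose proof (pos_INR k).
  assert (0 <= Cmod a * ((INR k + 1) ^ N * Cmod (g k))).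
  { repeat apply Rmult_le_pos; auto using Cmod_ge_0. apply pow_le. lra. }
  nra.
Qed.

Lemma rapid_der (g : nat -> C) : rapid g -> rapid (der g).
Proof.
  intros H N. destruct (H (S N)) as [M HM]. exists M. intros n.
  eapply Rle_trans; [|apply (HM (S n))].
  assert (E : forall (u : nat -> R) m, (forall k, 0 <= u k) -> rsum (fun k => u (S k)) m <= rsum u (S m)).
  { intros u m Hu. enough (rsum u (S m) = u O + rsum (fun k => u (S k)) m) by (specialize (Hu O); lra).
    induction m as [|m IH]; [rewrite rsum_S, !rsum_O; lra|].
    rewrite rsum_S, IH, rsum_S. lra. }
  eapply Rle_trans; [|apply (E (fun k => Cmod (RtoC (INR (S k) ^ S N) * g k)%C)); intros; apply Cmod_ge_0].
  apply rsum_le. intros k _. unfold der.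
  rewrite !Cmod_mult, !Cmod_R, !Rabs_pos_eq by (try apply pow_le; apply pos_INR).
  rewrite <- Rmult_assoc. apply Rmult_le_compat_r; [apply Cmod_ge_0|].
  rewrite <- (tech_pow_Rmult (INR (S (S k)))), Rmult_comm.
  assert (INR (S k) <= INR (S (S k))) by (rewrite (S_INR (S k)); lra). pose proof (pos_INR (S k)).
  apply Rmult_le_compat; auto; [apply pow_le; auto|]. apply pow_incr. auto.
Qed.

Lemma CSeries_minus (u v : nat -> C) U V :
  l1_bound u U -> l1_bound v V -> CSeries (fun k => u k - v k)%C = (CSeries u - CSeries v)%C.
Proof.
  intros Hu Hv. apply is_Cseries_l1 in Hu, Hv.
  destruct Hu as [H1 H2], Hv as [H3 H4]. apply is_Cseries_unique. split.
  - apply (is_series_minus (K := R_AbsRing) (V := R_NormedModule) _ _ _ _ H1 H3).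
  - apply (is_series_minus (K := R_AbsRing) (V := R_NormedModule) _ _ _ _ H2 H4).
Qed.

Lemma l1_bound_mult_const (u : nat -> C) (a : C) M :
  l1_bound u M -> l1_bound (fun k => a * u k)%C (Cmod a * M).
Proof.
  intros H N. rewrite (rsum_ext _ (fun k => Cmod a * Cmod (u k))) by (intros; apply Cmod_mult).
  rewrite rsum_mult_l. apply Rmult_le_compat_l; auto using Cmod_ge_0.
Qed.

(** Termwise differentiation: by [cis_quadratic] the remainders add up to at most [2 h^2] times the
    sum of [k^2 |g_k|], which is finite by rapid decrease. *)
Lemma is_deriveR_tser (g : nat -> C) x :
  rapid g -> is_deriveR (tser g) x (tser (fun k => Ci * RtoC (INR k) * g k)%C x).
Proof.
  intros H.
  destruct (rapid_l1 g H) as [M0 HM0].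
  destruct (rapid_l1 _ (rapid_mult_INR g Ci H)) as [M1 HM1].
  destruct (rapid_weight g (fun k => INR k ^ 2) 2) as [M2 HM2]; [|exact H|].
  { intros k. rewrite Rabs_pos_eq by (apply pow_le, pos_INR). apply pow_incr.
    rewrite S_INR. pose proof (pos_INR k). lra. }
  apply is_deriveR_quadratic with (2 * M2). intros h.
  assert (E : (tser g (x + h)%R - tser g x - RtoC h * tser (fun k => Ci * RtoC (INR k) * g k) x)%C
     = CSeries (fun k => g k * cis (INR k * (x + h)) - g k * cis (INR k * x)
          - RtoC h * ((Ci * RtoC (INR k) * g k) * cis (INR k * x)))%C).
  { unfold tser. rewrite <- (CSeries_mult_l _ _ M1) by now apply (l1_tser (fun k => Ci * RtoC (INR k) * g k)%C).
    rewrite <- (CSeries_minus _ _ M0 M0) by now apply l1_tser.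
    rewrite <- (CSeries_minus _ _ (M0 + M0) (Cmod (RtoC h) * M1)); [reflexivity| |].
    - intros N. eapply Rle_trans.
      { apply rsum_le. intros n _. eapply Rle_trans; [apply Cmod_triangle|]. rewrite Cmod_opp. apply Rle_refl. }
      rewrite (sum_n_plus (G := R_AbelianGroup)). apply Rplus_le_compat; now apply l1_tser.
    - apply (l1_bound_mult_const (fun k => Ci * RtoC (INR k) * g k * cis (INR k * x))%C).
      now apply (l1_tser (fun k => Ci * RtoC (INR k) * g k)%C). }
  rewrite E. replace (2 * M2 * h ^ 2) with (2 * h ^ 2 * M2) by ring.
  apply Cmod_CSeries_le. intros N.
  eapply Rle_trans; [|apply Rmult_le_compat_l; [pose proof (pow2_ge_0 h); lra|apply (HM2 N)]].
  rewrite <- rsum_mult_l. apply rsum_le. intros k _.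
  replace (g k * cis (INR k * (x + h)) - g k * cis (INR k * x) - RtoC h * (Ci * RtoC (INR k) * g k * cis (INR k * x)))%C
    with (g k * (cis (INR k * x) * (cis (INR k * h) - 1 - Ci * RtoC (INR k * h))))%C.
  - rewrite !Cmod_mult, Cmod_cis, Cmod_R, Rmult_1_l, Rabs_pos_eq by (apply pow_le, pos_INR).
    pose proof (cis_quadratic (INR k * h)) as Q.
    replace (2 * h ^ 2 * (INR k ^ 2 * Cmod (g k))) with (Cmod (g k) * (2 * (INR k * h) ^ 2)) by ring.
    apply Rmult_le_compat_l; auto using Cmod_ge_0.
  - rewrite Rmult_plus_distr_l, cis_plus, RtoC_mult. ring.
Qed.

Lemma CSeries_head (u : nat -> C) M : l1_bound u M -> CSeries u = (u O + CSeries (fun k => u (S k)))%C.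
Proof.
  intros H.
  assert (H' : is_lim_seq (fun N => Cmod (csum u N - CSeries u)) 0) by (apply is_Cseries_iff, is_Cseries_l1 with M, H).
  assert (E : CSeries (fun k => u (S k)) = (CSeries u - u O)%C).
  { apply is_Cseries_unique, is_Cseries_iff. apply is_lim_seq_incr_1 in H'.
    apply is_lim_seq_ext with (2 := H'). intros N. cbv beta. rewrite csum_S_head. f_equal. ring. }
  rewrite E. ring.
Qed.

(** The function [x -> G(r e^(ix))] is differentiated once termwise and once by the chain rule.
    Comparing the two results and cancelling [i r e^(ix)] gives the series of [G']. *)
Lemma disk_series_derivative (G G' : C -> C) (g : nat -> C) r x :
  disk_series G g -> (forall z, Cmod z < 1 -> is_deriveC G z (G' z)) -> rapid g ->
  0 < r < 1 -> G' (RtoC r * cis x)%C = tser (dil r (der g)) x.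
Proof.
  intros Hg HG Hra Hr.
  assert (Hrd : rapid (dil r g)).
  { apply rapid_mono with (2 := Hra). intros n. unfold dil.
    rewrite Cmod_mult, Cmod_R, Rabs_pos_eq by (apply pow_le; lra).
    assert (r ^ n <= 1) by (rewrite <- (pow1 n); apply pow_incr; lra).
    pose proof (Cmod_ge_0 (g n)). nra. }
  assert (D1 := is_deriveR_tser (dil r g) x Hrd).
  assert (D2 : is_deriveR (fun u => G (RtoC r * cis u)%C) x (Ci * (RtoC r * cis x) * G' (RtoC r * cis x))%C).
  { apply is_deriveR_comp; [apply HG; rewrite Cmod_circle; lra|apply is_deriveR_circle]. }
  apply (is_deriveR_ext _ (tser (dil r g))) in D2; [|intros; apply disk_series_circle; auto; lra].
  assert (E := is_deriveR_unique _ _ _ _ D1 D2).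
  destruct (rapid_l1 _ (rapid_mult_INR _ Ci Hrd)) as [M HM].
  assert (E2 : tser (fun k => Ci * RtoC (INR k) * dil r g k)%C x
               = (Ci * (RtoC r * cis x) * tser (dil r (der g)) x)%C).
  { unfold tser at 1. rewrite (CSeries_head _ M) by now apply (l1_tser (fun k => Ci * RtoC (INR k) * dil r g k)%C).
    simpl (INR 0). destruct (rapid_l1 _ (rapid_der g Hra)) as [M' HM'].
    unfold tser. rewrite <- (CSeries_mult_l _ _ M').
    2:{ apply l1_tser, l1_bound_dil; auto; lra. }
    rewrite (CSeries_ext (fun k => Ci * RtoC (INR (S k)) * dil r g (S k) * cis (INR (S k) * x))%C
        (fun k => Ci * (RtoC r * cis x) * (dil r (der g) k * cis (INR k * x)))%C).
    - ring.
    - intros k. replace (INR (S k) * x) with (x + INR k * x) by (rewrite S_INR; ring).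
      rewrite cis_plus. unfold dil, der. simpl (r ^ S k). rewrite (RtoC_mult r). ring. }
  rewrite E2 in E.
  assert (Hc : (Ci * (RtoC r * cis x))%C <> RtoC 0).
  { apply Cmod_gt_0. rewrite Cmod_mult, Cmod_Ci, Cmod_circle; lra. }
  replace (G' (RtoC r * cis x)%C) with (/ (Ci * (RtoC r * cis x)) * (Ci * (RtoC r * cis x) * G' (RtoC r * cis x)))%C.
  - rewrite <- E, Cmult_assoc, Cinv_l, Cmult_1_l; auto.
  - rewrite Cmult_assoc, Cinv_l, Cmult_1_l; auto.
Qed.

Lemma univalent_coefficients (f : C -> C) (c : nat -> C) :
  univalent_embedding f c ->
  rapid (fun j => RtoC (INR (S j)) * c j)%C /\
  exists K, l1_bound (conv_inv (fun j => RtoC (INR (S j)) * c j)%C) K.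
Proof.
  intros [Hc0 [Hs [_ [F [HF HF1]]]]].
  (* The Taylor coefficients of [f] itself, shifted by one against [c] because of the factor [z];
     hence [der g] is the series of [f']. *)
  set (g := fun n => match n with O => RtoC 0 | S m => c m end).
  assert (Hg : disk_series f g).
  { intros z Hz. destruct (Hs z Hz) as [s [H1 H2]]. rewrite H2.
    apply is_pseries_Cseries, is_Cseries_iff in H1. apply is_Cseries_iff.
    apply is_lim_seq_incr_1.
    apply is_lim_seq_ext with (fun N => Cmod z * Cmod (csum (fun k => c k * z ^ k)%C N - s)).
    - intros N. rewrite <- Cmod_mult. f_equal. rewrite csum_S_head. simpl.
      rewrite (csum_ext (fun n => c n * (z * z ^ n))%C (fun n => z * (c n * z ^ n))%C) by (intros; ring).
      rewrite csum_mult_l. ring.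
    - replace (Finite 0) with (Rbar_mult (Cmod z) (Finite 0)) by (simpl; f_equal; ring).
      now apply is_lim_seq_scal_l. }
  assert (Hra := smooth_disk_series_rapid f F g HF Hg).
  set (p := fun j => (RtoC (INR (S j)) * c j)%C).
  change p with (der g). assert (Hrp : rapid (der g)) by now apply rapid_der.
  split; [exact Hrp|].
  pose proof HF as [HF0 [HFd _]].
  destruct (closed_disk_derivatives_inv_bounded f F 1 HF HF1) as [M1 HM1].
  destruct (closed_disk_derivatives_bounded f F 2 HF) as [M2 HM2].
  destruct (closed_disk_derivatives_bounded f F 3 HF) as [M3 HM3].
  destruct (rapid_l1 _ Hrp) as [Mp HMp].
  destruct (rapid_weight (der g) INR 1) as [B HB]; [|exact Hrp|].
  { intros k. rewrite Rabs_pos_eq, pow_1, S_INR by apply pos_INR. lra. }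
  assert (Hp0 : der g O = RtoC 1) by (unfold der, g; simpl; rewrite Hc0; ring).
  apply (inverse_l1 (F 1%nat) (F 2%nat) (F 3%nat) (der g) _ Mp B); auto.
  - intros z Hz. exists (F 4%nat z). auto.
  - exists (Rmax M1 (Rmax M2 M3)). intros z Hz. repeat split; auto.
    + eapply Rle_trans; [now apply HM1|apply Rmax_l].
    + eapply Rle_trans; [now apply HM2|]. eapply Rle_trans; [apply Rmax_l|apply Rmax_r].
    + eapply Rle_trans; [now apply HM3|]. eapply Rle_trans; [apply Rmax_r|apply Rmax_r].
  - intros r x Hr. apply (disk_series_derivative (F O)); auto.
    intros z Hz. rewrite HF0 by lra. now apply Hg.
  - intros n. now apply conv_inv_correct.
Qed.

(** * Schur polynomials *)

(** The monomial [z^k]; [conv (mono k)] is multiplication by it. *)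
Definition mono (k n : nat) : C := if Nat.eqb n k then RtoC 1 else RtoC 0.

Lemma conv_mono k (u : nat -> C) m :
  conv (mono k) u m = if Nat.leb k m then u (m - k)%nat else RtoC 0.
Proof.
  unfold conv.
  assert (H : forall N, (N <= m)%nat ->
    csum (fun j => mono k j * u (m - j)%nat)%C N = if Nat.leb k N then u (m - k)%nat else RtoC 0).
  { induction N as [|N IH]; intros HN.
    - rewrite csum_O. unfold mono. destruct k; simpl; ring.
    - rewrite csum_S, IH by lia. unfold mono.
      destruct (Nat.leb_spec k N); destruct (Nat.leb_spec k (S N)); destruct (Nat.eqb_spec (S N) k);
        try lia; subst; try cring. }
  now apply H.
Qed.

Lemma mono_mono a b m : conv (mono a) (mono b) m = mono (a + b) m.
Proof.
  rewrite conv_mono. unfold mono.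
  destruct (Nat.leb_spec a m); destruct (Nat.eqb_spec (m - a) b); destruct (Nat.eqb_spec m (a + b)); try lia; reflexivity.
Qed.

Lemma l1_bound_mono_1 k : l1_bound (mono k) 1.
Proof.
  intros N.
  assert (H : rsum (fun n => Cmod (mono k n)) N <= if Nat.leb k N then 1 else 0); [|destruct (Nat.leb k N); lra].
  induction N as [|N IH].
  - rewrite rsum_O. unfold mono. destruct k; simpl; rewrite ?Cmod_1, ?Cmod_0; lra.
  - rewrite rsum_S. unfold mono at 2.
    destruct (Nat.leb_spec k N); destruct (Nat.leb_spec k (S N)); destruct (Nat.eqb_spec (S N) k);
      try lia; rewrite ?Cmod_1, ?Cmod_0; lra.
Qed.

Lemma conv_mono_comm (u v : nat -> C) k m : conv u (conv (mono k) v) m = conv (mono k) (conv u v) m.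
Proof.
  rewrite <- !conv_assoc. apply conv_ext; auto. intros. apply conv_comm.
Qed.

Notation xpow := xi_pow_coeff.

Lemma xi_pow_coeff_0 t m : xpow t 0 m = delta m.
Proof. reflexivity. Qed.

Lemma xi_pow_coeff_S t n m : xpow t (S n) m = conv (xi_coeff t) (xpow t n) m.
Proof. reflexivity. Qed.

Lemma xi_pow_coeff_vanish t n k : (k < n)%nat -> xpow t n k = RtoC 0.
Proof.
  revert k. induction n as [|n IH]; intros k Hk; [lia|].
  rewrite xi_pow_coeff_S. unfold conv.
  rewrite (csum_ext _ (fun _ => RtoC 0 * RtoC 0)%C).
  - rewrite csum_mult_l. ring.
  - intros [|j] Hj; simpl xi_coeff; [ring|]. rewrite (IH (k - S j)%nat) by lia. ring.
Qed.

Lemma xi_coeff_shift t k s m : (1 <= k)%nat ->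
  xi_coeff (shift_time t k s) m = (xi_coeff t m + s * mono k m)%C.
Proof.
  intros Hk. unfold xi_coeff, mono, shift_time. destruct m as [|m].
  - destruct (Nat.eqb_spec 0 k); [lia|ring].
  - destruct (Nat.eqb (S m) k); ring.
Qed.

Lemma l1_bound_xi_pow t T n : l1_bound (xi_coeff t) T -> l1_bound (xpow t n) (T ^ n).
Proof.
  intros H. induction n as [|n IH]; [exact l1_bound_delta|].
  exact (l1_bound_conv _ _ _ _ H IH).
Qed.

Lemma l1_bound_plus (u v : nat -> C) U V :
  l1_bound u U -> l1_bound v V -> l1_bound (fun k => u k + v k)%C (U + V).
Proof.
  intros Hu Hv N. eapply Rle_trans; [apply rsum_le; intros; apply Cmod_triangle|].
  rewrite (sum_n_plus (G := R_AbelianGroup)). now apply Rplus_le_compat.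
Qed.

(* First-order Taylor remainder of the power [xi ^ (n + 1)] in the direction
   of the monomial [z ^ k]. *)
Definition pow_rem t k s n m : C :=
  (xpow (shift_time t k s) (S n) m - xpow t (S n) m
   - RtoC (INR (S n)) * s * conv (mono k) (xpow t n) m)%C.

(** With [X = xi] and [Y = X + s z^k], multiply [Y^(n+1) - X^(n+1) - (n+1) s z^k X^n] by [Y] and
    expand [Y] in the last two terms; the only excess over the next remainder is
    [-(n+1) s^2 z^(2k) X^n]. *)
Lemma pow_rem_S t k s n m : (1 <= k)%nat ->
  pow_rem t k s (S n) m
  = (conv (xi_coeff (shift_time t k s)) (pow_rem t k s n) m
     + RtoC (INR (S n)) * (s * s) * conv (mono k) (conv (mono k) (xpow t n)) m)%C.
Proof.
  intros Hk. set (Y := xi_coeff (shift_time t k s)). set (X := xi_coeff t).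
  assert (EY : forall v j, conv Y v j = (conv X v j + s * conv (mono k) v j)%C).
  { intros v j. rewrite <- conv_scal_l, <- conv_plus_l. apply conv_ext; auto.
    intros i _. now apply xi_coeff_shift. }
  assert (E : conv Y (pow_rem t k s n) m
    = (conv Y (xpow (shift_time t k s) (S n)) m - conv Y (xpow t (S n)) m
       - RtoC (INR (S n)) * s * conv Y (conv (mono k) (xpow t n)) m)%C).
  { unfold conv at 1 2 3 4. rewrite <- csum_mult_l, <- !csum_minus. apply csum_ext.
    intros j _. unfold pow_rem. ring. }
  rewrite E, (EY (xpow t (S n))), (EY (conv (mono k) (xpow t n))).
  unfold X. rewrite (conv_mono_comm (xi_coeff t)). fold X.
  change (conv Y (xpow (shift_time t k s) (S n)) m) with (xpow (shift_time t k s) (S (S n)) m).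
  change (conv X (xpow t (S n)) m) with (xpow t (S (S n)) m).
  change (conv (mono k) (conv X (xpow t n)) m) with (conv (mono k) (xpow t (S n)) m).
  unfold pow_rem. rewrite (S_INR (S n)), RtoC_plus. ring.
Qed.

Lemma S_INR_le_pow2 n : INR (S n) <= 2 ^ n.
Proof.
  induction n as [|n IH]; [simpl; lra|]. rewrite S_INR. simpl (2 ^ S n).
  assert (1 <= 2 ^ n) by (apply pow_R1_Rle; lra). lra.
Qed.

(** [T] dominates the norms of both [xi] and its shift, as [|s| <= 1] and [z^k] has norm 1. The
    factor [2^n] absorbs the coefficient [n + 1] of the recursion, leaving a geometric bound that
    the exponential series can sum. *)
Lemma l1_bound_pow_rem t k s T n : (1 <= k)%nat -> 1 <= T -> Cmod s <= 1 ->
  l1_bound (xi_coeff t) (T - 1) -> l1_bound (pow_rem t k s n) (Cmod s ^ 2 * (2 * T) ^ n).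
Proof.
  intros Hk HT Hs H.
  assert (HY : l1_bound (xi_coeff (shift_time t k s)) T).
  { intros N. apply Rle_trans with (T - 1 + Cmod s * 1); [|lra].
    eapply l1_bound_ext; [|apply (l1_bound_plus _ _ _ _ H (l1_bound_mult_const _ s _ (l1_bound_mono_1 k)))].
    intros m. now rewrite xi_coeff_shift. }
  assert (HX : l1_bound (xi_coeff t) T) by (intros N; specialize (H N); lra).
  pose proof (Cmod_ge_0 s) as Ps.
  induction n as [|n IH].
  - intros N. rewrite (rsum_ext _ (fun _ => 0 * 0)).
    + rewrite rsum_mult_l. simpl. nra.
    + intros m _. rewrite Rmult_0_l, <- Cmod_0. f_equal. unfold pow_rem.
      rewrite !xi_pow_coeff_S.
      rewrite (conv_ext _ (xi_coeff (shift_time t k s)) _ delta), (conv_ext (xi_coeff t) (xi_coeff t) (xpow t 0) delta),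
        (conv_ext (mono k) (mono k) (xpow t 0) delta); auto.
      rewrite !conv_delta_r, xi_coeff_shift by auto. simpl. ring.
  - assert (B2 : l1_bound (fun m => RtoC (INR (S n)) * (s * s) * conv (mono k) (conv (mono k) (xpow t n)) m)%C
               (INR (S n) * Cmod s ^ 2 * T ^ n)).
    { intros N. eapply Rle_trans; [apply (l1_bound_mult_const _ _ (T ^ n))|].
      - intros N'. eapply Rle_trans.
        { apply (l1_bound_conv _ _ _ _ (l1_bound_mono_1 k) (l1_bound_conv _ _ _ _ (l1_bound_mono_1 k) (l1_bound_xi_pow t T n HX))). }
        right. ring.
      - rewrite !Cmod_mult, Cmod_R, Rabs_pos_eq by apply pos_INR. right. ring. }
    assert (B := l1_bound_plus _ _ _ _ (l1_bound_conv _ _ _ _ HY IH) B2).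
    intros N. eapply Rle_trans; [eapply l1_bound_ext; [|exact B]; intros m; now rewrite pow_rem_S|].
    pose proof (S_INR_le_pow2 n). rewrite Rpow_mult_distr.
    replace ((2 * T) ^ S n) with (2 * 2 ^ n * (T * T ^ n)) by (rewrite Rpow_mult_distr; reflexivity).
    assert (P1 : 1 <= T ^ n) by (apply pow_R1_Rle; lra).
    assert (P2 : 1 <= 2 ^ n) by (apply pow_R1_Rle; lra).
    set (a := 2 ^ n) in *. set (b := T ^ n) in *. set (c := INR (S n)) in *.
    assert (0 <= Cmod s ^ 2) by (apply pow2_ge_0). set (s2 := Cmod s ^ 2) in *.
    assert (c * b <= a * b * T).
    { apply Rle_trans with (a * b); [apply Rmult_le_compat_r; lra|]. assert (0 <= a * b) by nra. nra. }
    apply Rle_trans with (s2 * (T * (a * b) + c * b)); [right; ring|].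
    replace (s2 * (2 * a * (T * b))) with (s2 * (T * (a * b) + a * b * T)) by ring.
    apply Rmult_le_compat_l; lra.
Qed.

Lemma exp_partial_le x N : 0 <= x -> rsum (fun n => x ^ n / INR (Factorial.fact n)) N <= exp x.
Proof.
  intros Hx. pose proof (is_exp_Reals x) as H.
  apply (is_lim_seq_incr_compare (rsum (fun n => x ^ n / INR (Factorial.fact n)))).
  - apply is_lim_seq_ext with (2 := H). intros n. apply rsum_ext. intros m _.
    unfold scal; simpl. rewrite pow_n_pow. reflexivity.
  - intros n. rewrite rsum_S.
    assert (0 <= x ^ S n / INR (Factorial.fact (S n))); [|lra].
    apply Rdiv_le_0_compat; [now apply pow_le|apply INR_fact_lt_0].
Qed.

Lemma RtoC_fact_neq_0 n : RtoC (INR (Factorial.fact n)) <> RtoC 0.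
Proof. intros E. apply RtoC_inj in E. now apply (INR_fact_neq_0 n). Qed.

Lemma schur_upto t m N : (m <= N)%nat ->
  schur t m = csum (fun n => xpow t n m / RtoC (INR (Factorial.fact n)))%C N.
Proof.
  induction 1 as [|N HN IH]; [reflexivity|].
  rewrite csum_S, <- IH, xi_pow_coeff_vanish by lia. unfold Cdiv. ring.
Qed.

Lemma conv_csum_r (u : nat -> C) (F : nat -> nat -> C) N m :
  conv u (fun i => csum (fun n => F n i) N) m = csum (fun n => conv u (F n) m) N.
Proof.
  induction N as [|N IH].
  - rewrite csum_O. apply conv_ext; auto. intros. now rewrite csum_O.
  - rewrite csum_S, <- IH, !(conv_comm u), <- conv_plus_l. apply conv_ext; auto.
    intros. now rewrite csum_S.
Qed.

Lemma schur_rem t k s m :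
  (schur (shift_time t k s) m - schur t m - s * conv (mono k) (schur t) m)%C
  = csum (fun n => pow_rem t k s n m / RtoC (INR (Factorial.fact (S n))))%C m.
Proof.
  (* One extra, vanishing, term is included so that removing [n = 0] leaves the powers [n + 1] with
     [n <= m], the range of the right-hand side. *)
  rewrite !(schur_upto _ m (S m)) by lia. rewrite !csum_S_head.
  rewrite (conv_ext (mono k) (mono k) (schur t)
    (fun i => csum (fun n => / RtoC (INR (Factorial.fact n)) * xpow t n i)%C m)) by
    (auto; intros i Hi; rewrite (schur_upto _ i m) by lia; apply csum_ext; intros; unfold Cdiv; ring).
  rewrite (conv_csum_r (mono k) (fun n i => / RtoC (INR (Factorial.fact n)) * xpow t n i)%C).
  rewrite !xi_pow_coeff_0.
  match goal with |- (?a + ?b - (?a + ?c) - s * ?d)%C = _ =>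
    replace (a + b - (a + c) - s * d)%C with (b - c - s * d)%C by ring end.
  rewrite <- csum_mult_l, <- !csum_minus. apply csum_ext. intros n _.
  rewrite (conv_comm (mono k)), conv_scal_l, (conv_comm (xpow t n)). unfold pow_rem.
  change (Factorial.fact (S n)) with (S n * Factorial.fact n)%nat. rewrite mult_INR, RtoC_mult.
  assert (RtoC (INR (S n)) <> RtoC 0) by (intros E; apply RtoC_inj in E; revert E; apply not_0_INR; lia).
  pose proof (RtoC_fact_neq_0 n). field. auto.
Qed.

(** The triangle [n <= m <= N] is enlarged to a square, where the sums can be exchanged; each inner
    sum is then at most [a x^n / n!]. *)
Lemma l1_bound_exp_series (F : nat -> nat -> C) (x a : R) : 0 <= x -> 0 <= a ->
  (forall n, l1_bound (F n) (a * x ^ n)) ->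
  l1_bound (fun m => csum (fun n => F n m / RtoC (INR (Factorial.fact n)))%C m) (a * exp x).
Proof.
  intros Hx Ha H N.
  apply Rle_trans with (rsum (fun m => rsum (fun n => Cmod (F n m) * / INR (Factorial.fact n)) N) N).
  - apply rsum_le. intros m Hm. eapply Rle_trans; [apply Cmod_csum|].
    eapply Rle_trans; [|apply (rsum_incr _ m N); [|exact Hm]].
    + apply rsum_le. intros n _. rewrite Cmod_div, Cmod_R, Rabs_pos_eq by (apply RtoC_fact_neq_0 || apply pos_INR).
      apply Rle_refl.
    + intros n. apply Rmult_le_pos; [apply Cmod_ge_0|]. left. apply Rinv_0_lt_compat, INR_fact_lt_0.
  - rewrite (sum_n_switch (G := R_AbelianGroup)).
    apply Rle_trans with (rsum (fun n => a * (x ^ n / INR (Factorial.fact n))) N).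
    + apply rsum_le. intros n _.
      change (rsum (fun m => Cmod (F n m) * / INR (Factorial.fact n)) N <= a * (x ^ n / INR (Factorial.fact n))).
      rewrite rsum_mult_r. unfold Rdiv. rewrite <- Rmult_assoc.
      apply Rmult_le_compat_r; [left; apply Rinv_0_lt_compat, INR_fact_lt_0|apply H].
    + rewrite rsum_mult_l. apply Rmult_le_compat_l; auto. now apply exp_partial_le.
Qed.

Lemma l1_bound_schur_rem t k s T : (1 <= k)%nat -> 1 <= T -> Cmod s <= 1 ->
  l1_bound (xi_coeff t) (T - 1) ->
  l1_bound (fun m => schur (shift_time t k s) m - schur t m - s * conv (mono k) (schur t) m)%C
    (Cmod s ^ 2 * exp (2 * T)).
Proof.
  intros Hk HT Hs H.
  apply l1_bound_ext with
    (fun m => csum (fun n => (pow_rem t k s n m / RtoC (INR (S n))) / RtoC (INR (Factorial.fact n)))%C m).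
  - intros m. f_equal. rewrite schur_rem. apply csum_ext. intros n _.
    change (Factorial.fact (S n)) with (S n * Factorial.fact n)%nat. rewrite mult_INR, RtoC_mult.
    assert (RtoC (INR (S n)) <> RtoC 0) by (intros E; apply RtoC_inj in E; revert E; apply not_0_INR; lia).
    pose proof (RtoC_fact_neq_0 n). field. auto.
  - apply (l1_bound_exp_series (fun n m => pow_rem t k s n m / RtoC (INR (S n)))%C); [lra|apply pow2_ge_0|].
    intros n. eapply l1_bound_mono; [|apply (l1_bound_pow_rem t k s T n Hk HT Hs H)].
    intros m. cbv beta.
    assert (1 <= INR (S n)) by (rewrite S_INR; pose proof (pos_INR n); lra).
    rewrite Cmod_div, Cmod_R, Rabs_pos_eq; [|lra|intros E; apply RtoC_inj in E; lra].
    apply Rmult_le_reg_r with (INR (S n)); [lra|]. unfold Rdiv. rewrite Rmult_assoc, Rinv_l by lra.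
    pose proof (Cmod_ge_0 (pow_rem t k s n m)). nra.
Qed.

Definition weight N (u : nat -> C) (k : nat) : C := (RtoC (INR (S k) ^ N) * u k)%C.

Lemma Cmod_weight N u k : Cmod (weight N u k) = INR (S k) ^ N * Cmod (u k).
Proof.
  unfold weight. rewrite Cmod_mult, Cmod_R, Rabs_pos_eq; auto. apply pow_le, pos_INR.
Qed.

(** The weight is submultiplicative, since [j + i + 1 <= (j + 1)(i + 1)]. Each weighted l1 space is
    therefore an algebra, so rapid decrease passes from [xi] to [exp(xi)]. *)
Lemma l1_bound_weight_conv N u v U V :
  l1_bound (weight N u) U -> l1_bound (weight N v) V -> l1_bound (weight N (conv u v)) (U * V).
Proof.
  intros Hu Hv K.
  apply Rle_trans with
    (rsum (fun m => rsum (fun j => Cmod (weight N u j) * Cmod (weight N v (m - j)%nat)) m) K).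
  - apply rsum_le. intros m Hm. rewrite Cmod_weight.
    eapply Rle_trans; [apply Rmult_le_compat_l; [apply pow_le, pos_INR|apply Cmod_csum]|].
    rewrite <- rsum_mult_l. apply rsum_le. intros j Hj. rewrite !Cmod_weight, Cmod_mult.
    replace (INR (S j) ^ N * Cmod (u j) * (INR (S (m - j)) ^ N * Cmod (v (m - j)%nat)))
      with ((INR (S j) * INR (S (m - j))) ^ N * (Cmod (u j) * Cmod (v (m - j)%nat)))
      by (rewrite Rpow_mult_distr; ring).
    apply Rmult_le_compat_r; [apply Rmult_le_pos; apply Cmod_ge_0|].
    apply pow_incr. split; [apply pos_INR|]. rewrite <- mult_INR. apply le_INR. nia.
  - eapply Rle_trans.
    { apply (rsum_triangle_le (fun j i => Cmod (weight N u j) * Cmod (weight N v i))).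
      intros; apply Rmult_le_pos; apply Cmod_ge_0. }
    apply Rle_trans with (rsum (fun k => Cmod (weight N u k)) K * rsum (fun k => Cmod (weight N v k)) K).
    + rewrite <- rsum_mult_r. apply rsum_le. intros j Hj. rewrite rsum_mult_l. lra.
    + apply Rmult_le_compat; auto using rsum_Cmod_nonneg.
Qed.

Lemma rapid_schur t : rapid (xi_coeff t) -> rapid (schur t).
Proof.
  intros H N. destruct (H N) as [T HT]. exists (1 * exp T).
  assert (HP : forall n, l1_bound (weight N (xpow t n)) (1 * T ^ n)).
  { intros n. rewrite Rmult_1_l. induction n as [|n IH].
    - eapply l1_bound_ext; [|apply l1_bound_delta]. intros [|m]; rewrite Cmod_weight.
      + change (INR 1) with 1. rewrite pow1. simpl. lra.
      + simpl. rewrite Cmod_0. ring.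
    - exact (l1_bound_weight_conv N _ _ _ _ HT IH). }
  apply l1_bound_ext with (fun m => csum (fun n => weight N (xpow t n) m / RtoC (INR (Factorial.fact n)))%C m).
  - intros m. f_equal. unfold schur. rewrite <- csum_mult_l. apply csum_ext. intros n _.
    unfold weight, Cdiv. ring.
  - apply (l1_bound_exp_series (fun n => weight N (xpow t n))); auto; [|lra].
    apply l1_bound_nonneg with (1 := HT).
Qed.

(** * The function A as a linear functional of exp(xi) *)

Lemma is_CInt_RInt (g : R -> C) (l : C) :
  is_CInt g l -> RInt (V := C_R_CompleteNormedModule) g 0 (2 * PI) = l.
Proof.
  intros [H H']. apply (is_RInt_unique (V := C_R_CompleteNormedModule)).
  destruct l as [a b].
  exact (is_RInt_fct_extend_pair (U := R_NormedModule) (V := R_NormedModule) g 0 (2 * PI) a b H H').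
Qed.

Lemma tser_Derive_n (g : nat -> C) n : rapid g ->
  exists g', rapid g' /\ forall x,
    Derive_n (fun u => Re (tser g u)) n x = Re (tser g' x) /\
    Derive_n (fun u => Im (tser g u)) n x = Im (tser g' x).
Proof.
  intros H. induction n as [|n [g' [Hg' E]]].
  - exists g. split; auto.
  - exists (fun k => Ci * RtoC (INR k) * g' k)%C. split; [now apply rapid_mult_INR|].
    intros x. pose proof (is_deriveR_tser g' x Hg') as D. apply is_deriveR_components in D.
    destruct D as [D1 D2]. apply is_derive_unique in D1, D2. split.
    + exact (eq_trans (Derive_ext _ _ x (fun u => proj1 (E u))) D1).
    + exact (eq_trans (Derive_ext _ _ x (fun u => proj2 (E u))) D2).
Qed.

Lemma tser_ex_derive_n (g : nat -> C) n x : rapid g ->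
  ex_derive_n (fun u => Re (tser g u)) n x /\ ex_derive_n (fun u => Im (tser g u)) n x.
Proof.
  intros H. destruct n as [|n]; [split; exact I|].
  destruct (tser_Derive_n g n H) as [g' [Hg' E]].
  pose proof (is_deriveR_tser g' x Hg') as D. apply is_deriveR_components in D. destruct D as [D1 D2].
  split; simpl.
  - eapply ex_derive_ext; [intros u; symmetry; apply E|]. eexists; exact D1.
  - eapply ex_derive_ext; [intros u; symmetry; apply E|]. eexists; exact D2.
Qed.

Lemma Hplus_of_rapid (x : nat -> C) : rapid (fun k => x (S k)) -> Hplus x.
Proof.
  intros H. set (g := fun k => x (S k)).
  set (h := fun z => CSeries (fun k => g k * z ^ k)%C).
  assert (E : forall u, h (cis u) = tser g u).
  { intros u. apply CSeries_ext. intros n. now rewrite cis_pow. }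
  destruct (rapid_l1 g H) as [M HM].
  assert (HF : forall n : Z, fourier h n = if Z_le_dec 0 n then g (Z.to_nat n) else RtoC 0).
  { intros n. unfold fourier.
    rewrite (is_CInt_RInt _ (if Z_le_dec 0 n then RtoC (2 * PI) * g (Z.to_nat n) else RtoC 0)%C).
    - assert (RtoC (2 * PI) <> RtoC 0).
      { intros Q. apply RtoC_inj in Q. pose proof two_PI_pos. lra. }
      rewrite RtoC_inv by (pose proof two_PI_pos; lra).
      destruct Z_le_dec; [|ring]. field. auto.
    - eapply is_CInt_ext; [|apply (is_CInt_tser g M n HM)]. intros u. cbv beta. now rewrite E. }
  exists h. split; [|split].
  - intros n u. destruct (tser_ex_derive_n g n u H) as [D1 D2]. split.
    + eapply ex_derive_n_ext; [|exact D1]. intros v. cbv beta. now rewrite E.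
    + eapply ex_derive_n_ext; [|exact D2]. intros v. cbv beta. now rewrite E.
  - intros k. rewrite HF. destruct Z_le_dec; [|lia]. now rewrite Nat2Z.id.
  - intros k. rewrite HF. destruct Z_le_dec; [lia|reflexivity].
Qed.

(** Boundedness is all that uniqueness of the preimage in H_+ requires; continuity on the circle
    suffices for it. *)
Lemma Hplus_bounded (x : nat -> C) : Hplus x -> exists M, forall k, Cmod (x (S k)) <= M.
Proof.
  intros [h [Hs [Hf _]]].
  set (a := fun u => Re (h (cis u))). set (b := fun u => Im (h (cis u))).
  assert (Ca : forall u, continuous a u).
  { intros u. apply (ex_derive_continuous (V := R_NormedModule)), (proj1 (Hs 1%nat u)). }
  assert (Cb : forall u, continuous b u).
  { intros u. apply (ex_derive_continuous (V := R_NormedModule)), (proj2 (Hs 1%nat u)). }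
  destruct (bounded_continuity (K := R_AbsRing) (V := R_NormedModule) a 0 (2 * PI) ltac:(intros; apply Ca)) as [Ma HMa].
  destruct (bounded_continuity (K := R_AbsRing) (V := R_NormedModule) b 0 (2 * PI) ltac:(intros; apply Cb)) as [Mb HMb].
  exists (2 * (Ma + Mb)). intros k. rewrite <- Hf. unfold fourier.
  set (n := Z.of_nat k).
  assert (Cc : forall u, continuous (fun u => cos (- (IZR n * u))) u).
  { intros u. apply (ex_derive_continuous (V := R_NormedModule)). auto_derive. auto. }
  assert (Cs : forall u, continuous (fun u => sin (- (IZR n * u))) u).
  { intros u. apply (ex_derive_continuous (V := R_NormedModule)). auto_derive. auto. }
  set (G := fun u => (h (cis u) * cis (- (IZR n * u)))%C).
  assert (I1 : ex_RInt (fun u => Re (G u)) 0 (2 * PI)).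
  { apply (ex_RInt_continuous (V := R_CompleteNormedModule)). intros u _.
    apply (continuous_minus (V := R_NormedModule) (fun u => a u * cos (- (IZR n * u))) (fun u => b u * sin (- (IZR n * u))));
      apply (continuous_mult (K := R_AbsRing)); auto. }
  assert (I2 : ex_RInt (fun u => Im (G u)) 0 (2 * PI)).
  { apply (ex_RInt_continuous (V := R_CompleteNormedModule)). intros u _.
    apply (continuous_plus (V := R_NormedModule) (fun u => a u * sin (- (IZR n * u))) (fun u => b u * cos (- (IZR n * u))));
      apply (continuous_mult (K := R_AbsRing)); auto. }
  destruct I1 as [l1 I1], I2 as [l2 I2].
  assert (I : is_CInt G (l1, l2)) by (split; assumption).
  rewrite (is_CInt_RInt _ _ I).
  apply (is_CInt_bound _ _ (Ma + Mb)) in I.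
  - pose proof two_PI_pos as P. rewrite Cmod_mult, Cmod_R, Rabs_pos_eq by (left; now apply Rinv_0_lt_compat).
    apply Rmult_le_reg_l with (2 * PI); auto. rewrite <- Rmult_assoc, Rinv_r, Rmult_1_l by lra. exact I.
  - intros u Hu. unfold G. rewrite Cmod_mult, Cmod_cis, Rmult_1_r.
    eapply Rle_trans; [apply Cmod_le_Re_Im|]. apply Rplus_le_compat.
    + left. exact (HMa u Hu).
    + left. exact (HMb u Hu).
Qed.

Lemma rapid_bounded (g : nat -> C) N : rapid g -> exists M, forall k, INR (S k) ^ N * Cmod (g k) <= M.
Proof.
  intros H. destruct (H N) as [M HM]. exists M. intros k.
  rewrite <- (Cmod_weight N g k). exact (l1_bound_term _ _ k HM).
Qed.

Lemma l1_bounded (g : nat -> C) M : l1_bound g M -> forall k, Cmod (g k) <= M.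
Proof. intros H k. now apply l1_bound_term. Qed.

Definition C11_symbol (c : nat -> C) (j : nat) : C := (RtoC (INR (j + 1)) * Cconj (c j))%C.

Definition toeplitz (e y : nat -> C) (k : nat) : C := CSeries (fun j => e j * y (j + k)%nat)%C.

(** Entry [k] involves [y] only from index [k] on, so it inherits the rapid decrease whatever the
    summable [e] is. *)
Lemma Hplus_toeplitz (e y : nat -> C) E : l1_bound e E -> rapid y -> Hplus (toeplitz e y).
Proof.
  intros He Hy. apply Hplus_of_rapid, rapid_of_bounded. intros N.
  destruct (rapid_bounded y N Hy) as [M HM]. exists (E * M). intros k.
  assert (P : 0 <= INR (S k) ^ N) by apply pow_le, pos_INR.
  assert (P' : 0 < INR (S k) ^ N) by (apply pow_lt, lt_0_INR; lia).
  assert (B : Cmod (toeplitz e y (S k)) <= E * (M / INR (S k) ^ N)).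
  { apply Cmod_CSeries_le, (l1_bound_mult e (fun j => y (j + S k)%nat)); auto.
    intros j. apply Rmult_le_reg_l with (INR (S k) ^ N); auto.
    apply Rle_trans with M; [|right; field; lra].
    eapply Rle_trans; [|apply (HM (j + S k)%nat)]. apply Rmult_le_compat_r; [apply Cmod_ge_0|].
    apply pow_incr. split; [apply pos_INR|apply le_INR; lia]. }
  apply Rle_trans with (INR (S k) ^ N * (E * (M / INR (S k) ^ N))).
  - now apply Rmult_le_compat_l.
  - right. field. lra.
Qed.

(** Composing upper triangular Toeplitz operators multiplies their symbols. As [w] need only be
    bounded, this covers both compositions of [C11] with its inverse. *)
Lemma CSeries_conv_delta (u v w : nat -> C) U V W k :
  l1_bound u U -> l1_bound v V -> (forall n, conv u v n = delta n) ->
  (forall n, Cmod (w (n + k)%nat) <= W) ->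
  CSeries (fun j => u j * CSeries (fun i => v i * w (i + (j + k))%nat))%C = w k.
Proof.
  intros Hu Hv H Hw.
  transitivity (CSeries (fun m => conv u v m * w (m + k)%nat)%C).
  - rewrite <- (CSeries_conv u v (fun n => w (n + k)%nat) U V W); auto.
    apply CSeries_ext. intros j. f_equal. apply CSeries_ext. intros i.
    now rewrite Nat.add_assoc.
  - rewrite (CSeries_ext _ (fun m => delta m * w (m + k)%nat)%C) by (intros; now rewrite H).
    now rewrite CSeries_delta.
Qed.

Lemma C11_inv_toeplitz (c e y : nat -> C) Q E k :
  l1_bound (C11_symbol c) Q -> l1_bound e E -> (forall n, conv (C11_symbol c) e n = delta n) ->
  rapid y -> (1 <= k)%nat -> C11_inv c y k = toeplitz e y k.
Proof.
  set (q := C11_symbol c). intros Hq He Hqe Hy Hk. destruct (rapid_l1 y Hy) as [Y HY].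
  assert (EX : exists x, Hplus x /\ forall k, (1 <= k)%nat -> C11 c x k = y k).
  { exists (toeplitz e y). split; [now apply Hplus_toeplitz with E|]. intros m Hm.
    rewrite <- (CSeries_conv_delta q e y Q E Y m Hq He Hqe) by (intros; now apply l1_bounded).
    apply CSeries_ext. intros j. unfold q, C11_symbol, toeplitz. rewrite (Nat.add_comm m j). reflexivity. }
  (* The chosen preimage is identified by applying the inverse Toeplitz operator to its defining
     equation, at positive indices only. *)
  destruct (epsilon_spec (inhabits (fun _ => RtoC 0)) _ EX) as [H1 H2].
  change (Hplus (C11_inv c y)) in H1.
  change (forall k, (1 <= k)%nat -> C11 c (C11_inv c y) k = y k) in H2.
  set (x := C11_inv c y) in *. destruct (Hplus_bounded x H1) as [M HM].
  symmetry. rewrite <- (CSeries_conv_delta e q x E Q M k He Hq).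
  - apply CSeries_ext. intros j. f_equal. rewrite <- H2 by lia. unfold C11.
    apply CSeries_ext. intros i. unfold q, C11_symbol. now rewrite (Nat.add_comm (j + k) i).
  - intros n. rewrite conv_comm. apply Hqe.
  - intros n. replace (n + k)%nat with (S (n + k - 1)) by lia. apply HM.
Qed.

(* The paper's [A] and its derivatives are all of the form
   [sum_m L_m [z^m] (z^n exp(xi))] for one bounded sequence [L]. *)
Definition A_lin (L : nat -> C) (n : nat) (t : nat -> C) : C :=
  CSeries (fun m => L m * conv (mono n) (schur t) m)%C.

Lemma A_fun_linear (f : C -> C) (c : nat -> C) :
  univalent_embedding f c ->
  exists L LB, (forall m, Cmod (L m) <= LB) /\
    forall t, rapid (xi_coeff t) -> A_fun c t = A_lin L 0 t.
Proof.
  intros Hf. destruct (univalent_coefficients f c Hf) as [Hp [E HE]].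
  assert (Hc0 : c O = RtoC 1) by exact (proj1 Hf).
  set (p := fun j => (RtoC (INR (S j)) * c j)%C) in *.
  set (q := C11_symbol c).
  set (e := fun j => Cconj (conv_inv p j)).
  destruct (rapid_l1 p Hp) as [Q HQ].
  assert (Hq : l1_bound q Q).
  { eapply l1_bound_ext; [|exact HQ]. intros n. unfold p, q, C11_symbol.
    rewrite !Cmod_mult, Cmod_conj, Nat.add_1_r. reflexivity. }
  assert (He : l1_bound e E).
  { eapply l1_bound_ext; [|exact HE]. intros n. unfold e. now rewrite Cmod_conj. }
  assert (Cconj_csum : forall u N, Cconj (csum u N) = csum (fun k => Cconj (u k)) N).
  { intros u N. induction N as [|N IH]; [now rewrite !csum_O|].
    rewrite !csum_S, Cplus_conj, IH. reflexivity. }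
  assert (Hqe : forall n, conv q e n = delta n).
  { intros n. transitivity (Cconj (conv p (conv_inv p) n)).
    - unfold conv. rewrite Cconj_csum. apply csum_ext. intros j _. unfold q, C11_symbol, e, p.
      rewrite !Cmult_conj, Nat.add_1_r. f_equal. f_equal. unfold Cconj, RtoC. simpl. f_equal; ring.
    - rewrite conv_inv_correct.
      + destruct n; simpl; unfold Cconj, RtoC; simpl; f_equal; ring.
      + unfold p. rewrite Hc0. simpl. ring. }
  set (kap := fun k => (RtoC (INR k) * Cconj (c k))%C).
  assert (Hk : l1_bound kap Q).
  { eapply l1_bound_mono; [|exact HQ]. intros n. unfold p, kap.
    rewrite !Cmod_mult, Cmod_conj, !Cmod_R, !Rabs_pos_eq by apply pos_INR.
    apply Rmult_le_compat_r; [apply Cmod_ge_0|]. apply le_INR. lia. }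
  (* [A] pairs [kap] with the Toeplitz operator of symbol [e] applied to the Schur coefficients; by
     Mertens the two sums merge into a pairing with the product of [kap] and [e]. *)
  exists (conv kap e), (Q * E). split.
  { intros m. apply l1_bounded. now apply l1_bound_conv. }
  intros t Ht. assert (Hs := rapid_schur t Ht). destruct (rapid_l1 _ Hs) as [Y HY].
  unfold A_fun, A_lin.
  rewrite (CSeries_ext (fun m => conv kap e m * conv (mono 0) (schur t) m)%C
     (fun m => conv kap e m * schur t m)%C).
  - rewrite <- (CSeries_conv kap e (schur t) Q E Y Hk He) by now apply l1_bounded.
    (* At index 0 nothing is known about [C11_inv], but [kap 0 = 0]. *)
    apply CSeries_ext. intros [|k].
    + unfold kap. simpl. ring.
    + unfold kap. f_equal. apply (C11_inv_toeplitz c e _ Q E); auto; lia.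
  - intros m. rewrite conv_mono. simpl. now rewrite Nat.sub_0_r.
Qed.

(** * Derivatives in the times *)

Lemma shift_time_0 t k : shift_time t k (RtoC 0) = t.
Proof.
  apply functional_extensionality. intros m. unfold shift_time.
  destruct (Nat.eqb m k); auto. ring.
Qed.

Lemma rapid_shift t k s : (1 <= k)%nat -> rapid (xi_coeff t) -> rapid (xi_coeff (shift_time t k s)).
Proof.
  intros Hk H N. destruct (H N) as [M HM].
  exists (M + Cmod s * INR (S k) ^ N).
  eapply l1_bound_ext;
    [|apply (l1_bound_plus _ (fun m => s * (RtoC (INR (S k) ^ N) * mono k m))%C M _ HM)].
  - intros m. cbv beta. f_equal. rewrite xi_coeff_shift by auto. unfold mono.
    destruct (Nat.eqb_spec m k) as [->|]; ring.
  - apply l1_bound_mult_const.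
    intros n. eapply Rle_trans; [apply (l1_bound_mult_const _ _ _ (l1_bound_mono_1 k))|].
    rewrite Cmod_R, Rabs_pos_eq; [lra|apply pow_le, pos_INR].
Qed.

(** The l1 remainder of [exp(xi)] is quadratic in [s]; multiplication by [z^n] does not increase it,
    and pairing with the bounded [L] costs the factor [LB]. The linear term is [z^n z^k exp(xi)]. *)
Lemma A_lin_derive (L : nat -> C) LB n k t :
  (forall m, Cmod (L m) <= LB) -> (1 <= k)%nat -> rapid (xi_coeff t) ->
  is_deriveC (fun s => A_lin L n (shift_time t k s)) (RtoC 0) (A_lin L (n + k) t).
Proof.
  intros HL Hk Ht. destruct (rapid_l1 _ Ht) as [T0 HT0].
  set (T := T0 + 1). assert (T0P := l1_bound_nonneg _ _ HT0).
  assert (LB0 : 0 <= LB) by (eapply Rle_trans; [apply (Cmod_ge_0 (L O))|auto]).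
  assert (Bd : forall m t', rapid (xi_coeff t') -> exists M, l1_bound (fun j => L j * conv (mono m) (schur t') j)%C M).
  { intros m t' Ht'. destruct (rapid_l1 _ (rapid_schur t' Ht')) as [Y HY].
    exists (1 * Y * LB). eapply l1_bound_ext; [|apply (l1_bound_mult _ L _ _ (l1_bound_conv _ _ _ _ (l1_bound_mono_1 m) HY) HL)].
    intros j. cbv beta. f_equal. ring. }
  apply is_deriveC_quadratic with (LB * exp (2 * T)) 1; [lra|].
  intros s Hs. rewrite Cplus_0_l, shift_time_0.
  destruct (Bd n (shift_time t k s) (rapid_shift t k s Hk Ht)) as [M1 HM1].
  destruct (Bd n t Ht) as [M2 HM2]. destruct (Bd (n + k)%nat t Ht) as [M3 HM3].
  unfold A_lin. rewrite <- (CSeries_mult_l _ s M3 HM3), <- (CSeries_minus _ _ _ _ HM1 HM2).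
  rewrite <- (CSeries_minus _ _ (M1 + M2) (Cmod s * M3)).
  2:{ intros N. eapply Rle_trans; [apply (l1_bound_plus _ (fun j => - (L j * conv (mono n) (schur t) j))%C M1 M2 HM1)|lra].
      eapply l1_bound_ext; [|exact HM2]. intros j. symmetry. apply Cmod_opp. }
  2:{ now apply l1_bound_mult_const. }
  set (D := fun m => (schur (shift_time t k s) m - schur t m - s * conv (mono k) (schur t) m)%C).
  rewrite (CSeries_ext _ (fun m => conv (mono n) D m * L m)%C).
  - replace (LB * exp (2 * T) * Cmod s ^ 2) with (1 * (Cmod s ^ 2 * exp (2 * T)) * LB) by ring.
    apply Cmod_CSeries_le, l1_bound_mult; auto. apply l1_bound_conv; [apply l1_bound_mono_1|].
    apply l1_bound_schur_rem; auto; [unfold T; lra|lra|]. unfold T. now replace (T0 + 1 - 1) with T0 by ring.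
  - intros m. rewrite (conv_comm (mono n) D). unfold D.
    rewrite (conv_minus_l (fun i => schur (shift_time t k s) i - schur t i)%C), conv_minus_l, conv_scal_l.
    rewrite !(conv_comm _ (mono n)), <- conv_assoc.
    rewrite (conv_ext (mono (n + k)) (conv (mono n) (mono k)) (schur t) (schur t));
      [ring|intros; symmetry; apply mono_mono|auto].
Qed.

(** * The KP equation *)

(* Unlike [regular_times], this set is visibly stable under small shifts. *)
Definition good_times (L : nat -> C) (t : nat -> C) : Prop :=
  rapid (xi_coeff t) /\ (1 - A_lin L 0 t)%C <> RtoC 0.

(** Required at all good times rather than at one, because iterating needs the first derivative to
    be known near each point. *)
Definition has_pd (L : nat -> C) (k : nat) (F G : (nat -> C) -> C) : Prop :=
  forall t, good_times L t -> is_deriveC (fun s => F (shift_time t k s)) (RtoC 0) (G t).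

Lemma good_times_shift (L : nat -> C) LB k t :
  (forall m, Cmod (L m) <= LB) -> (1 <= k)%nat -> good_times L t ->
  exists d, 0 < d /\ forall s, Cmod (s - RtoC 0) < d -> good_times L (shift_time t k s).
Proof.
  intros HL Hk [Ht H0].
  destruct (is_deriveC_cont _ _ _ (A_lin_derive L LB 0 k t HL Hk Ht) (Cmod (1 - A_lin L 0 t)))
    as [d [Hd K]]; [now apply Cmod_gt_0|].
  exists d. split; auto. intros s Hs. split; [now apply rapid_shift|].
  specialize (K s Hs). rewrite shift_time_0 in K. intros E.
  replace (A_lin L 0 (shift_time t k s) - A_lin L 0 t)%C
    with ((1 - A_lin L 0 t) - (1 - A_lin L 0 (shift_time t k s)))%C in K by ring.
  rewrite E in K. replace (1 - A_lin L 0 t - 0)%C with (1 - A_lin L 0 t)%C in K by ring. lra.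
Qed.

(** Agreement on good times suffices, since small shifts stay good. This allows [A_fun] and iterated
    [pd] terms to be replaced by explicit expressions under a further derivative. *)
Lemma has_pd_ext (L : nat -> C) LB k (F F' G : (nat -> C) -> C) :
  (forall m, Cmod (L m) <= LB) -> (1 <= k)%nat ->
  (forall t, good_times L t -> F t = F' t) -> has_pd L k F G -> has_pd L k F' G.
Proof.
  intros HL Hk E H t Ht. destruct (good_times_shift L LB k t HL Hk Ht) as [d [Hd K]].
  apply is_deriveC_ext_loc with (fun s => F (shift_time t k s)) d; auto.
Qed.

Lemma has_pd_pd (L : nat -> C) k (F G : (nat -> C) -> C) t :
  has_pd L k F G -> good_times L t -> ex_pd k F t /\ pd k F t = G t.
Proof.
  intros H Ht. specialize (H t Ht). split; [now exists (G t)|].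
  apply is_C_derive_unique. exact H.
Qed.

Definition A_ratio (L : nat -> C) (n : nat) (t : nat -> C) : C := (A_lin L n t / (1 - A_lin L 0 t))%C.

Lemma A_ratio_pd (L : nat -> C) LB n k : (forall m, Cmod (L m) <= LB) -> (1 <= k)%nat ->
  has_pd L k (A_ratio L n) (fun t => A_ratio L (n + k) t + A_ratio L n t * A_ratio L k t)%C.
Proof.
  intros HL Hk t [Ht H0].
  pose proof (A_lin_derive L LB n k t HL Hk Ht) as D.
  pose proof (A_lin_derive L LB 0 k t HL Hk Ht) as D0. simpl in D0.
  pose proof (is_deriveC_plus _ _ _ _ _ (is_deriveC_const (RtoC 1) (RtoC 0)) (is_deriveC_opp _ _ _ D0)) as D1.
  apply is_deriveC_inv in D1; [|rewrite shift_time_0; exact H0].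
  pose proof (is_deriveC_mult _ _ _ _ _ D D1) as D2. cbv beta in D2. rewrite shift_time_0 in D2.
  replace (A_ratio L (n + k) t + A_ratio L n t * A_ratio L k t)%C
    with (A_lin L (n + k) t * / (1 + - A_lin L 0 t)
          + A_lin L n t * (- (0 + - A_lin L k t) / ((1 + - A_lin L 0 t) * (1 + - A_lin L 0 t))))%C.
  - exact D2.
  - unfold A_ratio. field. exact H0.
Qed.

(* Polynomials in the ratios [w_n = (d^n A) / (1 - A)], n >= 1, which are
   closed under all the flows because [d_k w_n = w_(n+k) + w_n w_k]. *)
Inductive ratio_poly : Type :=
  | Ratio (n : nat)
  | Cst (a : C)
  | Add (p q : ratio_poly)
  | Mul (p q : ratio_poly).

Fixpoint eval (L : nat -> C) (p : ratio_poly) (t : nat -> C) : C :=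
  match p with
  | Ratio n => A_ratio L n t
  | Cst a => a
  | Add p q => eval L p t + eval L q t
  | Mul p q => eval L p t * eval L q t
  end%C.

Fixpoint flow (k : nat) (p : ratio_poly) : ratio_poly :=
  match p with
  | Ratio n => Add (Ratio (n + k)) (Mul (Ratio n) (Ratio k))
  | Cst _ => Cst (RtoC 0)
  | Add p q => Add (flow k p) (flow k q)
  | Mul p q => Add (Mul (flow k p) q) (Mul p (flow k q))
  end.

Lemma eval_pd (L : nat -> C) LB k p : (forall m, Cmod (L m) <= LB) -> (1 <= k)%nat ->
  has_pd L k (eval L p) (eval L (flow k p)).
Proof.
  intros HL Hk. induction p as [n|a|p IHp q IHq|p IHp q IHq].
  - now apply A_ratio_pd with LB.
  - intros t Ht. exact (is_deriveC_const a (RtoC 0)).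
  - intros t Ht. exact (is_deriveC_plus _ _ _ _ _ (IHp t Ht) (IHq t Ht)).
  - intros t Ht. pose proof (is_deriveC_mult _ _ _ _ _ (IHp t Ht) (IHq t Ht)) as D.
    cbv beta in D. rewrite shift_time_0 in D. exact D.
Qed.

Lemma eval_pd_eq (L : nat -> C) LB k F p : (forall m, Cmod (L m) <= LB) -> (1 <= k)%nat ->
  (forall t, good_times L t -> F t = eval L p t) ->
  forall t, good_times L t -> ex_pd k F t /\ pd k F t = eval L (flow k p) t.
Proof.
  intros HL Hk E t Ht. apply has_pd_pd with L; auto.
  apply has_pd_ext with LB (eval L p); auto.
  - intros; symmetry; auto.
  - now apply eval_pd with LB.
Qed.

(** Once [lam] is a polynomial in the ratios, every derivative in the equation exists and is
    computed by [flow]; what remains is an identity between two evaluated polynomials. *)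
Lemma KP_solution_eval (L : nat -> C) LB lam p : (forall m, Cmod (L m) <= LB) ->
  (forall t, good_times L t -> lam t = eval L p t) ->
  (forall t, 3 * eval L (flow 2 (flow 2 p)) t
     = eval L (flow 1 (Add (Mul (Cst 4) (flow 3 p))
         (Add (Mul (Cst (-12)) (Mul p (flow 1 p))) (Mul (Cst (-1)) (flow 1 (flow 1 (flow 1 p))))))) t)%C ->
  KP_solution (good_times L) lam.
Proof.
  intros HL E KP t Ht.
  assert (D : forall k F q, (1 <= k)%nat -> (forall t, good_times L t -> F t = eval L q t) ->
    forall t, good_times L t -> ex_pd k F t /\ pd k F t = eval L (flow k q) t).
  { intros. now apply eval_pd_eq with LB. }
  assert (D2 := D 2%nat lam p ltac:(lia) E).
  assert (D22 := D 2%nat (pd 2 lam) _ ltac:(lia) (fun t Ht => proj2 (D2 t Ht))).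
  assert (D3 := D 3%nat lam p ltac:(lia) E).
  assert (D1 := D 1%nat lam p ltac:(lia) E).
  assert (D11 := D 1%nat (pd 1 lam) _ ltac:(lia) (fun t Ht => proj2 (D1 t Ht))).
  assert (D111 := D 1%nat (pd 1 (pd 1 lam)) _ ltac:(lia) (fun t Ht => proj2 (D11 t Ht))).
  assert (EF : forall t, good_times L t -> KP_flux lam t = eval L (Add (Mul (Cst 4) (flow 3 p))
         (Add (Mul (Cst (-12)) (Mul p (flow 1 p))) (Mul (Cst (-1)) (flow 1 (flow 1 (flow 1 p)))))) t).
  { intros u Hu. unfold KP_flux.
    rewrite (proj2 (D3 u Hu)), (proj2 (D1 u Hu)), (proj2 (D111 u Hu)), (E u Hu).
    cbn [eval]. replace (RtoC (-12)) with (- RtoC 12)%C by (rewrite <- RtoC_opp; reflexivity).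
    replace (RtoC (-1)) with (- RtoC 1)%C by (rewrite <- RtoC_opp; reflexivity). ring. }
  assert (DF := D 1%nat (KP_flux lam) _ ltac:(lia) EF).
  split; [exact (proj1 (D2 t Ht))|]. split; [exact (proj1 (D22 t Ht))|].
  split; [exact (proj1 (D3 t Ht))|]. split; [exact (proj1 (D1 t Ht))|].
  split; [exact (proj1 (D11 t Ht))|]. split; [exact (proj1 (D111 t Ht))|].
  split; [exact (proj1 (DF t Ht))|].
  rewrite (proj2 (D22 t Ht)), (proj2 (DF t Ht)). apply KP.
Qed.

Lemma admissible_rapid t : admissible_times t -> rapid (xi_coeff t).
Proof.
  intros [G [[F HF] HG]]. apply smooth_disk_series_rapid with G F; [exact HF|].
  intros z Hz. now apply is_pseries_Cseries, HG.
Qed.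

Theorem proposition6 :
  forall (f : C -> C) (c : nat -> C),
    univalent_embedding f c ->
    (forall t : nat -> C, regular_times c t ->
       is_Baker_Akhiezer (W_T1 c)
         (fun z => Cexp (xi t z))
         (fun z => Cexp (xi t z) * (1 + omega c t / z))%C) ->
    (forall t : nat -> C, regular_times c t ->
       ex_pd 1 (A_fun c) t /\ ex_pd 1 (pd 1 (A_fun c)) t /\
       ex_pd 1 (omega c) t /\
       pd 1 (omega c) t
       = (pd 1 (pd 1 (A_fun c)) t / (1 - A_fun c t)
          + (pd 1 (A_fun c) t / (1 - A_fun c t)) ^ 2)%C) /\
    KP_solution (regular_times c) (fun t => - pd 1 (omega c) t)%C.
Proof.
  intros f c Hf _.
  destruct (A_fun_linear f c Hf) as [L [LB [HL HA]]].
  assert (Reg : forall t, regular_times c t -> good_times L t).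
  { intros t [Ht H0]. apply admissible_rapid in Ht. split; auto. now rewrite <- HA. }
  assert (PA : forall t, good_times L t -> ex_pd 1 (A_fun c) t /\ pd 1 (A_fun c) t = A_lin L 1 t).
  { intros t Ht. apply has_pd_pd with L; auto.
    apply has_pd_ext with LB (A_lin L 0); auto.
    - intros u [Hu _]. symmetry. auto.
    - intros u [Hu _]. now apply (A_lin_derive L LB 0 1). }
  assert (PAA : forall t, good_times L t -> ex_pd 1 (pd 1 (A_fun c)) t /\ pd 1 (pd 1 (A_fun c)) t = A_lin L 2 t).
  { intros t Ht. apply has_pd_pd with L; auto.
    apply has_pd_ext with LB (A_lin L 1); auto.
    - intros u Hu. symmetry. now apply PA.
    - intros u [Hu _]. now apply (A_lin_derive L LB 1 1). }
  assert (Eo : forall t, good_times L t -> omega c t = eval L (Ratio 1) t).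
  { intros t Ht. unfold omega. rewrite (proj2 (PA t Ht)), HA by apply Ht. reflexivity. }
  assert (Po := eval_pd_eq L LB 1 (omega c) (Ratio 1) HL (le_n 1) Eo).
  split.
  - intros t Ht. apply Reg in Ht. pose proof (PA t Ht) as [H1 E1]. pose proof (PAA t Ht) as [H2 E2].
    pose proof (Po t Ht) as [H3 E3]. repeat split; auto.
    rewrite E1, E2, E3, HA by apply Ht. simpl. unfold A_ratio. ring.
  - assert (KP : KP_solution (good_times L) (fun t => - pd 1 (omega c) t)%C).
    { apply (KP_solution_eval L LB _ (Mul (Cst (-1)) (flow 1 (Ratio 1)))); auto.
      - intros t Ht. rewrite (proj2 (Po t Ht)). cbn [eval].
        replace (RtoC (-1)) with (- RtoC 1)%C by (rewrite <- RtoC_opp; reflexivity). ring.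
      (* Both sides become polynomials in [w_1, ..., w_6]; they agree with the [w_n] treated as
         independent variables. *)
      - intros t. cbn [eval flow Nat.add].
        replace (RtoC (-12)) with (- RtoC 12)%C by (rewrite <- RtoC_opp; reflexivity).
        replace (RtoC (-1)) with (- RtoC 1)%C by (rewrite <- RtoC_opp; reflexivity). ring. }
    (* The derivatives in [KP_solution] do not refer to the domain, so the result restricts from
       good to regular times. *)
    intros t Ht. apply KP. auto.
Qed.
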